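(* Set $I=[-1/2,1/2]\subseteq\mathbb{C}$. There exists a Swiss cheese $X\subseteq\mathbb{C}$ with $I\subseteq X$ such that (i) every point of $X\setminus I$ is a point of continuity for $R(X)$; (ii) for every $f\in R(X)$ the restriction of $f$ to $I$ is infinitely differentiable and satisfies $\sum_{k=1}^{\infty} |f^{(k)}|_I^{-1/k}=\infty$; and, for this $X$, $R(X)$ has no non-trivial Jensen measures, but $R(X)$ is not regular.
   Context: A Swiss cheese is a compact plane set $X$ of the form $X=\bar\Delta\setminus\bigcup_{n=1}^\infty D_n$, where $\bar\Delta=\{z\in\mathbb{C}:|z|\le 1\}$ and $(D_n)$ is a sequence of open discs in $\mathbb{C}$ (not necessarily pairwise disjoint) whose radii have finite sum. For a compact set $X\subseteq\mathbb{C}$, $R_0(X)$ is the set of restrictions to $X$ of rational functions with poles off $X$, and $R(X)$ is the closure of $R_0(X)$ in $C(X)$ for the uniform norm. It is a uniform algebra on $X$, and its character space $\Phi_{R(X)}$ is identified with $X$ via evaluation characters. Let $A$ be a uniform algebra on a compact space $X$. For $x\in X$, let $M_x$ be the ideal of functions in $A$ vanishing at $x$, and $J_x$ the ideal of functions in $A$ vanishing in a neighbourhood of $x$ (in $X$). A point $x\in X$ is a point of continuity for $A$ if there is no $y\in X\setminus\{x\}$ with $M_x\supseteq J_y$. For a character $\phi\in\Phi_A$, a Jensen measure for $\phi$ is a regular Borel probability measure $\mu$ on $X$ such that for all $f\in A$, $\log|\phi(f)|\le\int_X\log|f(x)|\,d\mu(x)$, where $\log 0=-\infty$. When $\Phi_A=X$,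 saying that $A$ has no non-trivial Jensen measures means that for every $x\in X$ the only Jensen measure for the evaluation character at $x$ is the point mass at $x$. When $\Phi_A=X$, $A$ is regular if for each closed subset $E$ of $X$ and each $x\in X\setminus E$ there is $f\in A$ with $f(x)=1$ and $f$ identically $0$ on $E$. For a bounded complex-valued function $g$ on a non-empty set $S$, $|g|_S=\sup\{|g(x)|:x\in S\}$. Here $f^{(k)}$ denotes the $k$-th derivative of the restriction of $f$ to the real interval $I$ (one-sided at the endpoints), and $0^{-1/k}$ is interpreted as $+\infty$. *)

(* Defs.v *)
(* The complex plane is R[i], for an arbitrary R : realType. *)
From HB Require Import structures.
From mathcomp Require Export all_boot all_order all_algebra.
From mathcomp Require Export complex.
From mathcomp Require Export all_classical all_reals all_analysis.

Set Implicit Arguments.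
Unset Strict Implicit.
Unset Printing Implicit Defensive.

Import Order.TTheory GRing.Theory Num.Theory.
Import numFieldNormedType.Exports.

Local Open Scope classical_set_scope.
Local Open Scope ring_scope.
Local Open Scope complex_scope.

(* The usual topology and norm of the plane. The norm `|z| lives in R[i];
   its real-valued version is Normc.normc z. *)
HB.instance Definition _ (R : realType) := NormedModule.copy R[i] R[i]^o.

Definition supnorm (R : realType) (S : set R[i]) (g : R[i] -> R[i]) : \bar R :=
  ereal_sup [set (Normc.normc (g z))%:E | z in S].

Definition swiss_cheese (R : realType) (X : set R[i]) : Prop :=
  compact X /\
  exists (c : nat -> R[i]) (r : nat -> R),
    [/\ forall n, 0 < r n,
        (\sum_(0 <= n <oo) (r n)%:E < +oo)%E
      & X = [set z | `|z| <= 1] `\` \bigcup_n ball (c n) (r n)%:C].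

(* Throughout, a function on a plane set X is represented by any map
   R[i] -> R[i] extending it: all the notions below depend only on its values
   on X. *)

Definition rational_functions (R : realType) (X : set R[i]) :
    set (R[i] -> R[i]) :=
  [set f | exists p q : {poly R[i]},
     forall z, X z -> q.[z] != 0 /\ f z = p.[z] / q.[z]].

(* R(X): the uniform closure of the rational functions with poles off X. *)
Definition rational_algebra (R : realType) (X : set R[i]) :
    set (R[i] -> R[i]) :=
  [set f | {within X, continuous f} /\
     forall e : R, 0 < e -> exists2 g, rational_functions X g &
       (supnorm X (fun z => f z - g z)%R < e%:E)%E].

Section UniformAlgebra.
Variables (R : realType) (X : set R[i]) (A : set (R[i] -> R[i])).

Definition ideal_M (x : R[i]) : set (R[i] -> R[i]) :=
  [set f | A f /\ f x = 0].

Definition ideal_J (x : R[i]) : set (R[i] -> R[i]) :=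
  [set f | A f /\ \forall z \near within X (nbhs x), f z = 0].

Definition point_of_continuity (x : R[i]) : Prop :=
  X x /\ ~ exists y, [/\ X y, y <> x & ideal_J y `<=` ideal_M x].

Definition regular_algebra : Prop :=
  forall (E : set R[i]) (x : R[i]), closed E -> E `<=` X -> (X `\` E) x ->
    exists f, [/\ A f, f x = 1 & forall z, E z -> f z = 0].

Definition borelC : Type := g_sigma_algebraType (@open R[i]).

Definition regular_measure (mu : set R[i] -> \bar R) : Prop :=
  forall B : set borelC, measurable B ->
    mu B = ereal_inf [set mu U | U in [set U : set R[i] | open U /\ B `<=` U]]
    /\
    mu B = ereal_sup [set mu K | K in [set K : set R[i] | compact K /\ K `<=` B]].

(* A Borel probability measure on X is a Borel probability measure on the plane
   carried by X. The integrand is bounded above on X, so the integral is well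
   defined in [-oo, +oo[; lne 0 = -oo. *)
Definition jensen_measure (phi : (R[i] -> R[i]) -> R[i])
    (mu : probability borelC R) : Prop :=
  [/\ mu X = 1%E, regular_measure mu &
      forall f, A f ->
        (lne (Normc.normc (phi f))%:E <=
         \int[mu]_(z in X) lne (Normc.normc (f z))%:E)%E].

Definition no_nontrivial_jensen_measure : Prop :=
  forall x, X x -> forall mu : probability borelC R,
    jensen_measure (fun f => f x) mu ->
    forall B : set borelC, measurable B -> mu B = \d_(x : borelC) B.

End UniformAlgebra.

(* Derivative of the restriction of f to S: on a nondegenerate real segment,
   the derivative with respect to the real variable, one-sided at the ends.
   The values of derive_on S f outside S are irrelevant. *)
Definition quotient_filter (R : realType) (S : set R[i]) (f : R[i] -> R[i])
    (z : R[i]) : set_system R[i] :=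
  (fun w => (f w - f z) / (w - z)) @ within S z^'.

Definition derive_on (R : realType) (S : set R[i]) (f : R[i] -> R[i])
    (z : R[i]) : R[i] :=
  lim (quotient_filter S f z).

Definition derive_on_n (R : realType) (S : set R[i]) (k : nat)
    (f : R[i] -> R[i]) : R[i] -> R[i] :=
  iter k (derive_on S) f.

Definition infinitely_derivable_on (R : realType) (S : set R[i])
    (f : R[i] -> R[i]) : Prop :=
  forall k z, S z -> cvg (quotient_filter S (derive_on_n S k f) z).

(* s^{-1/k}; since 0^-1 = +oo in \bar R, inv_root k 0 = +oo for k > 0. *)
Definition inv_root (R : realType) (k : nat) (s : \bar R) : \bar R :=
  ((s `^ (k%:R^-1)%R)^-1)%E.

Definition segmentI (R : realType) : set R[i] :=
  [set x%:C | x in `[- 2^-1, 2^-1]].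
Arguments segmentI : clear implicits.

(* Main.v *)
(* For countably many circles missing the segment I, chosen so as to separate
   any two points of the plane not both on I, remove near the j-th circle the
   small discs of a McKissick construction: off them the products of the
   factors 1 / (1 - w^n) converge uniformly to a function that vanishes
   exactly outside the circle. This gives the points of continuity, and makes
   every Jensen measure for x null on X \ {x}: a measure charging a set where
   a function f with f(x) <> 0 vanishes violates Jensen's inequality, and on I
   the polynomial 1 - (z - x)^2 peaks at x.

   The total radius eps_j of the discs near the j-th circle can be prescribed
   as small as we please compared with the distance delta_j from these discs
   to I. By the Cauchy formula, discretised over roots of unity, every f in
   R(X) is on I a uniform limit of sums of c / (w - x) in which the total mass
   of the coefficients c attached to the j-th circle is O(eps_j). Hence f is
   smooth on I, and its derivatives up to an order b_N are bounded as if the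
   poles stayed at distance delta_N from I, where b_N is so large that the
   harmonic sum up to b_N outweighs N times the relevant power of 1 / delta_N.
   Moreover, away from I the kernel 1 / (w - 1/2) is a uniform limit of
   combinations of kernels 1 / (w - x) with x in [-1/2, 0]; if eps_j also
   beats the size of their coefficients, every f in R(X) that is zero on
   [-1/2, 0] vanishes at 1/2, so that R(X) is not regular. *)

Require Import Defs.
From mathcomp Require Import ring lra zify cyclic separable cyclotomic.
Set Implicit Arguments.
Unset Strict Implicit.
Unset Printing Implicit Defensive.
Import Order.TTheory GRing.Theory Num.Theory.
Import numFieldNormedType.Exports.
Local Open Scope classical_set_scope.
Local Open Scope ring_scope.
Local Open Scope complex_scope.

(** Cauchy's formula asks for finitely many boundary circles that do not meet, whereas the holes are
    infinitely many and overlap in an uncontrolled way. For a rational function bounded on X,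
    compactness leaves finitely many holes; these are merged into larger discs with disjoint
    closures, and a disc reaching the outer circle is discarded by shrinking that circle. Each disc
    carries a level and a merged disc keeps the smaller one, so the sum of the radii weighted by any
    nondecreasing function of the level never grows. The estimates on I are instances of this one
    inequality, the weight being a power of the inverse distance, the indicator of the high levels,
    or a bound for a kernel.

    The radii are chosen last. Each demand made on them for an index N concerns only the levels j >=
    N, so that a given level faces finitely many demands.

    Non-regularity does not pass through the Denjoy-Carleman theorem, although the divergence in
    (ii) suggests it: approximating one kernel by others gives it directly from the Cauchy sums. *)

Definition cnorm (R : realType) (z : R[i]) : R := Normc.normc z.

(** * The real-valued modulus and the topology of the plane *)

Section ComplexNorm.
Variable R : realType.
Implicit Types z w c : R[i].

Lemma norm_cnorm z : `|z| = (cnorm z)%:C.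
Proof. by []. Qed.

Lemma cnorm_ge0 z : 0 <= cnorm z.
Proof. by rewrite -lecR -norm_cnorm normr_ge0. Qed.

Lemma cnormD z w : cnorm (z + w) <= cnorm z + cnorm w.
Proof. by rewrite -lecR rmorphD -!norm_cnorm ler_normD. Qed.

Lemma cnormN z : cnorm (- z) = cnorm z.
Proof. by apply: (@complexI R); rewrite -!norm_cnorm normrN. Qed.

Lemma cnormB z w : cnorm (z - w) <= cnorm z + cnorm w.
Proof. by rewrite -(cnormN w) cnormD. Qed.

Lemma cdistC z w : cnorm (z - w) = cnorm (w - z).
Proof. by rewrite -cnormN opprB. Qed.

Lemma cdistD c z w : cnorm (z - w) <= cnorm (z - c) + cnorm (c - w).
Proof. by rewrite -[z - w](subrKA c) cnormD. Qed.

Lemma cnormM z w : cnorm (z * w) = cnorm z * cnorm w.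
Proof. exact: Normc.normcM. Qed.

Lemma cnormV z : cnorm z^-1 = (cnorm z)^-1.
Proof. exact: Normc.normcV. Qed.

Lemma cnorm0 : cnorm (0 : R[i]) = 0.
Proof. exact: Normc.normc0. Qed.

Lemma cnorm1 : cnorm (1 : R[i]) = 1.
Proof. exact: Normc.normc1. Qed.

Lemma cnormX z n : cnorm (z ^+ n) = cnorm z ^+ n.
Proof. by elim: n => [|n IH]; rewrite ?expr0 ?cnorm1 // !exprS cnormM IH. Qed.

Lemma cnorm_eq0 z : (cnorm z == 0) = (z == 0).
Proof.
apply/eqP/eqP => [|->]; [exact: Normc.eq0_normc | exact: cnorm0].
Qed.

Lemma cnorm_gt0 z : (0 < cnorm z) = (z != 0).
Proof. by rewrite lt_neqAle cnorm_ge0 andbT eq_sym cnorm_eq0. Qed.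

Lemma cnorm_real (x : R) : cnorm x%:C = `|x|.
Proof. by rewrite /cnorm /= expr0n addr0 sqrtr_sqr. Qed.

Lemma cnorm_nat n : cnorm (n%:R : R[i]) = n%:R.
Proof. by rewrite -(rmorph_nat (real_complex R)) cnorm_real ger0_norm. Qed.

Lemma cnorm_sum (I : Type) (s : seq I) (P : pred I) (F : I -> R[i]) :
  cnorm (\sum_(i <- s | P i) F i) <= \sum_(i <- s | P i) cnorm (F i).
Proof.
elim/big_rec2: _ => [|i x y _ le_yx]; first by rewrite cnorm0.
by rewrite (le_trans (cnormD _ _)) // lerD2l.
Qed.

Lemma cnorm_le_ReIm z : cnorm z <= `|complex.Re z| + `|complex.Im z|.
Proof.
case: z => a b; rewrite /cnorm /= -[leRHS]ger0_norm ?addr_ge0 // -sqrtr_sqr ler_wsqrtr //.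
rewrite sqrrD !real_normK ?num_real //.
by rewrite -addrA lerD2l lerDr mulrn_wge0 // mulr_ge0.
Qed.

Lemma Re_le_cnorm z : `|complex.Re z| <= cnorm z.
Proof. by rewrite -lecR; exact: normc_ge_Re. Qed.

Lemma Im_le_cnorm z : `|complex.Im z| <= cnorm z.
Proof.
case: z => a b; rewrite /cnorm /= -sqrtr_sqr ler_wsqrtr //.
by rewrite lerDr sqr_ge0.
Qed.

Lemma cnorm_distl z w : `|cnorm z - cnorm w| <= cnorm (z - w).
Proof.
rewrite ler_norml; apply/andP; split.
  by have := cnormD (w - z) z; rewrite subrK cdistC; lra.
by have := cnormD (z - w) w; rewrite subrK; lra.
Qed.

Lemma ballE c (r : R) z : ball c r%:C z <-> cnorm (z - c) < r.
Proof. by rewrite -ball_normE /ball_ /= cdistC ltcR. Qed.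

Lemma nbhs_cnormP z (P : set R[i]) :
  nbhs z P <-> exists2 e : R, 0 < e & forall w, cnorm (w - z) < e -> P w.
Proof.
split=> [/nbhs_ballP[e e0 eP]|[e e0 eP]].
  have /complex_realP[e' ee'] : e \is Num.real by rewrite realE ltW.
  move: e0 eP; rewrite ee' /= ltcR => e0 eP.
  by exists e' => // w /ballE; exact: eP.
by apply/nbhs_ballP; exists e%:C => /=; [rewrite ltcR|move=> w /ballE; exact: eP].
Qed.

Lemma continuous_cnormP (f : R[i] -> R[i]) z :
  {for z, continuous f} <->
  forall e : R, 0 < e -> exists2 d : R, 0 < d &
    forall w, cnorm (w - z) < d -> cnorm (f w - f z) < e.
Proof.
split=> [fz e e0|H].
  have /fz /nbhs_cnormP : nbhs (f z) [set w | cnorm (w - f z) < e].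
    by apply/nbhs_cnormP; exists e.
  by case=> d d0 dP; exists d.
move=> P /nbhs_cnormP[e e0 eP]; have [d d0 dP] := H e e0.
by apply/nbhs_cnormP; exists d => // w /dP; exact: eP.
Qed.

Lemma within_continuous_cnormP (X : set R[i]) (f : R[i] -> R[i]) :
  {within X, continuous f} <->
  forall z, X z -> forall e : R, 0 < e -> exists2 d : R, 0 < d &
    forall w, X w -> cnorm (w - z) < d -> cnorm (f w - f z) < e.
Proof.
split=> [/subspace_continuousP fX z Xz e e0|H].
  have fze : nbhs (f z) [set w | cnorm (w - f z) < e].
    by apply/nbhs_cnormP; exists e.
  have /nbhs_cnormP[d d0 dP] :
    nbhs z [set w | X w -> cnorm (f w - f z) < e] := fX z Xz _ fze.
  by exists d => // w Xw wz; exact: dP.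
apply/subspace_continuousP => z Xz P /nbhs_cnormP[e e0 eP].
have [d d0 dP] := H z Xz e e0.
apply/nbhs_cnormP; exists d => // w wz Xw; apply: eP; exact: dP.
Qed.

Lemma continuous_cnorm : continuous (@cnorm R : R[i] -> R).
Proof.
move=> z P /nbhs_ballP[e /= e0 eP]; apply/nbhs_cnormP; exists e => // w wz.
by apply: eP; rewrite /ball /= distrC (le_lt_trans (cnorm_distl _ _)).
Qed.

Lemma horner_bounded (p : {poly R[i]}) (r : R) : 0 <= r ->
  exists2 B : R, 0 <= B & forall w, cnorm w <= r -> cnorm p.[w] <= B.
Proof.
move=> r0; elim/poly_ind: p => [|p c [B B0 IH]].
  by exists 0 => // w _; rewrite horner0 cnorm0.
exists (B * r + cnorm c); first by rewrite addr_ge0 ?mulr_ge0 ?cnorm_ge0.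
move=> w wr; rewrite hornerD hornerM hornerX hornerC (le_trans (cnormD _ _)) //.
by rewrite lerD2r cnormM ler_pM ?cnorm_ge0 ?IH.
Qed.

Lemma continuous_horner (p : {poly R[i]}) : continuous (fun z => p.[z]).
Proof.
move=> z; apply/continuous_cnormP => e e0.
have : root (p - p.[z]%:P) z by rewrite rootE !hornerE subrr.
move=> /factor_theorem[q pq].
have [B B0 qB] : exists2 B : R, 0 <= B &
    forall w, cnorm w <= cnorm z + 1 -> cnorm q.[w] <= B.
  by apply: horner_bounded; rewrite addr_ge0 ?cnorm_ge0.
exists (Num.min 1 (e / (B + 1))).
  by rewrite lt_min ltr01 divr_gt0 // ltr_wpDl.
move=> w; rewrite lt_min ltr_pdivlMr ?ltr_wpDl // => /andP[w1 we].
have -> : p.[w] - p.[z] = q.[w] * (w - z).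
  by have := congr1 (horner^~ w) pq; rewrite !hornerE.
have : cnorm q.[w] <= B.
  by apply: qB; rewrite -[w](subrK z) (le_trans (cnormD _ _)) //; lra.
rewrite cnormM => qwB; apply: le_lt_trans we; rewrite mulrC ler_wpM2l ?cnorm_ge0 //.
by rewrite ler_wpDr.
Qed.

Lemma compact_unit_square : compact [set z : R[i] | `|complex.Re z| <= 1 /\ `|complex.Im z| <= 1].
Proof.
have -> : [set z : R[i] | `|complex.Re z| <= 1 /\ `|complex.Im z| <= 1] =
    (fun p : R * R => p.1 +i* p.2) @` (`[-1, 1] `*` `[-1, 1]).
  apply/seteqP; split=> [[a b] [/= a1 b1]|_ [[a b] [/= a1 b1]] <-] /=.
    by exists (a, b) => //=; rewrite !in_itv /= -!ler_norml.
  by move: a1 b1; rewrite !in_itv /= -!ler_norml.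
apply: continuous_compact; last first.
  by apply: compact_setX; exact: segment_compact.
apply: continuous_subspaceT => -[a b] P /nbhs_cnormP[e e0 eP].
exists (ball a (e / 2), ball b (e / 2)) => /=.
  by split; apply: nbhsx_ballx; rewrite divr_gt0.
move=> [x y] [/= xa yb]; apply: eP.
rewrite (le_lt_trans (cnorm_le_ReIm _)) //=.
move: xa yb; rewrite /ball /= !(distrC _ a) !(distrC _ b).
by lra.
Qed.

Lemma compact_sub_unit_disc (A : set R[i]) :
  closed A -> A `<=` [set z | cnorm z <= 1] -> compact A.
Proof.
move=> cA A1; apply: (subclosed_compact cA compact_unit_square) => z /A1 /= z1.
by split; rewrite (le_trans _ z1) // ?Re_le_cnorm ?Im_le_cnorm.
Qed.

End ComplexNorm.

(** * Roots of unity: orthogonality and partial fractions *)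

Section RootsOfUnity.
Variable R : realType.
Implicit Types (w z : R[i]) (n : nat).

Lemma prim_root_exists n : (0 < n)%N -> exists om : R[i], n.-primitive_root om.
Proof.
move=> n0; pose p : {poly R[i]} := 'X^n - 1.
have [r Dp] := closed_field_poly_normal p.
move: Dp; rewrite (monicP _) ?monicXnsubC // scale1r => Dp.
have rn1 : all n.-unity_root r.
  by apply/allP => z; rewrite -root_prod_XsubC -Dp.
have sz_r : (n < (size r).+1)%N.
  by rewrite -(size_prod_XsubC r id) -Dp size_XnsubC.
have [|z] := hasP (has_prim_root n0 rn1 _ sz_r); last by exists z.
by rewrite -separable_prod_XsubC -Dp separable_Xn_sub_1 // pnatr_eq0 -lt0n.
Qed.

Lemma cnorm_unity_root n z : (0 < n)%N -> z ^+ n = 1 -> cnorm z = 1.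
Proof.
move=> n0 /(congr1 (@cnorm R)); rewrite cnormX cnorm1 => /eqP.
by rewrite pexpr_eq1 ?cnorm_ge0 // => /eqP.
Qed.

Lemma cnorm_prim_root n om k : n.-primitive_root om -> cnorm (om ^+ k : R[i]) = 1.
Proof.
move=> pom; rewrite cnormX (cnorm_unity_root (prim_order_gt0 pom)) ?expr1n //.
exact: prim_expr_order.
Qed.

Lemma sum_expr_eq0 n z : z ^+ n = 1 -> z != 1 -> \sum_(k < n) z ^+ k = 0.
Proof.
move=> zn z1; have := subrX1 z n; rewrite zn subrr => /esym/eqP.
by rewrite mulf_eq0 subr_eq0 (negPf z1) => /eqP.
Qed.

Lemma sum_prim_rootX n om j : n.-primitive_root om ->
  \sum_(k < n) (om ^+ k) ^+ j = if (n %| j)%N then n%:R else 0 :> R[i].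
Proof.
move=> pom; under eq_bigr do rewrite exprAC.
case: ifPn => nj.
  rewrite (prim_order_dvd pom) in nj; rewrite (eqP nj).
  by under eq_bigr do rewrite expr1n; rewrite sumr_const card_ord.
apply: sum_expr_eq0; last by rewrite -(prim_order_dvd pom).
by rewrite exprAC (prim_expr_order pom) expr1n.
Qed.

Lemma inv_prim_root n om : n.-primitive_root om -> n.-primitive_root (om^-1 : R[i]).
Proof.
move=> pom; have n0 := prim_order_gt0 pom.
have -> : om^-1 = om ^+ n.-1.
  have om0 : om != 0 by rewrite (prim_root_eq0 pom) -lt0n.
  by apply: (mulfI om0); rewrite mulfV // -exprS prednK // prim_expr_order.
by rewrite (prim_root_exp_coprime _ pom) coprimePn.
Qed.

(* Partial fractions of [1 / (1 - w^n)]: this is what bounds a switching factor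
   off small discs around the [n]-th roots of unity. *)
Lemma avg_inv_subr1 n om w : n.-primitive_root om -> w ^+ n != 1 ->
  n%:R^-1 * (\sum_(k < n) (1 - w / om ^+ k)^-1) = (1 - w ^+ n)^-1.
Proof.
move=> pom wn1; have n0 := prim_order_gt0 pom.
have w1 : 1 - w ^+ n != 0 by rewrite subr_eq0 eq_sym.
have E k : (1 - w / om ^+ k)^-1 =
    (1 - w ^+ n)^-1 * \sum_(j < n) w ^+ j * (om^-1 ^+ k) ^+ j.
  set u := w / _; have un : u ^+ n = w ^+ n.
    by rewrite /u exprMn exprVn exprAC (prim_expr_order pom) expr1n invr1 mulr1.
  have u1 : 1 - u != 0.
    apply: contraNneq wn1 => /eqP; rewrite subr_eq0 => /eqP u1.
    by rewrite -un -u1 expr1n.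
  under eq_bigr do rewrite exprVn -exprMn -/u.
  have uS : 1 - w ^+ n = (1 - u) * \sum_(j < n) u ^+ j.
    by rewrite -un -opprB subrX1 -mulNr opprB.
  move: w1; rewrite uS mulf_eq0 negb_or => /andP[_ S0].
  by rewrite invfM -mulrA mulVf ?mulr1.
under eq_bigr do rewrite E.
rewrite -mulr_sumr exchange_big /=.
under eq_bigr => j _ do rewrite -mulr_sumr (sum_prim_rootX _ (inv_prim_root pom)).
have -> : \sum_(j < n) w ^+ j * (if (n %| j)%N then n%:R else 0) = n%:R.
  rewrite (bigD1 (Ordinal n0)) //= dvdn0 expr0 mul1r big1 ?addr0 // => i i0.
  by rewrite gtnNdvd ?mulr0 // lt0n.
by rewrite mulrCA mulVf ?mulr1 // pnatr_eq0 -lt0n.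
Qed.

(** The left side is a mean of [n] terms of modulus at most [rho^-1], so the bound does not
    deteriorate with the number of poles. *)
Lemma cnorm_inv_1subX n om w (rho : R) : n.-primitive_root om -> 0 < rho ->
  (forall k, (k < n)%N -> rho <= cnorm (1 - w / om ^+ k)) ->
  w ^+ n != 1 /\ cnorm (1 - w ^+ n)^-1 <= rho^-1.
Proof.
move=> pom rho0 H; have n0 := prim_order_gt0 pom.
have wn1 : w ^+ n != 1.
  apply/eqP => /(prim_rootP pom)[i wi]; have := H i (ltn_ord i).
  rewrite wi divff ?subrr ?cnorm0; first by rewrite leNgt rho0.
  by rewrite -cnorm_gt0 (cnorm_prim_root _ pom).
split=> //; rewrite -(avg_inv_subr1 pom wn1) cnormM cnormV cnorm_nat.
rewrite ler_pdivrMl ?ltr0n // (le_trans (cnorm_sum _ _ _)) //.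
rewrite mulr_natl -[n in leRHS]card_ord -sumr_const ler_sum // => k _.
by rewrite cnormV lef_pV2 ?posrE ?(lt_le_trans rho0) // H.
Qed.

End RootsOfUnity.

(** * Completeness of the plane and geometric convergence *)

Section ComplexSequences.
Variable R : realType.
Implicit Types (u : nat -> R[i]).

Lemma exp2V_lt (e : R) : 0 < e -> exists n, 2 ^- n < e.
Proof.
move=> e0; exists (Num.bound e^-1).
rewrite invf_plt ?posrE ?exprn_gt0 //.
apply: (lt_trans (archi_boundP _)); first by rewrite invr_ge0 ltW.
by rewrite -natrX ltr_nat ltn_expl.
Qed.

Lemma real_cauchy_cvg (u : nat -> R) :
  (forall e : R, 0 < e -> exists N, forall m n, (N <= m)%N -> (N <= n)%N ->
     `|u m - u n| < e) ->
  exists l, forall e : R, 0 < e -> exists N, forall n, (N <= n)%N -> `|u n - l| < e.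
Proof.
move=> H; have /cauchy_cvgP/cvg_ex[l ul] : cauchy (u @ \oo).
  apply/cauchy_ballP => e e0; have [N NP] := H e e0.
  exists ([set x | exists2 n, (N <= n)%N & u n = x], [set x | exists2 n, (N <= n)%N & u n = x])
      => /=.
    by split; exists N => // n /= Nn; exists n.
  by move=> [x y] /= [[m Nm <-] [n Nn <-]]; exact: NP.
exists l => e e0; have /cvgrPdist_lt/(_ e e0)[N _ NP] := ul.
by exists N => n Nn; rewrite distrC; exact: NP.
Qed.

Lemma complex_cauchy_cvg u :
  (forall e : R, 0 < e -> exists N, forall m n, (N <= m)%N -> (N <= n)%N ->
     cnorm (u m - u n) < e) ->
  exists l, forall e : R, 0 < e -> exists N, forall n, (N <= n)%N -> cnorm (u n - l) < e.
Proof.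
move=> H.
have [|a aP] := @real_cauchy_cvg (fun n => complex.Re (u n)).
  move=> e /H[N NP]; exists N => m n Nm Nn; rewrite -raddfB.
  by rewrite (le_lt_trans (Re_le_cnorm _)) // NP.
have [|b bP] := @real_cauchy_cvg (fun n => complex.Im (u n)).
  move=> e /H[N NP]; exists N => m n Nm Nn; rewrite -raddfB.
  by rewrite (le_lt_trans (Im_le_cnorm _)) // NP.
exists (a +i* b) => e e0; have e2 : 0 < e / 2 by rewrite divr_gt0.
have [N1 N1P] := aP _ e2; have [N2 N2P] := bP _ e2.
exists (maxn N1 N2) => n; rewrite geq_max => /andP[n1 n2].
rewrite (le_lt_trans (cnorm_le_ReIm _)) //.
have := N1P n n1; have := N2P n n2; rewrite !raddfB /=. lra.
Qed.

Lemma le_of_cvg u (l x : R[i]) (B : R) :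
  (forall e : R, 0 < e -> exists N, forall n, (N <= n)%N -> cnorm (u n - l) < e) ->
  (exists N, forall n, (N <= n)%N -> cnorm (u n - x) <= B) ->
  cnorm (l - x) <= B.
Proof.
move=> ul [N1 uB]; apply/ler_addgt0Pr => e /ul[N2 N2P].
have := N2P _ (leq_maxr N1 N2); have := uB _ (leq_maxl N1 N2).
by have := cdistD (u (maxn N1 N2)) l x; rewrite (cdistC l (u _)); lra.
Qed.

Lemma complex_fast_cvg u (K : R) : 0 <= K ->
  (forall s, cnorm (u s.+1 - u s) <= K * 2 ^- s) ->
  exists l, forall s, cnorm (l - u s) <= 2 * K * 2 ^- s.
Proof.
move=> K0 H.
have D s m : cnorm (u (s + m)%N - u s) <= 2 * K * 2 ^- s - 2 * K * 2 ^- (s + m).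
  elim: m => [|m IH]; first by rewrite addn0 !subrr cnorm0.
  have E : 2 ^- (s + m).+1 = 2 ^- (s + m) / 2 :> R by rewrite exprS invfM mulrC.
  have := H (s + m)%N; have := cdistD (u (s + m)%N) (u (s + m).+1) (u s).
  by rewrite addnS E; lra.
have D' s m : (s <= m)%N -> cnorm (u m - u s) <= 2 * K * 2 ^- s.
  move=> sm; have := D s (m - s)%N; rewrite subnKC // => /le_trans; apply.
  by rewrite lerBlDr lerDl mulr_ge0 ?mulr_ge0 ?invr_ge0 ?exprn_ge0.
have [|l lP] := @complex_cauchy_cvg u.
  move=> e e0; have [|N Ne] := @exp2V_lt (e / (4 * K + 1)).
    by rewrite divr_gt0 // ltr_wpDl // mulr_ge0.
  exists N => m n Nm Nn; rewrite (le_lt_trans (cdistD (u N) _ _)) //.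
  rewrite ltr_pdivlMr ?ltr_wpDl ?mulr_ge0 // in Ne.
  have := D' _ _ Nm; have := D' _ _ Nn; rewrite (cdistC (u N) (u n)).
  have : 0 < 2 ^- N :> R by rewrite invr_gt0 exprn_gt0.
  by set y := 2 ^- N in Ne *; lra.
exists l => s; apply: (le_of_cvg lP); exists s => n; exact: D'.
Qed.

End ComplexSequences.

(** * McKissick's switching functions *)

Section SwitchingProduct.
Variables (R : realType) (h : nat -> R[i]) (inn : nat -> bool).
Variables (C eta : nat -> R).
(* At a fixed point [z], [inn s] says that [z] is in the [s]-th of an increasing
   sequence of discs, where the [s]-th factor [h s] is almost 1. *)
Hypothesis innS : forall s, inn s -> inn s.+1.
Hypothesis near1 : forall s, inn s -> cnorm (h s - 1) <= 2 ^- s.+2.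
Hypothesis le_C : forall s, cnorm (h s) <= C s.
Hypothesis le_eta : forall s, ~~ inn s.+1 -> cnorm (h s) <= eta s.
Hypothesis eta_small : forall s, eta s <= 2 ^- s.+1.
Hypothesis eta_C : forall s, eta s * C s.+1 <= 2 ^- s.+1.

Let P s := \prod_(t < s) h t.

Let C_ge0 s : 0 <= C s. Proof. exact: le_trans (cnorm_ge0 _) (le_C s). Qed.

Let PS s : P s.+1 = P s * h s. Proof. by rewrite /P big_ord_recr. Qed.

Let e2_le1 s : 2 ^- s <= 1 :> R.
Proof. by rewrite invf_le1 ?exprn_gt0 // exprn_ege1 // ler1n. Qed.

Let e2_gt0 s : 0 < 2 ^- s :> R.
Proof. by rewrite invr_gt0 exprn_gt0. Qed.

Let e2S s : 2 ^- s.+1 = 2 ^- s / 2 :> R.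
Proof. by rewrite exprS invfM mulrC. Qed.

Let out_le s : ~~ inn s.+1 -> cnorm (P s) <= 1 /\ cnorm (P s.+1) <= eta s.
Proof.
elim: s => [|s IH] outs.
  by rewrite PS /P big_ord0 mul1r cnorm1; split=> //; exact: le_eta.
have /IH[_ Ps] : ~~ inn s.+1 by apply: contra outs; exact: innS.
have Ps1 : cnorm (P s.+1) <= 1 by rewrite (le_trans Ps) ?(le_trans (eta_small _)).
split=> //; rewrite [P s.+2]PS cnormM -[leRHS]mul1r.
by rewrite ler_pM ?cnorm_ge0 ?le_eta.
Qed.

Let out_le1 s : ~~ inn s -> cnorm (P s) <= 2 ^- s.
Proof.
case: s => [|s] outs; first by rewrite /P big_ord0 cnorm1 expr0 invr1.
by have [_ /le_trans] := out_le outs; apply.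
Qed.

(** The point may enter the discs at [s.+1], and then [h s] is only bounded by [C s]. The preceding
    factor, still in the far regime, pays for it through [eta_C]. At [s = 0] there is no preceding
    factor, whence the constant [1 + C 0]. *)
Let out_leS s : ~~ inn s -> cnorm (P s.+1) <= (1 + C 0) * 2 ^- s.
Proof.
rewrite PS cnormM; case: s => [|s] outs.
  rewrite /P big_ord0 cnorm1 mul1r expr0 invr1 mulr1.
  by rewrite (le_trans (le_C _)) // lerDr.
have [_ Ps] := out_le outs.
apply: (@le_trans _ _ (2 ^- s.+1)); last by rewrite ler_peMl ?lerDl // ltW.
by apply: le_trans (eta_C s); rewrite ler_pM ?cnorm_ge0.
Qed.

(** The slack [2 - 2 ^- s] grows just enough to absorb a factor [1 + 2 ^- s.+2] at each step while
    the bound stays below [2 * (1 + C 0)]. *)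
Let in_le s : inn s -> cnorm (P s) <= (1 + C 0) * (2 - 2 ^- s).
Proof.
have C0 := C_ge0 0; elim: s => [|s IH] ins.
  by rewrite /P big_ord0 cnorm1 expr0 invr1; lra.
have e2 := e2_gt0 s; have e1 := e2_le1 s.
have [{}ins|outs] := boolP (inn s); last first.
  rewrite (le_trans (out_leS outs)) // ler_wpM2l ?addr_ge0 // e2S; lra.
have hs : cnorm (h s) <= 1 + 2 ^- s.+2.
  have := near1 ins; have := cnormD (h s - 1) 1; rewrite subrK cnorm1; lra.
rewrite PS cnormM (le_trans (ler_pM _ _ (IH ins) hs)) ?cnorm_ge0 //.
rewrite -mulrA ler_wpM2l ?addr_ge0 // !e2S; nra.
Qed.

Lemma switching_step s : cnorm (P s.+1 - P s) <= 2 * (1 + C 0) * 2 ^- s.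
Proof.
have C0 := C_ge0 0; have e2 := e2_gt0 s; have e1 := e2_le1 s.
have [ins|outs] := boolP (inn s).
  rewrite PS -[P s in X in _ - X]mulr1 -mulrBr cnormM.
  rewrite (le_trans (ler_pM _ _ (in_le ins) (near1 ins))) ?cnorm_ge0 //.
  rewrite -[leRHS]mulrA mulrCA -mulrA ler_wpM2l ?addr_ge0 // !e2S; nra.
have := out_leS outs; have := out_le1 outs; have := cnormB (P s.+1) (P s); nra.
Qed.

Lemma switching_cvg0 F : (forall s, cnorm (F - P s) <= 4 * (1 + C 0) * 2 ^- s) ->
  (forall s, ~~ inn s) -> F = 0.
Proof.
move=> FP out; apply/eqP; rewrite -cnorm_eq0 eq_le cnorm_ge0 andbT.
apply/ler_addgt0Pr => e e0; have C0 := C_ge0 0.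
have K0 : 0 < 4 * (1 + C 0) + 1 by lra.
have [|s se] := @exp2V_lt R (e / (4 * (1 + C 0) + 1)); first exact: divr_gt0.
rewrite ltr_pdivlMr // in se.
have := FP s; have := out_le1 (out s); have := cnormD (F - P s) (P s).
by rewrite subrK; lra.
Qed.

Lemma switching_neq0 F s0 :
  (forall s, cnorm (F - P s) <= 4 * (1 + C 0) * 2 ^- s) ->
  inn s0 -> (forall s, h s != 0) -> F != 0.
Proof.
move=> FP ins0 h0; have C0 := C_ge0 0.
have Ps0 : 0 < cnorm (P s0).
  by rewrite cnorm_gt0 /P prodf_seq_neq0; apply/allP => i _; rewrite h0.
have insm m : inn (s0 + m)%N.
  by elim: m => [|m IH]; rewrite ?addn0 // addnS; exact: innS.
(* Once inside, no factor vanishes and the later ones multiply the modulus by at least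
   [1 - 2 ^- (s0 + m).+2]. The extra power of 2 makes the induction close; half of the modulus of
   [P s0] survives in the limit. *)
have low m : cnorm (P s0) * (1 / 2 + 2 ^- (s0 + m).+1) <= cnorm (P (s0 + m)%N).
  have e2 := e2_gt0 (s0 + m); have e1 := e2_le1 (s0 + m); elim: m => [|m IH] in e2 e1 *.
    by rewrite addn0 in e2 e1 *; rewrite e2S ler_piMr ?cnorm_ge0 //; lra.
  rewrite addnS in e2 e1 *; rewrite PS cnormM.
  have e2' := e2_gt0 (s0 + m); have e1' := e2_le1 (s0 + m).
  have hs : 1 - 2 ^- (s0 + m).+2 <= cnorm (h (s0 + m)%N).
    have := near1 (insm m); have := cnormB (h (s0 + m)%N) (h (s0 + m)%N - 1).
    by rewrite subKr cnorm1; lra.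
  have {}IH := IH e2' e1'.
  apply: le_trans (ler_pM _ _ IH hs); last 2 first.
  - by rewrite mulr_ge0 ?cnorm_ge0 // !e2S; lra.
  - by rewrite !e2S; lra.
  by rewrite -mulrA ler_wpM2l ?cnorm_ge0 // !e2S; nra.
have K0 : 0 < 4 * (1 + C 0) by lra.
have [|s se] := @exp2V_lt R (cnorm (P s0) / 2 / (4 * (1 + C 0))).
  by rewrite !divr_gt0.
rewrite ltr_pdivlMr // in se.
rewrite -cnorm_gt0.
have := FP (s0 + s)%N; have := low s; have := cnormD (P (s0 + s)%N - F) F.
rewrite subrK (cdistC _ F) => P1 P2.
have : 2 ^- (s0 + s) <= 2 ^- s :> R.
  by rewrite lef_pV2 ?posrE ?exprn_gt0 // ler_weXn2l ?ler1n // leq_addl.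
have := e2_gt0 (s0 + s).+1.
move: P2; set x := 2 ^- (s0 + s).+1; set y := 2 ^- (s0 + s); set z := 2 ^- s in se *.
by move=> P2 x0 yz FP'; nra.
Qed.

Lemma switching_limit : exists F, (forall s, cnorm (F - P s) <= 4 * (1 + C 0) * 2 ^- s) /\
  ((forall s, ~~ inn s) -> F = 0) /\
  (forall s0, inn s0 -> (forall s, h s != 0) -> F != 0).
Proof.
have [||F FP] := @complex_fast_cvg R P (2 * (1 + C 0)).
- by have := C_ge0 0; lra.
- exact: switching_step.
have {}FP s : cnorm (F - P s) <= 4 * (1 + C 0) * 2 ^- s.
  by have := FP s; rewrite mulrA -natrM.
exists F; split=> //; split=> [|s0]; [exact: switching_cvg0|exact: switching_neq0].
Qed.

End SwitchingProduct.

(** * Degrees, circles and holes of the switching product *)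

Section Mckissick.
Variable R : realType.

Lemma bernoulli_ge (x : R) n : 0 <= x -> 1 + x *+ n <= (1 + x) ^+ n.
Proof.
move=> x0; elim: n => [|n IH]; first by rewrite mulr0n addr0 expr0.
rewrite exprS (le_trans _ (ler_wpM2l _ IH)) ?addr_ge0 // mulrS.
have : 0 <= x * x *+ n by rewrite mulrn_wge0 // mulr_ge0.
by rewrite -mulrnAr; lra.
Qed.

Lemma exp2_ge_linear n : (5 <= n)%N -> (5 * n + 5 <= 2 ^ n)%N.
Proof.
elim: n => // n IH; rewrite leq_eqVlt => /orP[/eqP <- //|n5].
by have := IH n5; rewrite expnS; lia.
Qed.

(** By Bernoulli the exponent [2 ^ q] already yields 2. The remaining exponent makes the gain doubly
    exponential in [e], while the number [2 ^ (q + e)] of poles is only exponential in it: this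
    disproportion is what makes tiny holes affordable. *)
Lemma pow_1exp2V_ge q e : 2 ^+ (2 ^ e) <= (1 + 2 ^- q) ^+ (2 ^ (q + e)) :> R.
Proof.
have q0 : 0 <= 2 ^- q :> R by rewrite invr_ge0 exprn_ge0.
rewrite expnD exprM lerXn2r ?nnegrE ?exprn_ge0 ?addr_ge0 //.
apply: le_trans (bernoulli_ge _ q0).
have -> : 2 ^- q *+ 2 ^ q = 1 :> R.
  by rewrite -[LHS]mulr_natr natrX mulVf // expf_neq0 // pnatr_eq0.
by [].
Qed.

Section Factor.
Variables (q e : nat) (w : R[i]).
Let n := (2 ^ (q + e))%N.
Let Y : R := 2 ^+ (2 ^ e).

Let Y2 : 2 <= Y.
Proof. by rewrite -[leLHS]expr1 ler_weXn2l ?ler1n // expn_gt0. Qed.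

Lemma switch_near1 : cnorm w <= (1 + 2 ^- q)^-1 ->
  cnorm ((1 - w ^+ n)^-1 - 1) <= 2 / Y.
Proof.
move=> w1; have wn : cnorm (w ^+ n) <= Y^-1.
  have q0 : 0 < 1 + 2 ^- q :> R by rewrite addr_gt0 // invr_gt0 exprn_gt0.
  rewrite cnormX (le_trans (lerXn2r n _ _ w1)) ?nnegrE ?cnorm_ge0 ?invr_ge0 ?(ltW q0) //.
  by rewrite exprVn lef_pV2 ?posrE ?exprn_gt0 // pow_1exp2V_ge.
have Y1 : Y^-1 <= 2^-1 by rewrite lef_pV2 ?posrE ?(lt_le_trans _ Y2).
set v := w ^+ n in wn *.
have v1 : 1 / 2 <= cnorm (1 - v).
  by have := cnormD (1 - v) v; rewrite subrK cnorm1; lra.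
have v0 : 1 - v != 0 by rewrite -cnorm_gt0; lra.
have -> : (1 - v)^-1 - 1 = v / (1 - v).
  by apply: (mulIf v0); rewrite mulrBl mulVf // mul1r subKr divfK.
rewrite cnormM cnormV ler_pdivrMr ?(lt_le_trans _ v1) ?divr_gt0 //.
by have := cnorm_ge0 v; nra.
Qed.

Lemma switch_far : 1 + 2 ^- q <= cnorm w -> cnorm (1 - w ^+ n)^-1 <= 2 / Y.
Proof.
move=> w1; have wn : Y <= cnorm (w ^+ n).
  have q0 : 0 < 1 + 2 ^- q :> R by rewrite addr_gt0 // invr_gt0 exprn_gt0.
  rewrite cnormX; apply: (le_trans (pow_1exp2V_ge q e)).
  by rewrite lerXn2r ?nnegrE ?cnorm_ge0 ?(ltW q0).
set v := w ^+ n in wn *.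
have v1 : Y / 2 <= cnorm (1 - v).
  by have := cnormD (v - 1) 1; have := Y2; rewrite subrK cnorm1 (cdistC v); lra.
have Y0 : 0 < Y by have := Y2; lra.
have Y20 : 0 < Y / 2 by rewrite divr_gt0.
rewrite cnormV -[leRHS]invrK invf_div lef_pV2 ?posrE //.
exact: lt_le_trans v1.
Qed.

End Factor.

Section Radii.
Variables (R0 : R) (A : nat).
Hypothesis (R0_gt0 : 0 < R0) (A_gt0 : (0 < A)%N).

(** The odd indices give the circles carrying the poles and the even ones the discs in which a point
    is located: the poles of the [s]-th factor lie between the discs [s] and [s.+1]. *)
Definition nested_radius i := R0 * (1 - 2 ^- (A + i)).

Let e2_le i : 2 ^- (A + i) <= 1 / 2 :> R.
Proof.
rewrite div1r lef_pV2 ?posrE ?exprn_gt0 // -[leLHS]expr1 ler_weXn2l ?ler1n //.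
by rewrite addn_gt0 A_gt0.
Qed.

Lemma nested_radius_gt0 i : 0 < nested_radius i.
Proof. by have := e2_le i; rewrite /nested_radius => ?; rewrite mulr_gt0 //; lra. Qed.

Lemma nested_radius_lt i : nested_radius i < R0.
Proof.
by rewrite /nested_radius gtr_pMr // ltrBlDr ltrDl invr_gt0 exprn_gt0.
Qed.

Lemma nested_radius_ge i : R0 * (1 - 2 ^- A) <= nested_radius i.
Proof.
rewrite /nested_radius ler_wpM2l ?(ltW R0_gt0) // lerB //.
by rewrite lef_pV2 ?posrE ?exprn_gt0 // ler_weXn2l ?ler1n // leq_addr.
Qed.

Lemma nested_radius_step i :
  nested_radius i * (1 + 2 ^- (A + i).+1) <= nested_radius i.+1.
Proof.
rewrite /nested_radius -mulrA ler_wpM2l ?(ltW R0_gt0) // addnS.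
have -> : 2 ^- (A + i).+1 = 2 ^- (A + i) / 2 :> R by rewrite exprS invfM mulrC.
have := e2_le i; have : 0 < 2 ^- (A + i) :> R by rewrite invr_gt0 exprn_gt0.
by set x := 2 ^- _; nra.
Qed.

Lemma nested_radius_mono i j : (i <= j)%N -> nested_radius i <= nested_radius j.
Proof.
move=> ij; rewrite /nested_radius ler_wpM2l ?(ltW R0_gt0) // lerB //.
by rewrite lef_pV2 ?posrE ?exprn_gt0 // ler_weXn2l ?ler1n // leq_add2l.
Qed.

Lemma nested_radius_cofinal x : x < R0 -> exists s, x <= nested_radius s.*2.
Proof.
move=> xR; have [|s] := @exp2V_lt R ((R0 - x) / R0).
  by rewrite divr_gt0 ?subr_gt0.
rewrite ltr_pdivlMr // => sx; exists s.
have : 2 ^- (A + s.*2) <= 2 ^- s :> R.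
  rewrite lef_pV2 ?posrE ?exprn_gt0 // ler_weXn2l ?ler1n //.
  by rewrite -addnn addnA leq_addl.
by move=> /(ler_wpM2l (ltW R0_gt0)); rewrite /nested_radius mulrBr mulr1; lra.
Qed.

End Radii.

(** Inside its circle of poles a factor is close to 1, outside it is tiny, and near the circle it is
    bounded by the inverse of the relative hole radius. The partial products are inverses of
    polynomials, and the rate of convergence is the same at all points off the holes; this puts [F]
    in the algebra of any cheese that avoids them. *)
Lemma mckissick (a : R[i]) (R0 eta eps : R) : 0 < R0 -> 0 < eta -> 0 < eps ->
  exists (c : nat -> nat -> R[i]) (r : nat -> nat -> R) (K : R)
    (F : R[i] -> R[i]) (q : nat -> {poly R[i]}),
  [/\ forall s k, 0 < r s k,
      forall s k, R0 - eta <= cnorm (c s k - a) <= R0,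
      forall S N, \sum_(s < S) \sum_(k < N) r s k <= eps &
      forall z, (forall s k, r s k <= cnorm (z - c s k)) ->
      [/\ forall s, (q s).[z] != 0 /\ cnorm (F z - ((q s).[z])^-1) <= K * 2 ^- s,
          R0 <= cnorm (z - a) -> F z = 0 &
          cnorm (z - a) < R0 -> F z != 0]].
Proof.
move=> R00 eta0 eps0.
have [|A' A'e] := @exp2V_lt R (eta / R0); first exact: divr_gt0.
rewrite ltr_pdivlMr // in A'e.
have [|l le] := @exp2V_lt R (eps / R0); first exact: divr_gt0.
rewrite ltr_pdivlMr // in le.
(* [A] places all the circles in the annulus of width [eta], and [l] scales the total radius down to
   [eps]. The ratio of consecutive nested radii dictates [q = A + s.*2.+2] in [pow_1exp2V_ge], so
   [p s = q + e s], where [e s] is large enough for [lin] below. *)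
pose A := A'.+1; pose e s := (A + l + 6 + s)%N.
pose p s := (A + s.*2.+2 + e s)%N; pose n s := (2 ^ p s)%N.
pose t := nested_radius R0 A; pose rr s := t s.*2.+1.
(* The holes of the [s]-th factor, redundant ones included, have relative radii of sum at most
   [rho s * (n s + 2)]. This is at most [4 * n s * rho s = 2 ^- (l + s).+1], which sums over [s] to
   at most [2 ^- l]. *)
pose rho s : R := 2 ^- (l + s + 3 + p s).
have n_gt0 s : (0 < n s)%N by rewrite expn_gt0.
have rr0 s : 0 < rr s by exact: nested_radius_gt0.
have rho0 s : 0 < rho s by rewrite invr_gt0 exprn_gt0.
have /choice[om pom] : forall s, exists om : R[i], (n s).-primitive_root om.
  by move=> s; exact: prim_root_exists.
pose c s k := a + (rr s)%:C * om s ^+ k.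
(* The index [k] runs over all integers: from [n s] on the centres repeat, and the redundant holes,
   contained in genuine ones, get positive radii with a finite sum. *)
pose r s k := if (k < n s)%N then rr s * rho s else rr s * rho s * 2 ^- k.
pose w s z := (rr s)^-1%:C * (z - a).
pose h s z := (1 - w s z ^+ n s)^-1.
pose fq s : {poly R[i]} := 1 - ((rr s)^-1%:C *: ('X - a%:P)) ^+ n s.
have hq s z : h s z = ((fq s).[z])^-1 by rewrite /h /fq !hornerE.
pose q s := \prod_(t < s) fq t.
have Pq z s : \prod_(t < s) h t z = ((q s).[z])^-1.
  by rewrite /q horner_prod -prodfV; apply: eq_bigr => i _; rewrite hq.
pose good z := forall s k, r s k <= cnorm (z - c s k).
have hole z s k : (k < n s)%N -> good z -> rho s <= cnorm (1 - w s z / om s ^+ k).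
  move=> kn /(_ s k); rewrite /r kn => rz.
  have om1 := cnorm_prim_root k (pom s).
  have om0 : om s ^+ k != 0 by rewrite -cnorm_gt0 om1.
  have rC0 : (rr s)%:C != 0 by rewrite -cnorm_gt0 cnorm_real gtr0_norm.
  have -> : 1 - w s z / om s ^+ k =
      - ((z - c s k) * (rr s)^-1%:C / om s ^+ k).
    rewrite /w /c fmorphV; field; exact/andP.
  rewrite cnormN !cnormM cnormV om1 invr1 mulr1 cnorm_real.
  by rewrite ger0_norm ?invr_ge0 ?(ltW (rr0 s)) // ler_pdivlMr // mulrC.
have wn1 z s : good z -> w s z ^+ n s != 1 /\ cnorm (h s z) <= (rho s)^-1.
  move=> gz; apply: (cnorm_inv_1subX (pom s)) => // k kn; exact: hole.
pose C s : R := (rho s)^-1; pose et s : R := 2 / 2 ^+ (2 ^ e s).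
pose inn z s := cnorm (z - a) <= t s.*2.
have innS z s : inn z s -> inn z s.+1.
  move=> /le_trans; apply; apply: nested_radius_mono => //.
  by rewrite leq_double.
(* The left side is the exponent of 2 needed in [etC], where [C s.+1] contributes [p s.+1]; the
   other uses need less. *)
have lin s : (11 + l + A + (A + l + 6) + 5 * s <= 2 ^ e s)%N.
  apply: leq_trans (exp2_ge_linear _); rewrite /e; lia.
have et_le m s : (m.+1 <= 2 ^ e s)%N -> et s <= 2 ^- m.
  move=> ms; rewrite /et ler_pdivrMr ?exprn_gt0 // mulrC ler_pdivlMr ?exprn_gt0 //.
  by rewrite -exprS ler_weXn2l ?ler1n.
have cw z s : cnorm (w s z) = cnorm (z - a) / rr s.
  by rewrite /w cnormM cnorm_real ger0_norm ?invr_ge0 ?(ltW (rr0 s)) // mulrC.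
have q0 m : 0 < 1 + 2 ^- m :> R by rewrite addr_gt0 // invr_gt0 exprn_gt0.
have near1 z s : inn z s -> cnorm (h s z - 1) <= 2 ^- s.+2.
  move=> zs; apply: le_trans (et_le s.+2 s _); last by have := lin s; lia.
  apply: switch_near1; rewrite cw ler_pdivrMr // mulrC ler_pdivlMr //.
  rewrite (le_trans _ (nested_radius_step R00 _ s.*2)) // ler_pM ?cnorm_ge0 ?(ltW (q0 _)) //.
  by rewrite lerD2l lef_pV2 ?posrE ?exprn_gt0 // ler_weXn2l ?ler1n // /A; lia.
have far z s : ~~ inn z s.+1 -> cnorm (h s z) <= et s.
  rewrite /inn -ltNge => zs.
  apply: switch_far; rewrite cw ler_pdivlMr //; apply: le_trans (ltW zs).
  rewrite mulrC (le_trans _ (nested_radius_step R00 _ s.*2.+1)) //.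
  by rewrite /A !addnS !addSn.
have etC s : et s * C s.+1 <= 2 ^- s.+1.
  rewrite /C /rho invrK /et mulrAC ler_pdivrMr ?exprn_gt0 // [leRHS]mulrC.
  rewrite ler_pdivlMr ?exprn_gt0 // -exprS -exprD ler_weXn2l ?ler1n //.
  by have := lin s; rewrite /p /e; lia.
have /choice[F FP] : forall z, exists Fz, good z ->
    [/\ forall s, cnorm (Fz - ((q s).[z])^-1) <= 4 * (1 + C 0) * 2 ^- s,
        R0 <= cnorm (z - a) -> Fz = 0 & cnorm (z - a) < R0 -> Fz != 0].
  move=> z; have [gz|ngz] := pselect (good z); last by exists 0.
  have [||||||Fz [F1 [F2 F3]]] := @switching_limit R (h ^~ z) (inn z) C et.
  - exact: innS.
  - exact: near1.
  - by move=> s; have [] := wn1 z s gz.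
  - exact: far.
  - by move=> s; apply: et_le; have := lin s; lia.
  - exact: etC.
  exists Fz => _; split.
  - by move=> s; have := F1 s; rewrite Pq.
  - move=> zR; apply: F2 => s; rewrite /inn -ltNge (lt_le_trans _ zR) //.
    exact: nested_radius_lt.
  - move=> zR; have [s zs] := @nested_radius_cofinal R0 A R00 _ zR.
    apply: (F3 s) => // m; rewrite /h invr_eq0 subr_eq0 eq_sym.
    by have [] := wn1 z m gz.
exists c, r, (4 * (1 + C 0)), F, q; split.
- have rr_rho0 s : 0 < rr s * rho s by exact: mulr_gt0.
  move=> s k; rewrite /r; case: ifP => _; first exact: rr_rho0.
  by apply: mulr_gt0 => //; rewrite invr_gt0 exprn_gt0.
- move=> s k; have -> : c s k - a = (rr s)%:C * om s ^+ k by rewrite /c addrC addKr.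
  rewrite cnormM (cnorm_prim_root _ (pom s)) mulr1.
  rewrite cnorm_real gtr0_norm // (ltW (nested_radius_lt _ _ _)) // andbT.
  rewrite (le_trans _ (nested_radius_ge _ _ _)) //.
  have : 2 ^- A = 2 ^- A' / 2 :> R by rewrite /A exprS invfM mulrC.
  have : 0 < 2 ^- A' :> R by rewrite invr_gt0 exprn_gt0.
  by move=> ? ->; nra.
- move=> S N.
  have rs s : \sum_(k < N) r s k <= R0 * 2 ^- (l + s).+1.
    have rk k : r s k <= rr s * rho s * ((k < n s)%N%:R + 2 ^- k).
      rewrite /r; case: ifP => _; last by rewrite add0r.
      have e2 : 0 <= 2 ^- k :> R by rewrite invr_ge0 exprn_ge0.
      by rewrite -[leLHS]mulr1 ler_wpM2l ?lerDl // ltW // mulr_gt0.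
    apply: (@le_trans _ _ (\sum_(k < N) (rr s * rho s * ((k < n s)%N%:R + 2 ^- k)))).
      by apply: ler_sum.
    rewrite -mulr_sumr -mulrA.
    rewrite ler_pM ?(ltW (rr0 s)) ?(ltW (nested_radius_lt _ _ _)) //.
      apply: mulr_ge0; [exact: ltW|apply: sumr_ge0 => i _].
      by apply: addr_ge0; rewrite ?ler0n // invr_ge0 exprn_ge0.
    rewrite big_split /=.
    have S1 : \sum_(k < N) (k < n s)%N%:R <= (n s)%:R :> R.
      have -> : \sum_(k < N) (k < n s)%N%:R = (minn N (n s))%:R :> R.
        elim: N => [|N IH]; first by rewrite big_ord0 min0n.
        by rewrite big_ord_recr /= IH -natrD; congr (_%:R); lia.
      by rewrite ler_nat geq_minr.
    have S2 : \sum_(k < N) 2 ^- k <= 2 - 2 ^- N * 2 :> R.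
      elim: N {S1} => [|N IH]; first by rewrite big_ord0 expr0; lra.
      rewrite big_ord_recr /= exprS invfM; lra.
    have N0 : 0 < 2 ^- N :> R by rewrite invr_gt0 exprn_gt0.
    have -> : 2 ^- (l + s).+1 = rho s * (4 * (n s)%:R).
      have E : (l + s + 3 + p s = (l + s).+1 + (2 + p s))%N by lia.
      have -> : 4 * (n s)%:R = 2 ^+ (2 + p s) :> R by rewrite natrX exprD -[2 ^+ 2]natrX.
      by rewrite /rho E exprD invfM -mulrA mulVf ?mulr1 // expf_neq0 // pnatr_eq0.
    rewrite ler_wpM2l ?(ltW (rho0 s)) //.
    have : 1 <= (n s)%:R :> R by rewrite ler1n.
    by lra.
  apply: (@le_trans _ _ (\sum_(s < S) (R0 * 2 ^- (l + s).+1))).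
    by apply: ler_sum.
  rewrite -mulr_sumr.
  have : \sum_(s < S) 2 ^- (l + s).+1 <= 2 ^- l * (1 - 2 ^- S) :> R.
    elim: S => [|S IH]; first by rewrite big_ord0 expr0 invr1 subrr mulr0.
    rewrite big_ord_recr /= -addnS exprD invfM exprS invfM; nra.
  have : 0 < 2 ^- S :> R by rewrite invr_gt0 exprn_gt0.
  have : 0 < 2 ^- l :> R by rewrite invr_gt0 exprn_gt0.
  set x := \sum_(s < S) _; set y := 2 ^- l in le *; set u := 2 ^- S.
  move=> y0 u0 xy; have : x <= y by nra.
  by nra.
- move=> z gz; have [F1 F2 F3] := FP z gz; split=> // s; split; last exact: F1.
  rewrite /q horner_prod prodf_seq_neq0; apply/allP => i _ /=.
  by rewrite -invr_eq0 -hq /h invr_eq0 subr_eq0 eq_sym; have [] := wn1 z i gz.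
Qed.
End Mckissick.

(** * Merging overlapping discs *)

Section MergingDiscs.
Variable R : realType.

(* Centre, radius and level; the level of a hole of the cheese is the index [j]
   of the circle near which it lies, so that its distance to the segment is
   bounded below by a decreasing function of the level. *)
Definition disc : Type := (R[i] * R * nat)%type.
Implicit Types (d : disc) (L : seq disc).

Definition in_disc d z := cnorm (z - d.1.1) < d.1.2.

Definition apart d d' := d.1.2 + d'.1.2 < cnorm (d.1.1 - d'.1.1).

Lemma apart_sym : symmetric apart.
Proof. by move=> d d'; rewrite /apart addrC cdistC. Qed.

Definition monotone_weight (b : nat -> R) :=
  (forall m, 0 <= b m) /\ (forall m n, (m <= n)%N -> b m <= b n).

Definition weighted b L := \sum_(d <- L) d.1.2 * b d.2.

(** The second clause ties the position of a new disc to its level, through an old disc of that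
    level inside it. The third one quantifies over all weights because several are applied to the
    same list: the constant 1 for the total radius, indicators of high levels for single radii, and
    powers of inverse distances for the coefficients. *)
Definition coarsens L' L :=
  [/\ forall d z, d \in L -> in_disc d z -> exists2 d', d' \in L' & in_disc d' z,
      forall d', d' \in L' ->
        exists d, [/\ d \in L, d.2 = d'.2 & cnorm (d.1.1 - d'.1.1) + d.1.2 <= d'.1.2] &
      forall b, monotone_weight b -> weighted b L' <= weighted b L].

Lemma coarsens_trans L1 L2 L3 : coarsens L1 L2 -> coarsens L2 L3 -> coarsens L1 L3.
Proof.
move=> [A1 A2 A3] [B1 B2 B3]; split.
- by move=> d z dL /(B1 _ _ dL)[d2 d2L]; exact: A1.
- move=> d1 /A2[d2 [/B2[d3 [d3L e32 l32]] e21 l21]].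
  exists d3; split=> //; first by rewrite e32.
  by have := cdistD d2.1.1 d3.1.1 d1.1.1; lra.
- by move=> b bm; rewrite (le_trans (A3 b bm)) ?B3.
Qed.

Lemma coarsens_perm L1 L2 : perm_eq L1 L2 -> coarsens L1 L2.
Proof.
move=> p12; have m12 := perm_mem p12; split.
- by move=> d z dL dz; exists d; rewrite ?m12.
- by move=> d dL; exists d; rewrite -m12 subrr cnorm0 add0r.
- by move=> b _; rewrite /weighted (perm_big _ p12).
Qed.

Lemma coarsens_cons d L1 L2 : coarsens L1 L2 -> coarsens (d :: L1) (d :: L2).
Proof.
move=> [A1 A2 A3]; split.
- move=> e z; rewrite inE => /orP[/eqP->|eL] ez.
    by exists d => //; rewrite mem_head.
  by have [e' e'L e'z] := A1 _ _ eL ez; exists e' => //; rewrite inE e'L orbT.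
- move=> e; rewrite inE => /orP[/eqP->|/A2[e' [e'L ? ?]]].
    by exists d; rewrite mem_head subrr cnorm0 add0r.
  by exists e'; split=> //; rewrite inE e'L orbT.
- by move=> b bm; rewrite /weighted !big_cons lerD2l A3.
Qed.

(* Two discs whose closures meet lie in a disc whose radius is the sum of
   their radii. *)
Definition merge d d' : disc :=
  (d.1.1 + (d'.1.2 / (d.1.2 + d'.1.2))%:C * (d'.1.1 - d.1.1), d.1.2 + d'.1.2,
   minn d.2 d'.2).

Lemma merge_dist d d' : 0 < d.1.2 -> 0 < d'.1.2 -> ~~ apart d d' ->
  cnorm (d.1.1 - (merge d d').1.1) <= d'.1.2 /\
  cnorm (d'.1.1 - (merge d d').1.1) <= d.1.2.
Proof.
rewrite /apart -leNgt /=; case: d d' => [[c r] m] [[c' r'] m'] /= r0 r'0 ncc.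
have rr0 : 0 < r + r' by rewrite addr_gt0.
split.
  rewrite opprD addrA subrr sub0r cnormN cnormM cnorm_real ger0_norm.
    by rewrite mulrAC ler_pdivrMr // ler_pM2l // cdistC.
  by rewrite divr_ge0 ?ltW.
have -> : c' - (c + (r' / (r + r'))%:C * (c' - c)) = (r / (r + r'))%:C * (c' - c).
  have -> : r / (r + r') = 1 - r' / (r + r') by field; rewrite gt_eqF.
  by rewrite rmorphB rmorph1; ring.
rewrite cnormM cnorm_real ger0_norm; last by rewrite divr_ge0 ?ltW.
by rewrite mulrAC ler_pdivrMr // ler_pM2l // cdistC.
Qed.

(** The radii add up, so a nondecreasing weight cannot grow provided that the merged disc takes the
    smaller level. *)
Lemma coarsens_merge d d' L : 0 < d.1.2 -> 0 < d'.1.2 -> ~~ apart d d' ->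
  coarsens (merge d d' :: L) (d :: d' :: L).
Proof.
move=> r0 r'0 nap; have [m1 m2] := merge_dist r0 r'0 nap.
have rE : (merge d d').1.2 = d.1.2 + d'.1.2 by [].
split.
- move=> e z; rewrite !inE => /or3P[/eqP->|/eqP->|eL] ez.
  + exists (merge d d'); first exact: mem_head.
    rewrite /in_disc rE; have := cdistD d.1.1 z (merge d d').1.1.
    by move: ez; rewrite /in_disc; lra.
  + exists (merge d d'); first exact: mem_head.
    rewrite /in_disc rE; have := cdistD d'.1.1 z (merge d d').1.1.
    by move: ez; rewrite /in_disc; lra.
  + by exists e => //; rewrite inE eL orbT.
- move=> e; rewrite inE => /orP[/eqP->|eL]; last first.
    by exists e; rewrite !inE eL !orbT subrr cnorm0 add0r.
  case: (leqP d.2 d'.2) => dd'.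
    exists d; split; [exact: mem_head|by rewrite /= (minn_idPl dd')|].
    by rewrite rE; lra.
  exists d'; split; [by rewrite !inE eqxx orbT|by rewrite /= (minn_idPr (ltnW dd'))|].
  by rewrite rE; lra.
- move=> b [b0 bm]; rewrite /weighted !big_cons addrA lerD2r /= mulrDl.
  by apply: lerD; apply: ler_wpM2l; rewrite ?(ltW r0) ?(ltW r'0) ?bm ?geq_minl ?geq_minr.
Qed.

Definition all_pos L := forall d, d \in L -> 0 < d.1.2.

Lemma coarsens_pos L' L : coarsens L' L -> all_pos L -> all_pos L'.
Proof.
move=> [_ A2 _] pL d' /A2[d [/pL d0 _]]; apply: lt_le_trans.
by rewrite ltr_wpDl ?cnorm_ge0.
Qed.

(** A merged disc may meet discs that were already apart, so the procedure restarts; it terminates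
    because each merge removes a disc. The bound on [size L'] is there to reapply the induction
    hypothesis. *)
Lemma merge_pairwise n L : (size L <= n)%N -> all_pos L ->
  exists L', [/\ coarsens L' L, (size L' <= size L)%N & pairwise apart L'].
Proof.
elim: n L => [|n IH] [|d L] //= sL pL; try by exists [::]; split=> //; exact: coarsens_perm.
have [L1 [cL1 sL1 pwL1]] : exists L', [/\ coarsens L' L, (size L' <= size L)%N & pairwise apart L'].
  by apply: IH => // e eL; apply: pL; rewrite inE eL orbT.
have [dL1|/allPn[d1 d1L1 nap]] := boolP (all (apart d) L1).
  by exists (d :: L1); rewrite /= dL1; split=> //; exact: coarsens_cons.
have pL1 : all_pos (d :: L1) by apply: coarsens_pos pL; exact: coarsens_cons.
have d0 : 0 < d.1.2 by apply: pL; exact: mem_head.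
have d10 : 0 < d1.1.2 by apply: pL1; rewrite inE d1L1 orbT.
pose L2 := merge d d1 :: rem d1 L1.
have cL2 : coarsens L2 (d :: L).
  apply: coarsens_trans (coarsens_merge _ d0 d10 nap) _.
  apply: coarsens_trans (coarsens_cons d cL1).
  by apply: coarsens_perm; rewrite perm_cons perm_sym perm_to_rem.
have sL2 : size L2 = size L1.
  by rewrite /L2 /= size_rem // prednK //; case: (L1) d1L1.
have [|L3 [cL3 sL3 pwL3]] := IH L2 _ (coarsens_pos cL2 pL).
  by rewrite sL2 (leq_trans sL1).
exists L3; split=> //; first exact: coarsens_trans cL2.
by rewrite (leq_trans sL3) // sL2 (leq_trans sL1).
Qed.

Lemma sum_subseq (T : eqType) (s1 s2 : seq T) (f : T -> R) : subseq s1 s2 ->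
  (forall x, x \in s2 -> 0 <= f x) -> \sum_(x <- s1) f x <= \sum_(x <- s2) f x.
Proof.
elim: s2 s1 => [|y s2 IH] [|x s1] //= s12 f0; rewrite ?big_cons ?lexx //.
  by rewrite big_nil addr_ge0 ?f0 ?mem_head // big_seq sumr_ge0 // => z zs;
    rewrite f0 // inE zs orbT.
have f0' z : z \in s2 -> 0 <= f z by move=> zs; rewrite f0 // inE zs orbT.
case: eqVneq s12 => [->|_] s12; first by rewrite lerD2l IH.
by have := IH (x :: s1) s12 f0'; rewrite big_cons => ?; rewrite ler_wpDl ?f0 ?mem_head.
Qed.

Lemma weighted1 L : weighted (fun=> 1) L = \sum_(d <- L) d.1.2.
Proof. by rewrite /weighted; under eq_bigr do rewrite mulr1. Qed.

(** A disc that reaches the circle of radius [r0] stays outside the circle whose radius is smaller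
    by the diameter of the disc. It is therefore dropped at this cost, and the remaining discs are
    compared with the new circle. *)
Lemma shrink_discs n L (r0 : R) : (size L <= n)%N -> all_pos L ->
  exists L' (r' : R), [/\ subseq L' L, r0 - 2 * (\sum_(d <- L) d.1.2) <= r' <= r0,
     forall d, d \in L' -> cnorm d.1.1 + d.1.2 < r' &
     forall z d, cnorm z <= r' -> d \in L -> in_disc d z -> d \in L'].
Proof.
elim: n L r0 => [|n IH] L r0 sL pL.
  by case: L sL pL => // _ _; exists [::], r0; split=> //; rewrite big_nil mulr0 subr0 lexx.
have S0 L1 : all_pos L1 -> 0 <= \sum_(d <- L1) d.1.2.
  by move=> pL1; rewrite big_seq sumr_ge0 // => d /pL1 /ltW.
have [ins|/allPn[d dL]] := boolP (all (fun d : disc => cnorm d.1.1 + d.1.2 < r0) L).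
  exists L, r0; split=> //; last exact/allP.
  by rewrite lexx andbT lerBlDr lerDl mulr_ge0 ?S0.
rewrite -leNgt => dr.
have [||L' [r' [sL' /andP[r'1 r'2] inL' cL']]] := IH (rem d L) (r0 - 2 * d.1.2).
- by rewrite size_rem // -ltnS (leq_trans _ sL) // prednK //; case: (L) dL.
- by move=> e /mem_rem; exact: pL.
have d0 := pL _ dL.
exists L', r'; split=> //.
- exact: subseq_trans (rem_subseq d L).
- have -> : \sum_(e <- L) e.1.2 = d.1.2 + \sum_(e <- rem d L) e.1.2.
    by rewrite (perm_big _ (perm_to_rem dL)) big_cons.
  by apply/andP; split; lra.
- move=> z e zr eL ez; have [ed|ed] := eqVneq e d.
    move: ez; rewrite /in_disc ed; have := cnormB z (z - d.1.1).
    by rewrite subKr; lra.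
  apply: (cL' z) => //; move: eL; rewrite (perm_mem (perm_to_rem dL)) inE.
  by rewrite (negPf ed).
Qed.

Lemma merge_discs L (r0 : R) : all_pos L ->
  exists L' (r' : R), [/\ r0 - 2 * (\sum_(d <- L) d.1.2) <= r' <= r0,
     pairwise apart L',
     forall d, d \in L' -> 0 < d.1.2 /\ cnorm d.1.1 + d.1.2 < r',
     forall z, cnorm z <= r' -> (forall d, d \in L' -> ~~ in_disc d z) ->
       forall d, d \in L -> ~~ in_disc d z &
     (forall d', d' \in L' -> exists d, [/\ d \in L, d.2 = d'.2 &
        cnorm (d.1.1 - d'.1.1) + d.1.2 <= d'.1.2]) /\
     (forall b, monotone_weight b -> weighted b L' <= weighted b L)].
Proof.
move=> pL; have [L1 [cL1 _ pwL1]] := merge_pairwise (leqnn _) pL.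
have pL1 := coarsens_pos cL1 pL.
have [L' [r' [sL' /andP[r'1 r'2] inL' cL']]] := shrink_discs r0 (leqnn _) pL1.
have m1 : monotone_weight (fun=> 1) by split.
case: cL1 => [A1 A2 A3]; exists L', r'; split=> //.
- rewrite r'2 andbT (le_trans _ r'1) // lerB // ler_pM2l //.
  by rewrite -!weighted1 A3.
- exact: subseq_pairwise pwL1.
- by move=> d dL'; split; [apply: pL1; exact: (mem_subseq sL')|exact: inL'].
- move=> z zr zL' d dL; apply/negP => dz.
  have [d' d'L d'z] := A1 _ _ dL dz.
  by have := zL' d' (cL' z d' zr d'L d'z); rewrite d'z.
- split=> [d' /(mem_subseq sL')|b bm]; first exact: A2.
  apply: le_trans (A3 b bm); case: bm => b0 _.
  rewrite /weighted; apply: (sum_subseq sL') => d dL1; exact: mulr_ge0 (ltW (pL1 _ dL1)) (b0 _).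
Qed.
End MergingDiscs.

(** * A discrete Cauchy formula *)

Section DiscreteCauchy.
Variable R : realType.

Definition tends0 (u : nat -> R[i]) :=
  forall e : R, 0 < e -> exists N, forall n, (N <= n)%N -> cnorm (u n) < e.

Lemma tends0_eventually (u : nat -> R[i]) N :
  (forall n, (N <= n)%N -> u n = 0) -> tends0 u.
Proof. by move=> u0 e e0; exists N => n Nn; rewrite u0 // cnorm0. Qed.

Lemma tends0D (u v : nat -> R[i]) :
  tends0 u -> tends0 v -> tends0 (fun n => u n + v n).
Proof.
move=> u0 v0 e e0; have e2 : 0 < e / 2 by rewrite divr_gt0.
have [N1 N1P] := u0 _ e2; have [N2 N2P] := v0 _ e2.
exists (maxn N1 N2) => n; rewrite geq_max => /andP[n1 n2].
by rewrite (le_lt_trans (cnormD _ _)) // [ltRHS]splitr ltrD ?N1P ?N2P.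
Qed.

Lemma tends0Z (a : R[i]) (u : nat -> R[i]) :
  tends0 u -> tends0 (fun n => a * u n).
Proof.
move=> u0 e e0; have a0 : 0 < cnorm a + 1 by rewrite ltr_wpDl ?cnorm_ge0.
have [|N NP] := u0 (e / (cnorm a + 1)); first by rewrite divr_gt0.
exists N => n /NP; rewrite ltr_pdivlMr // cnormM => H; apply: le_lt_trans H.
by rewrite mulrC ler_wpM2l ?cnorm_ge0 // lerDl.
Qed.

Lemma tends0N (u : nat -> R[i]) : tends0 u -> tends0 (fun n => - u n).
Proof. by move=> u0 e /u0[N NP]; exists N => n; rewrite cnormN; exact: NP. Qed.

Lemma tends0_sum (I : eqType) (s : seq I) (u : I -> nat -> R[i]) :
  (forall i, i \in s -> tends0 (u i)) -> tends0 (fun n => \sum_(i <- s) u i n).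
Proof.
elim: s => [|i s IH] us.
  by apply: (@tends0_eventually _ 0) => n _; rewrite big_nil.
under [X in tends0 X]eq_fun do rewrite big_cons.
apply: tends0D; first by apply: us; exact: mem_head.
by apply: IH => j js; apply: us; rewrite inE js orbT.
Qed.

Lemma tends0_ext (u v : nat -> R[i]) N : (forall n, (N <= n)%N -> u n = v n) ->
  tends0 u -> tends0 v.
Proof.
move=> uv u0 e /u0[N' NP]; exists (maxn N N') => n.
by rewrite geq_max => /andP[n1 n2]; rewrite -uv // NP.
Qed.

Lemma expr_small (b e : R) : 0 <= b -> b < 1 -> 0 < e -> exists n, b ^+ n < e.
Proof.
move=> b0 b1 e0; have : `|b| < 1 by rewrite ger0_norm.
move=> /cvg_expr/cvgrPdist_lt/(_ e e0)[N _ NP]; exists N.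
by have := NP N (leqnn N); rewrite /= sub0r normrN ger0_norm ?exprn_ge0.
Qed.

Section Averages.
Variable om : nat -> R[i].
Hypothesis pom : forall n, (0 < n)%N -> n.-primitive_root (om n).

Section Kernel.
Variable b : R[i].
Hypothesis b1 : cnorm b < 1.

(* As [n] grows, [V m e n] tends to the integral of [u^e (1 - b u)^-m] over the
   unit circle, that is to 1 if [e = 0] and to 0 otherwise. *)
Let V m e n := n%:R^-1 *
  \sum_(k < n) (om n ^+ k) ^+ e * (1 - b * om n ^+ k) ^- m.

Let B := (1 - cnorm b)^-1.

Let B_gt0 : 0 < B. Proof. by rewrite invr_gt0 subr_gt0. Qed.

Let den_ge n k : (0 < n)%N -> 1 - cnorm b <= cnorm (1 - b * om n ^+ k).
Proof.
move=> /pom pn; have := cnormD (1 - b * om n ^+ k) (b * om n ^+ k).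
rewrite subrK cnorm1 cnormM (cnorm_prim_root _ pn); lra.
Qed.

Let den_neq0 n k : (0 < n)%N -> 1 - b * om n ^+ k != 0.
Proof. by move=> n0; rewrite -cnorm_gt0 (lt_le_trans _ (den_ge k n0)) ?subr_gt0. Qed.

Let V_le m e n : (0 < n)%N -> cnorm (V m e n) <= B ^+ m.
Proof.
move=> n0; rewrite /V cnormM cnormV cnorm_nat ler_pdivrMl ?ltr0n //.
rewrite (le_trans (cnorm_sum _ _ _)) // mulr_natl -[n in leRHS]card_ord -sumr_const.
apply: ler_sum => k _; rewrite cnormM cnormX (cnorm_prim_root _ (pom n0)) expr1n mul1r.
rewrite cnormV cnormX -exprVn lerXn2r ?nnegrE ?(ltW B_gt0) ?invr_ge0 ?cnorm_ge0 //.
by rewrite lef_pV2 ?posrE ?den_ge // ?subr_gt0 // cnorm_gt0 den_neq0.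
Qed.

Let V_rec m e n : (0 < n)%N -> V m.+1 e n = V m e n + b * V m.+1 e.+1 n.
Proof.
move=> n0; rewrite /V [b * (_ * _)]mulrCA -mulrDr; congr (_ * _).
rewrite mulr_sumr -big_split /=.
apply: eq_bigr => k _; have := den_neq0 k n0; set z := om n ^+ k => d0.
rewrite !exprS; have := expf_neq0 m d0; set X := _ ^+ m => X0.
by field; rewrite X0 d0.
Qed.

Let V_recn m e I n : (0 < n)%N ->
  V m.+1 e n = \sum_(i < I) b ^+ i * V m (e + i) n + b ^+ I * V m.+1 (e + I) n.
Proof.
move=> n0; elim: I => [|I IH]; first by rewrite big_ord0 add0r expr0 mul1r addn0.
by rewrite IH big_ord_recr /= -addrA V_rec // mulrDr addnS exprSr mulrA.
Qed.

(** By [V_recn], expanding one of the factors geometrically leaves finitely many averages with a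
    lower power, which tend to 0 by induction, and a remainder bounded by a multiple of
    [cnorm b ^+ I] independent of [n]. *)
Lemma kernel_avg0 m e : (0 < e)%N -> tends0 (V m e).
Proof.
elim: m e => [|m IH] e e0.
  apply: (@tends0_eventually _ e.+1) => n en; rewrite /V.
  under eq_bigr do rewrite expr0 invr1 mulr1.
  rewrite (sum_prim_rootX _ (pom (leq_ltn_trans (leq0n _) en))) gtnNdvd ?mulr0 //.
move=> eps eps0; have Bm : 0 < B ^+ m.+1 by rewrite exprn_gt0.
have [I bI] : exists I, cnorm b ^+ I < eps / 2 / B ^+ m.+1.
  by apply: expr_small; rewrite ?cnorm_ge0 // !divr_gt0.
rewrite ltr_pdivlMr // in bI.
have [N NP] : exists N, forall n, (N <= n)%N ->
    cnorm (\sum_(i < I) b ^+ i * V m (e + i) n) < eps / 2.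
  apply: (@tends0_sum _ _ (fun (i : 'I_I) n => b ^+ i * V m (e + i) n)).
    by move=> i _; apply: tends0Z; apply: IH; rewrite addn_gt0 e0.
  by rewrite divr_gt0.
exists (maxn N 1) => n; rewrite geq_max => /andP[Nn n0].
rewrite (V_recn _ _ I n0) (le_lt_trans (cnormD _ _)) // [ltRHS]splitr.
apply: ltrD; first exact: NP.
rewrite cnormM cnormX; apply: le_lt_trans bI.
by rewrite ler_wpM2l ?exprn_ge0 ?cnorm_ge0 ?V_le.
Qed.

Lemma kernel_avg1 m : tends0 (fun n => V m 0 n - 1).
Proof.
elim: m => [|m IH].
  apply: (@tends0_eventually _ 1) => n n0; rewrite /V.
  under eq_bigr do rewrite !expr0 invr1 mulr1.
  by rewrite sumr_const card_ord mulVf ?subrr // pnatr_eq0 -lt0n.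
apply: (@tends0_ext (fun n => (V m 0 n - 1) + b * V m.+1 1 n) _ 1).
  by move=> n n0; rewrite (V_rec m 0 n0) addrAC.
by apply: tends0D => //; apply: tends0Z; exact: kernel_avg0.
Qed.

End Kernel.

(* A Riemann sum for [(2 i pi)^-1] times the integral of [h] along a circle. *)
Definition circle_avg (c : R[i]) (r : R) (h : R[i] -> R[i]) n :=
  n%:R^-1 * \sum_(k < n) r%:C * om n ^+ k * h (c + r%:C * om n ^+ k).

Lemma circle_avgD c r h1 h2 n : circle_avg c r (fun z => h1 z + h2 z) n =
  circle_avg c r h1 n + circle_avg c r h2 n.
Proof.
rewrite /circle_avg -mulrDr -big_split; congr (_ * _).
by apply: eq_bigr => k _; rewrite mulrDr.
Qed.

Lemma circle_avgZ c r a h n : circle_avg c r (fun z => a * h z) n =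
  a * circle_avg c r h n.
Proof.
rewrite /circle_avg mulrCA; congr (_ * _); rewrite mulr_sumr.
by apply: eq_bigr => k _; rewrite mulrCA.
Qed.

Lemma on_circle c (r : R) n k : 0 < r -> (0 < n)%N ->
  cnorm (c + r%:C * om n ^+ k - c) = r.
Proof.
move=> r0 n0; rewrite addrC addKr cnormM (cnorm_prim_root _ (pom n0)) mulr1.
by rewrite cnorm_real gtr0_norm.
Qed.

Lemma circle_avg_poly c r (p : {poly R[i]}) : tends0 (circle_avg c r (horner p)).
Proof.
pose q := p \Po (r%:C *: 'X + c%:P).
apply: (@tends0_eventually _ (size q).+2) => n qn; rewrite /circle_avg.
have n0 : (0 < n)%N by apply: leq_trans qn.
have E (k : 'I_n) : r%:C * om n ^+ k * p.[c + r%:C * om n ^+ k] =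
    r%:C * \sum_(i < size q) q`_i * (om n ^+ k) ^+ i.+1.
  have -> : c + r%:C * om n ^+ k = (r%:C *: 'X + c%:P).[om n ^+ k].
    by rewrite !hornerE addrC.
  rewrite -horner_comp -/q horner_coef -mulrA mulr_sumr; congr (_ * _).
  by apply: eq_bigr => i _; rewrite exprS mulrCA.
under eq_bigr do rewrite E.
rewrite -mulr_sumr exchange_big /= big1 ?mulr0 // => i _.
rewrite -mulr_sumr (sum_prim_rootX _ (pom n0)) gtnNdvd ?mulr0 //.
by rewrite (leq_ltn_trans _ (ltnW qn)).
Qed.

Lemma circle_avg_out c (r : R) a m : 0 < r -> r < cnorm (a - c) ->
  tends0 (circle_avg c r (fun z => (z - a) ^- m)).
Proof.
move=> r0 ra; have ac0 : c - a != 0 by rewrite -cnorm_gt0 cdistC (lt_trans r0).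
pose b := r%:C / (a - c).
have b1 : cnorm b < 1.
  by rewrite /b cnormM cnormV cnorm_real gtr0_norm // ltr_pdivrMr ?mul1r // (lt_trans r0).
have := tends0Z (r%:C * (c - a) ^- m) (kernel_avg0 b1 m (ltn0Sn 0)).
apply: (@tends0_ext _ _ 0) => n _; rewrite /circle_avg mulrCA; congr (_ * _).
rewrite mulr_sumr; apply: eq_bigr => k _; set z := om n ^+ k.
have -> : c + r%:C * z - a = (c - a) * (1 - b * z).
  by rewrite /b; field; rewrite -oppr_eq0 opprB.
by rewrite exprMn invfM expr1; ring.
Qed.

End Averages.

Section CauchySums.
Variable om : nat -> R[i].
Hypothesis pom : forall n, (0 < n)%N -> n.-primitive_root (om n).
Local Notation circle_avg := (circle_avg om).

(** Written in the inverse roots of unity, the average is a kernel average with exponent [e = m]: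
    the line element cancels one of the [m.+1] powers. Hence the limit is nonzero for a simple pole
    only. *)
Lemma circle_avg_in c (r : R) a m : 0 < r -> cnorm (a - c) < r ->
  tends0 (fun n => circle_avg c r (fun z => (z - a) ^- m.+1) n - (m == 0%N)%:R).
Proof.
move=> r0 ra; pose om' n := (om n)^-1.
have pom' n : (0 < n)%N -> n.-primitive_root (om' n).
  by move=> /pom; exact: inv_prim_root.
pose b := (a - c) / r%:C.
have rC0 : r%:C != 0 by rewrite -cnorm_gt0 cnorm_real gtr0_norm.
have b1 : cnorm b < 1.
  by rewrite /b cnormM cnormV cnorm_real gtr0_norm // ltr_pdivrMr ?mul1r.
have E n : (0 < n)%N -> circle_avg c r (fun z => (z - a) ^- m.+1) n =
    r%:C ^- m * (n%:R^-1 *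
      \sum_(k < n) (om' n ^+ k) ^+ m * (1 - b * om' n ^+ k) ^- m.+1).
  move=> n0; rewrite /circle_avg mulrCA; congr (_ * _).
  rewrite mulr_sumr; apply: eq_bigr => k _; rewrite /om' exprVn; set z := om n ^+ k.
  have z0 : z != 0 by rewrite -cnorm_gt0 (cnorm_prim_root _ (pom n0)).
  have -> : c + r%:C * z - a = r%:C * z * (1 - b / z).
    by rewrite /b; field; rewrite rC0 z0.
  have rz0 : r%:C * z != 0 by exact: mulf_neq0.
  rewrite [in LHS]exprMn [in LHS]invfM [LHS]mulrA [RHS]mulrA exprVn -[in RHS]invfM -[in RHS]exprMn.
  congr (_ * _).
  by rewrite exprS invfM mulrA mulfV ?mul1r.
case: m E => [|m] E.
  apply: (@tends0_ext _ _ 1) (kernel_avg1 pom' b1 1) => n n0.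
  by rewrite (E n n0) expr0 invr1 mul1r.
have := tends0Z (r%:C ^- m.+1) (kernel_avg0 pom' b1 m.+2 (ltn0Sn m)).
by apply: (@tends0_ext _ _ 1) => n n0; rewrite (E n n0) subr0.
Qed.

Variables (L : seq (disc R)) (r0 : R).
Hypothesis r0_gt0 : 0 < r0.
Hypothesis apartL : pairwise (@apart R) L.
Hypothesis insideL : forall d, d \in L -> 0 < d.1.2 /\ cnorm d.1.1 + d.1.2 < r0.

Definition contour_avg h n :=
  circle_avg 0 r0 h n - \sum_(d <- L) circle_avg d.1.1 d.1.2 h n.

Definition domain z := cnorm z <= r0 /\ forall d, d \in L -> ~~ in_disc d z.

Lemma apart_rem d : d \in L -> all (apart d) (rem d L).
Proof.
elim: (L) apartL => //= e s IH /andP[es ps]; rewrite inE eq_sym.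
case: (eqVneq e d) => [<- //|_ /= ds].
by rewrite IH // apart_sym (allP es).
Qed.

Lemma apart_mem d e : d \in L -> e \in L -> e != d -> apart d e.
Proof.
move=> dL eL ed; apply: (allP (apart_rem dL)).
by move: eL; rewrite (perm_mem (perm_to_rem dL)) inE (negPf ed).
Qed.

Lemma outer_circle_domain n k : (0 < n)%N -> domain (0 + r0%:C * om n ^+ k).
Proof.
move=> n0; have E := on_circle pom 0 k r0_gt0 n0; rewrite subr0 in E.
split=> [|d /insideL[d0 dr]]; first by rewrite E.
rewrite /in_disc -leNgt; set w := 0 + _ in E *.
by have := cnormD (w - d.1.1) d.1.1; rewrite subrK E; lra.
Qed.

Lemma inner_circle_domain d n k : d \in L -> (0 < n)%N ->
  domain (d.1.1 + d.1.2%:C * om n ^+ k).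
Proof.
move=> dL n0; have [d0 dr] := insideL dL.
have E := on_circle pom d.1.1 k d0 n0; set w := d.1.1 + _ in E *.
split=> [|e eL].
  by have := cnormD (w - d.1.1) d.1.1; rewrite subrK E; lra.
have [->|ed] := eqVneq e d; first by rewrite /in_disc E ltxx.
have := apart_mem dL eL ed; rewrite /in_disc /apart -leNgt.
by have := cdistD w d.1.1 e.1.1; rewrite (cdistC d.1.1 w) E; lra.
Qed.

Lemma contour_avgD h1 h2 n : contour_avg (fun z => h1 z + h2 z) n =
  contour_avg h1 n + contour_avg h2 n.
Proof.
rewrite /contour_avg circle_avgD; under eq_bigr do rewrite circle_avgD.
by rewrite big_split /= opprD addrACA.
Qed.

Lemma contour_avgZ a h n : contour_avg (fun z => a * h z) n = a * contour_avg h n.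
Proof.
rewrite /contour_avg circle_avgZ; under eq_bigr do rewrite circle_avgZ.
by rewrite -mulr_sumr mulrBr.
Qed.

(** The outer circle is given level 0. Its radius is close to 1 and I lies in the disc of radius
    1/2, so its distance to I obeys the bound required at level 0. *)
Definition on_contour z m :=
  cnorm z = r0 /\ m = 0%N \/ exists d, [/\ d \in L, m = d.2 & cnorm (z - d.1.1) = d.1.2].

Lemma outer_on_contour n k : (0 < n)%N -> on_contour (0 + r0%:C * om n ^+ k) 0.
Proof. by move=> n0; left; rewrite -[X in cnorm X]subr0 on_circle. Qed.

Lemma inner_on_contour d n k : d \in L -> (0 < n)%N ->
  on_contour (d.1.1 + d.1.2%:C * om n ^+ k) d.2.
Proof.
by move=> dL n0; right; exists d; rewrite (on_circle pom _ _ _ n0) //; case: (insideL dL).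
Qed.

Lemma contour_avg_eq h1 h2 n : (0 < n)%N ->
  (forall z m, domain z -> on_contour z m -> h1 z = h2 z) ->
  contour_avg h1 n = contour_avg h2 n.
Proof.
move=> n0 h12; rewrite /contour_avg /circle_avg; congr (_ * _ - _).
  apply: eq_bigr => k _; rewrite (h12 _ 0%N) //; first exact: outer_circle_domain.
  exact: outer_on_contour.
apply: eq_big_seq => d dL; congr (_ * _).
apply: eq_bigr => k _; rewrite (h12 _ d.2) //; first exact: inner_circle_domain.
exact: inner_on_contour.
Qed.

Lemma contour_avg_ext h1 h2 n : (0 < n)%N ->
  (forall z, domain z -> h1 z = h2 z) -> contour_avg h1 n = contour_avg h2 n.
Proof. by move=> n0 h12; apply: (contour_avg_eq n0) => z m /h12. Qed.

Lemma contour_avg_poly (p : {poly R[i]}) : tends0 (contour_avg (horner p)).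
Proof.
apply: tends0D; first exact: circle_avg_poly.
by apply: tends0N; apply: tends0_sum => d _; exact: circle_avg_poly.
Qed.

(** Beyond the outer circle every average vanishes in the limit. Otherwise the pole lies in a disc
    of [L], and in no other since they are apart: the limits for the outer circle and for this disc
    are equal and cancel. *)
Lemma contour_avg_pole a m : ~ domain a ->
  tends0 (contour_avg (fun z => (z - a) ^- m.+1)).
Proof.
move=> nK; have [ar|ar] := ltP r0 (cnorm a).
  apply: tends0D; first by apply: circle_avg_out; rewrite ?subr0.
  apply: tends0N; apply: tends0_sum => d /insideL[d0 dr].
  apply: circle_avg_out => //.
  by have := cnormD (a - d.1.1) d.1.1; rewrite subrK; lra.
have [d dL ad] : exists2 d, d \in L & in_disc d a.
  apply: contra_notP nK => H; split=> // d dL; apply/negP => ad.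
  by apply: H; exists d.
have [d0 dr] := insideL dL.
have ar' : cnorm (a - 0) < r0.
  have := cnormD (a - d.1.1) d.1.1; move: ad; rewrite /in_disc subrK subr0; lra.
have T1 := circle_avg_in m r0_gt0 ar'.
have T2 := circle_avg_in m d0 ad.
have T3 : tends0 (fun n => \sum_(e <- rem d L)
    circle_avg e.1.1 e.1.2 (fun z => (z - a) ^- m.+1) n).
  apply: tends0_sum => e erem; have [e0 _] := insideL (mem_rem erem).
  apply: circle_avg_out => //; have := allP (apart_rem dL) e erem.
  have := cdistD a d.1.1 e.1.1; move: ad; rewrite /apart /in_disc (cdistC a d.1.1); lra.
have := tends0D T1 (tends0N (tends0D T2 T3)).
apply: (@tends0_ext _ _ 0) => n _; rewrite /contour_avg.
have -> : \sum_(e <- L) circle_avg e.1.1 e.1.2 (fun z => (z - a) ^- m.+1) n =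
    circle_avg d.1.1 d.1.2 (fun z => (z - a) ^- m.+1) n +
    \sum_(e <- rem d L) circle_avg e.1.1 e.1.2 (fun z => (z - a) ^- m.+1) n.
  by rewrite (perm_big _ (perm_to_rem dL)) big_cons.
by ring.
Qed.

(** Partial fractions by induction on the number of poles: two distinct poles are separated by the
    identity for [1 / ((z - a) * (z - b))], and if all poles equal [a], dividing [p - p.[a]] by
    [z - a] lowers the order. *)
Lemma contour_avg_frac n (s : seq R[i]) (p : {poly R[i]}) : (size s <= n)%N ->
  (forall a, a \in s -> ~ domain a) ->
  tends0 (contour_avg (fun z => p.[z] / \prod_(a <- s) (z - a))).
Proof.
elim: n s p => [|n IH] s p ss sK.
  case: s ss sK => // _ _; apply: (@tends0_ext _ _ 1) (contour_avg_poly p) => n n0.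
  by apply: (contour_avg_ext n0) => z _; rewrite big_nil divr1.
case: s ss sK => [|a s] ss sK.
  exact: IH.
have domB z b : b \in a :: s -> domain z -> z - b != 0.
  move=> /sK nb zK; apply/eqP => /eqP; rewrite subr_eq0 => /eqP zb.
  by apply: nb; rewrite -zb.
have [/all_pred1P alls|/allPn[b bs /= ba]] := boolP (all (pred1 a) s).
  have /factor_theorem[p1 Ep] : root (p - p.[a]%:P) a by rewrite rootE !hornerE subrr.
  have T1 := IH s p1 ss (fun b bs => sK b (mem_behead (s := a :: s) bs)).
  have T2 := tends0Z p.[a] (contour_avg_pole (size s) (sK a (mem_head _ _))).
  apply: (@tends0_ext _ _ 1) (tends0D T1 T2) => k k0; rewrite -contour_avgZ -contour_avgD.
  apply: (contour_avg_ext k0) => z zK.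
  have za := domB z a (mem_head _ _) zK.
  have -> : p.[z] = p1.[z] * (z - a) + p.[a].
    by have := congr1 (horner^~ z) Ep; rewrite !hornerE => <-; rewrite subrK.
  have Es : \prod_(b <- s) (z - b) = (z - a) ^+ size s.
    by rewrite [in LHS]alls big_nseq iter_mulr_1.
  rewrite big_cons Es exprS; have := expf_neq0 (size s) za; set X := _ ^+ _ => X0.
  by field; rewrite X0 za.
have bs' := perm_to_rem bs.
have sz : size (rem b s) = (size s).-1 by rewrite size_rem.
have s0 : (0 < size s)%N by case: (s) bs.
have T1 : tends0 (contour_avg (fun z => p.[z] / \prod_(c <- a :: rem b s) (z - c))).
  apply: IH; first by rewrite /= sz prednK.
  by move=> c; rewrite inE => /orP[/eqP->|/mem_rem cs]; apply: sK; rewrite inE ?eqxx ?cs ?orbT.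
have T2 : tends0 (contour_avg (fun z => p.[z] / \prod_(c <- b :: rem b s) (z - c))).
  apply: IH; first by rewrite /= sz prednK.
  by move=> c; rewrite inE => /orP[/eqP->|/mem_rem cs]; apply: sK; rewrite inE ?bs ?cs ?orbT.
have ab : a - b != 0 by rewrite subr_eq0 eq_sym.
apply: (@tends0_ext _ _ 1) (tends0Z (a - b)^-1 (tends0D T1 (tends0Z (-1) T2))) => k k0.
rewrite -contour_avgZ -contour_avgD -contour_avgZ.
apply: (contour_avg_ext k0) => z zK.
have za := domB z a (mem_head _ _) zK.
have bas : b \in a :: s by rewrite inE bs orbT.
have zb := domB z b bas zK.
rewrite !big_cons (perm_big _ bs') big_cons /=.
have : \prod_(c <- rem b s) (z - c) != 0.
  rewrite prodf_seq_neq0; apply/allP => c cs; apply: (domB z c) => //.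
  by rewrite inE (mem_rem cs) orbT.
by set X := \prod_(c <- _) _ => X0; field; rewrite X0 za zb ab.
Qed.

Lemma contour_avg_rational (p q : {poly R[i]}) :
  (forall z, domain z -> q.[z] != 0) ->
  tends0 (contour_avg (fun z => p.[z] / q.[z])).
Proof.
move=> q0; have [s Es] := closed_field_poly_normal q.
have sK a : a \in s -> ~ domain a.
  move=> sa /q0; rewrite Es hornerZ horner_prod mulf_eq0 negb_or => /andP[_].
  rewrite prodf_seq_neq0 => /allP/(_ a sa).
  by rewrite /= hornerXsubC subrr eqxx.
have := tends0Z (lead_coef q)^-1 (contour_avg_frac p (leqnn (size s)) sK).
apply: (@tends0_ext _ _ 1) => n n0; rewrite -contour_avgZ.
apply: (contour_avg_ext n0) => z _.
rewrite [in RHS]Es hornerZ horner_prod invfM mulrCA.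
by under [in RHS]eq_bigr do rewrite hornerXsubC.
Qed.

(** Cauchy's formula from Cauchy's theorem: subtracting [p.[x] / q.[x]] times the kernel removes the
    singularity at [x] and leaves a multiple of [s / q], with [s] a polynomial. *)
Lemma contour_avg_cauchy (p q : {poly R[i]}) x :
  (forall z, domain z -> q.[z] != 0) ->
  cnorm x < r0 -> (forall d, d \in L -> d.1.2 < cnorm (x - d.1.1)) ->
  tends0 (fun n => contour_avg (fun z => p.[z] / q.[z] / (z - x)) n - p.[x] / q.[x]).
Proof.
move=> q0 xr xL.
have xK : domain x by split=> [|d /xL]; rewrite ?ltW // /in_disc -leNgt; exact: ltW.
have qx := q0 x xK.
have [s Es] : exists s, q.[x] *: p - p.[x] *: q = s * ('X - x%:P).
  have /factor_theorem[s Es] : root (q.[x] *: p - p.[x] *: q) x.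
    by rewrite rootE !hornerE mulrC subrr.
  by exists s.
have T1 := contour_avg_rational s q0.
have T2 : tends0 (fun n => contour_avg (fun z => (z - x)^-1) n - 1).
  have x0 : cnorm (x - 0) < r0 by rewrite subr0.
  have U1 := circle_avg_in 0 r0_gt0 x0.
  have U2 : tends0 (fun n => \sum_(e <- L) circle_avg e.1.1 e.1.2 (fun z => (z - x) ^- 1) n).
    by apply: tends0_sum => e eL; apply: (circle_avg_out pom); [case: (insideL eL)|exact: xL].
  apply: (@tends0_ext _ _ 0) (tends0D U1 (tends0N U2)) => n _.
  by rewrite /contour_avg addrAC.
apply: (@tends0_ext _ _ 1) (tends0D (tends0Z q.[x]^-1 T1) (tends0Z (p.[x] / q.[x]) T2)) => n n0.
rewrite [p.[x] / q.[x] * (_ - 1)]mulrBr mulr1 addrA -!contour_avgZ -contour_avgD; congr (_ - _).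
apply: (contour_avg_eq n0) => z m zK zC.
have zx : z - x != 0.
  apply/eqP => /eqP; rewrite subr_eq0 => /eqP zx; case: zC => [[]|[d [dL _]]]; rewrite zx => E.
    by rewrite E ltxx in xr.
  by have := xL d dL; rewrite E ltxx.
have qz := q0 z zK.
have Ez : s.[z] * (z - x) = q.[x] * p.[z] - p.[x] * q.[z].
  by have := congr1 (horner^~ z) Es; rewrite !hornerE => <-.
have -> : s.[z] = (q.[x] * p.[z] - p.[x] * q.[z]) / (z - x) by rewrite -Ez mulfK.
by field; rewrite qx qz zx.
Qed.

(* A term [(a, w, m)] of [T] is a coefficient, a pole and the level of the disc
   on whose boundary the pole lies. *)
Definition csum (T : seq (R[i] * R[i] * nat)) x := \sum_(t <- T) t.1.1 / (t.1.2 - x).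

Definition cweight (b : nat -> R) (T : seq (R[i] * R[i] * nat)) :=
  \sum_(t <- T) cnorm t.1.1 * b t.2.

Definition circle_terms g n c (r : R) m (a : R[i]) : seq (R[i] * R[i] * nat) :=
  [seq (a * n%:R^-1 * (r%:C * om n ^+ k) * g (c + r%:C * om n ^+ k),
        c + r%:C * om n ^+ k, m) | k <- index_iota 0 n].

Definition contour_terms g n := circle_terms g n 0 r0 0 1 ++
  flatten [seq circle_terms g n d.1.1 d.1.2 d.2 (-1) | d <- L].

Lemma csum_circle g n c r m a x : csum (circle_terms g n c r m a) x =
  a * circle_avg c r (fun z => g z / (z - x)) n.
Proof.
rewrite /csum /circle_terms big_map big_mkord /circle_avg /= mulrA mulr_sumr.
by apply: eq_bigr => k _; rewrite !mulrA.
Qed.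

Lemma csum_contour g n x :
  csum (contour_terms g n) x = contour_avg (fun z => g z / (z - x)) n.
Proof.
rewrite /csum /contour_terms big_cat /= big_flatten /= big_map.
rewrite -/(csum _ x) csum_circle mul1r /contour_avg; congr (_ + _).
rewrite -sumrN; apply: eq_bigr => d _.
by rewrite -/(csum _ x) csum_circle mulN1r.
Qed.

Lemma cweight_circle (b : nat -> R) g n c r m a (M : R) : (forall m, 0 <= b m) ->
  0 < r -> (0 < n)%N -> cnorm a = 1 ->
  (forall k, cnorm (g (c + r%:C * om n ^+ k)) <= M) ->
  cweight b (circle_terms g n c r m a) <= M * (r * b m).
Proof.
move=> b0 r_gt0 n0 a1 gM.
rewrite /cweight /circle_terms big_map big_mkord /=.
apply: (@le_trans _ _ (\sum_(k < n) n%:R^-1 * (M * (r * b m)))).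
  apply: ler_sum => k _; rewrite !cnormM a1 mul1r cnormV cnorm_nat cnorm_real gtr0_norm //.
  rewrite (cnorm_prim_root _ (pom n0)) mulr1 -!mulrA ler_wpM2l ?invr_ge0 ?ler0n //.
  rewrite [leLHS]mulrCA ler_wpM2r // mulr_ge0 ?b0 ?ltW //.
by rewrite sumr_const card_ord -[leLHS]mulr_natr mulrAC mulVf ?mul1r // pnatr_eq0 -lt0n.
Qed.

Lemma cweight_contour (b : nat -> R) g n (M : R) : (forall m, 0 <= b m) -> (0 < n)%N ->
  (forall z, domain z -> cnorm (g z) <= M) ->
  cweight b (contour_terms g n) <= M * (r0 * b 0%N + weighted b L).
Proof.
move=> b0 n0 gM; rewrite /cweight /contour_terms big_cat /= mulrDr lerD //.
  apply: (cweight_circle _ b0 r0_gt0 n0); first exact: cnorm1.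
  by move=> k; apply: gM; exact: outer_circle_domain.
rewrite big_flatten /= big_map /weighted mulr_sumr big_seq [leRHS]big_seq.
apply: ler_sum => d dL; have [d0 _] := insideL dL.
apply: (cweight_circle _ b0 d0 n0); first by rewrite cnormN cnorm1.
by move=> k; apply: gM; exact: inner_circle_domain.
Qed.

Lemma contour_terms_on g n t : (0 < n)%N -> t \in contour_terms g n ->
  on_contour t.1.2 t.2.
Proof.
move=> n0; rewrite mem_cat => /orP[/mapP[k _ ->]|/flattenP[s /mapP[d dL ->] /mapP[k _ ->]]].
  exact: outer_on_contour.
exact: inner_on_contour.
Qed.

Lemma cauchy_sums (p q : {poly R[i]}) (M : R) (xs : seq R[i]) (e : R) :
  (forall z, domain z -> q.[z] != 0) ->
  (forall z, domain z -> cnorm (p.[z] / q.[z]) <= M) ->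
  (forall x, x \in xs -> cnorm x < r0 /\ forall d, d \in L -> d.1.2 < cnorm (x - d.1.1)) ->
  0 < e ->
  exists T : seq (R[i] * R[i] * nat),
    [/\ forall t, t \in T -> on_contour t.1.2 t.2,
        forall b, (forall m, 0 <= b m) -> cweight b T <= M * (r0 * b 0%N + weighted b L) &
        forall x, x \in xs -> cnorm (csum T x - p.[x] / q.[x]) < e].
Proof.
move=> q0 gM xsP e0; pose g z := p.[z] / q.[z].
have [N NP] : exists N, forall n, (N <= n)%N -> forall x, x \in xs ->
    cnorm (csum (contour_terms g n) x - p.[x] / q.[x]) < e.
  elim: xs xsP => [|x xs IH] xsP; first by exists 0%N.
  have [|N1 N1P] := IH; first by move=> y ys; apply: xsP; rewrite inE ys orbT.
  have [xr xL] := xsP x (mem_head _ _).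
  have [N2 N2P] := contour_avg_cauchy p q0 xr xL e0.
  exists (maxn N1 N2) => n; rewrite geq_max => /andP[n1 n2] y.
  rewrite inE => /orP[/eqP->|ys]; first by rewrite csum_contour N2P.
  exact: N1P.
exists (contour_terms g N.+1); split.
- by move=> t; exact: contour_terms_on.
- by move=> b b0; exact: cweight_contour.
- by apply: NP.
Qed.

End CauchySums.
End DiscreteCauchy.

(** * Closed sets used in the compactness argument *)

Section Closedness.
Variable R : realType.

Lemma continuous_real (phi : R[i] -> R) :
  (forall z (e : R), 0 < e -> exists2 d : R, 0 < d &
     forall w, cnorm (w - z) < d -> `|phi w - phi z| < e) -> continuous phi.
Proof.
move=> H z P /nbhs_ballP[e /= e0 eP]; have [d d0 dP] := H z e e0.
apply/nbhs_cnormP; exists d => // w wz; apply: eP.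
by rewrite /ball /= distrC dP.
Qed.

Lemma continuous_cdist (c : R[i]) : continuous (fun z => cnorm (z - c)).
Proof.
apply: continuous_real => z e e0; exists e => // w.
by apply: le_lt_trans; rewrite (le_trans (cnorm_distl _ _)) // opprB addrA subrK.
Qed.

Lemma closed_cdist_ge (c : R[i]) (r : R) : closed [set z | r <= cnorm (z - c)].
Proof.
apply: (@preimage_closed _ _ (fun z => cnorm (z - c)) [set x | r <= x]).
  by move=> z _; exact: continuous_cdist.
exact: closed_ge.
Qed.

Lemma closed_cdist_le (c : R[i]) (r : R) : closed [set z | cnorm (z - c) <= r].
Proof.
apply: (@preimage_closed _ _ (fun z => cnorm (z - c)) [set x | x <= r]).
  by move=> z _; exact: continuous_cdist.
exact: closed_le.
Qed.

Lemma closed_poly_ratio_ge (p q : {poly R[i]}) (M : R) :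
  closed [set z | M * cnorm q.[z] <= cnorm p.[z]].
Proof.
have -> : [set z : R[i] | M * cnorm q.[z] <= cnorm p.[z]] =
    (fun z => cnorm p.[z] - M * cnorm q.[z]) @^-1` [set x | 0 <= x].
  by apply/seteqP; split=> z /=; rewrite subr_ge0.
apply: preimage_closed; last exact: closed_ge.
move=> z _; apply: continuous_real => {}z e e0.
have M0 : 0 < `|M| + 1 by rewrite ltr_wpDl.
have pz : {for z, continuous (fun z => p.[z])} := @continuous_horner R p z.
have qz : {for z, continuous (fun z => q.[z])} := @continuous_horner R q z.
have [|d1 d10 d1P] := (continuous_cnormP _ z).1 pz (e / 2).
  by rewrite divr_gt0.
have [|d2 d20 d2P] := (continuous_cnormP _ z).1 qz (e / 2 / (`|M| + 1)).
  by rewrite !divr_gt0.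
exists (Num.min d1 d2); first by rewrite lt_min d10.
move=> w; rewrite lt_min => /andP[/d1P w1 /d2P w2].
have -> : cnorm p.[w] - M * cnorm q.[w] - (cnorm p.[z] - M * cnorm q.[z]) =
  (cnorm p.[w] - cnorm p.[z]) - M * (cnorm q.[w] - cnorm q.[z]) by ring.
rewrite (le_lt_trans (ler_normB _ _)) // [ltRHS]splitr ltrD //.
  exact: le_lt_trans (cnorm_distl _ _) w1.
rewrite normrM; apply: le_lt_trans (_ : (`|M| + 1) * cnorm (q.[w] - q.[z]) < _).
  by rewrite ler_pM // ?lerDl ?cnorm_distl.
by rewrite mulrC -ltr_pdivlMr.
Qed.

End Closedness.

(** * From finitely many points to uniform approximation on the segment *)

Section SegmentApproximation.
Variable R : realType.

Definition segment_pt (x : R) := - 2^-1 <= x <= 2^-1.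

Section Uniform.
Variables (L : seq (disc R)) (r0 : R).
Hypothesis r0_gt0 : 0 < r0.
Hypothesis apartL : pairwise (@apart R) L.
Hypothesis insideL : forall d, d \in L -> 0 < d.1.2 /\ cnorm d.1.1 + d.1.2 < r0.
Hypothesis segL : forall x, segment_pt x -> cnorm x%:C < r0 /\
  forall d, d \in L -> d.1.2 < cnorm (x%:C - d.1.1).
Variable D : nat -> R.
Hypothesis D_gt0 : forall m, 0 < D m.
Hypothesis D_dist : forall w m x, on_contour L r0 w m -> segment_pt x ->
  D m <= cnorm (w - x%:C).
Variables (p q : {poly R[i]}) (M : R).
Hypothesis M_ge0 : 0 <= M.
Hypothesis q0 : forall z, domain L r0 z -> q.[z] != 0.
Hypothesis gM : forall z, domain L r0 z -> cnorm (p.[z] / q.[z]) <= M.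

Let g z := p.[z] / q.[z].
Let b m := (D m) ^- 2.
Let Lam := M * (r0 * b 0%N + weighted b L).

Let b_ge0 m : 0 <= b m. Proof. by rewrite invr_ge0 exprn_ge0 // ltW. Qed.

Lemma csum_lipschitz (T : seq (R[i] * R[i] * nat)) x y :
  (forall t, t \in T -> on_contour L r0 t.1.2 t.2) ->
  segment_pt x -> segment_pt y ->
  cnorm (csum T x%:C - csum T y%:C) <= cweight b T * `|x - y|.
Proof.
move=> TC sx sy; rewrite /csum -sumrB (le_trans (cnorm_sum _ _ _)) //.
rewrite /cweight mulr_suml big_seq [leRHS]big_seq; apply: ler_sum => t tT.
have dx := D_dist (TC t tT) sx; have dy := D_dist (TC t tT) sy.
have D0 := D_gt0 t.2.
have x0 : t.1.2 - x%:C != 0 by rewrite -cnorm_gt0 (lt_le_trans _ dx).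
have y0 : t.1.2 - y%:C != 0 by rewrite -cnorm_gt0 (lt_le_trans _ dy).
have -> : t.1.1 / (t.1.2 - x%:C) - t.1.1 / (t.1.2 - y%:C) =
    t.1.1 * (x - y)%:C / ((t.1.2 - x%:C) * (t.1.2 - y%:C)).
  by rewrite rmorphB; field; rewrite x0 y0.
rewrite !cnormM cnormV cnorm_real cnormM mulrAC ler_wpM2r // ler_wpM2l ?cnorm_ge0 //.
rewrite /b lef_pV2 ?posrE ?exprn_gt0 // ?mulr_gt0 ?(lt_le_trans D0) //.
by rewrite expr2 ler_pM // ltW.
Qed.

(** All the Cauchy sums share the Lipschitz constant [Lam] on I, and so does [p / q], being their
    limit at any two given points. The net can thus be fixed before the sum, and approximation on
    the net is enough. *)
Lemma cauchy_sums_uniform (e : R) : 0 < e ->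
  exists T : seq (R[i] * R[i] * nat),
    [/\ forall t, t \in T -> on_contour L r0 t.1.2 t.2,
        forall b, (forall m, 0 <= b m) -> cweight b T <= M * (r0 * b 0%N + weighted b L) &
        forall x, segment_pt x -> cnorm (csum T x%:C - g x%:C) <= e].
Proof.
move=> e0.
have /choice[om0 pom0] : forall n : nat, exists om : R[i], (0 < n)%N -> n.-primitive_root om.
  move=> [|n]; first by exists 0.
  by have [om pom] := @prim_root_exists R n.+1 isT; exists om.
have sums := @cauchy_sums R om0 pom0 L r0 r0_gt0 apartL insideL p q M.
have Lam0 : 0 <= Lam.
  rewrite /Lam mulr_ge0 // addr_ge0 ?mulr_ge0 ?(ltW r0_gt0) //.
  by rewrite /weighted big_seq sumr_ge0 // => d /insideL[d0 _]; rewrite mulr_ge0 // ltW.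
have g_lip x y : segment_pt x -> segment_pt y ->
    cnorm (g x%:C - g y%:C) <= Lam * `|x - y|.
  move=> sx sy; apply/ler_addgt0Pr => eps eps0.
  have [||T [TC TW TP]] := sums [:: x%:C; y%:C] (eps / 2) q0 gM.
  - by move=> z; rewrite !inE => /orP[]/eqP->; exact: segL.
  - by rewrite divr_gt0.
  have := TP x%:C (mem_head _ _).
  have /TP : y%:C \in [:: x%:C; y%:C] by rewrite !inE eqxx orbT.
  have := csum_lipschitz TC sx sy.
  have : cweight b T * `|x - y| <= Lam * `|x - y| by rewrite ler_wpM2r // TW.
  have := cdistD (csum T x%:C) (g x%:C) (g y%:C).
  have := cdistD (csum T y%:C) (csum T x%:C) (g y%:C).
  rewrite (cdistC (g x%:C) (csum T x%:C)) /g; lra.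
pose K := (Num.bound (4 * Lam / e)).+1.
have K0 : 0 < K%:R :> R by rewrite ltr0n.
have LK : 4 * Lam <= e * K%:R.
  rewrite [e * _]mulrC -ler_pdivrMr //.
  have e1 : 0 <= 4 * Lam / e by apply: divr_ge0 (ltW e0); exact: mulr_ge0.
  by apply: (le_trans (ltW (archi_boundP e1))); rewrite ler_nat leqnSn.
pose net := [seq (- 2^-1 + j%:R / K%:R : R) | j <- iota 0 K.+1].
have net_seg y : y \in net -> segment_pt y.
  move=> /mapP[j]; rewrite mem_iota add0n ltnS => /andP[_ jK] ->; rewrite /segment_pt.
  have j0 : 0 <= j%:R / K%:R :> R by rewrite divr_ge0 ?ler0n.
  have j1 : j%:R / K%:R <= 1 :> R by rewrite ler_pdivrMr // mul1r ler_nat.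
  by lra.
have net_near x : segment_pt x -> exists2 y, y \in net & `|x - y| <= K%:R^-1.
  move=> sx; pose j := Num.trunc ((x + 2^-1) * K%:R).
  have x0 : 0 <= (x + 2^-1) * K%:R.
    by rewrite mulr_ge0 ?ler0n //; move: sx; rewrite /segment_pt; lra.
  have /andP[j1 j2] := truncn_itv x0; rewrite -/j in j1 j2.
  exists (- 2^-1 + j%:R / K%:R).
    apply/mapP; exists j => //; rewrite mem_iota add0n ltnS /=.
    rewrite -(ler_nat R) (le_trans j1) // ler_piMl ?ler0n //.
    by move: sx; rewrite /segment_pt; lra.
  rewrite -ler_pdivrMr // in j1; rewrite -[j.+1%:R]natr1 -ltr_pdivlMr // mulrDl mul1r in j2.
  by rewrite ler_norml; apply/andP; split; lra.
have [||T [TC TW TP]] := sums [seq y%:C | y <- net] (e / 4) q0 gM.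
- by move=> z /mapP[y /net_seg sy ->]; exact: segL.
- by rewrite divr_gt0.
exists T; split=> // x sx; have [y yn xy] := net_near x sx.
have sy := net_seg y yn.
have h1 := TP _ (map_f _ yn).
have h2 := csum_lipschitz TC sx sy.
have h3 : cweight b T * `|x - y| <= Lam * `|x - y| by rewrite ler_wpM2r // TW.
have h4 := g_lip y x sy sx; rewrite distrC in h4.
have h5 : Lam * `|x - y| <= e / 4.
  rewrite (le_trans (ler_wpM2l Lam0 xy)) // ler_pdivrMr //; lra.
have := cdistD (csum T y%:C) (csum T x%:C) (g x%:C).
have := cdistD (g y%:C) (csum T y%:C) (g x%:C).
rewrite -/(g y%:C) in h1; lra.
Qed.

End Uniform.
End SegmentApproximation.

Lemma supnorm_lt (R : realType) (S : set R[i]) (g : R[i] -> R[i]) (e : R) z :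
  (supnorm S g < e%:E)%E -> S z -> cnorm (g z) < e.
Proof.
move=> Se Sz; rewrite -lte_fin; apply: le_lt_trans Se.
by apply: ereal_sup_ubound; exists z.
Qed.

Lemma supnorm_le (R : realType) (S : set R[i]) (g : R[i] -> R[i]) (e : R) :
  (forall z, S z -> cnorm (g z) <= e) -> (supnorm S g <= e%:E)%E.
Proof.
by move=> H; apply: ge_ereal_sup => _ [z Sz <-]; rewrite lee_fin; exact: H.
Qed.

(** * Cauchy sums for the functions of R(X) *)

Section Cheese.
Variable R : realType.
Variables (delta eps : nat -> R).
Variables (c : nat -> nat -> nat -> R[i]) (r : nat -> nat -> nat -> R).
Hypothesis delta_gt0 : forall j, 0 < delta j.
Hypothesis delta0_le : delta 0%N * 2 <= 1.
Hypothesis r_gt0 : forall j s k, 0 < r j s k.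
Hypothesis r_sum : forall j S N, \sum_(s < S) \sum_(k < N) r j s k <= eps j.
Hypothesis c_dist : forall j s k x, segment_pt x -> delta j <= cnorm (c j s k - x%:C).
Hypothesis eps_tail : forall m J, \sum_(m <= j < J) eps j <= delta m / 8.

Definition cheese : set R[i] :=
  [set z | cnorm z <= 1 /\ forall j s k, r j s k <= cnorm (z - c j s k)].

(* The hole [(j, s, k)] is the [k]-th one of the [s]-th factor of the product
   attached to the [j]-th circle. *)
Definition cheese_indices J : seq (nat * nat * nat) :=
  [seq (x, k) | x <- [seq (j, s) | j <- index_iota 0 J, s <- index_iota 0 J],
                k <- index_iota 0 J].

Definition hole (t : nat * nat * nat) : disc R :=
  (c t.1.1 t.1.2 t.2, r t.1.1 t.1.2 t.2, t.1.1).

Definition holes J := [seq hole t | t <- cheese_indices J].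

Lemma mem_cheese_indices J j s k : (j, s, k) \in cheese_indices J =
  [&& (j < J)%N, (s < J)%N & (k < J)%N].
Proof.
apply/allpairsP/and3P => [[[[j' s'] k'] /= [/allpairsP[[a b] /=
  [a1 b1 [-> ->]]] k1 [-> -> ->]]]|[j1 s1 k1]].
  by move: a1 b1 k1; rewrite !mem_index_iota.
exists ((j, s), k); rewrite /= mem_index_iota; split=> //.
by apply/allpairsP; exists (j, s); rewrite /= !mem_index_iota.
Qed.

Lemma eps_ge0 j : 0 <= eps j.
Proof. by apply: le_trans (r_sum j 0%N 0%N); rewrite big_ord0. Qed.

Lemma weighted_holes (b : nat -> R) J : (forall m, 0 <= b m) ->
  weighted b (holes J) <= \sum_(0 <= j < J) eps j * b j.
Proof.
move=> b0; rewrite /weighted /holes big_map /cheese_indices.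
rewrite big_allpairs /= big_allpairs /= ler_sum // => j _.
rewrite big_mkord; under eq_bigr do rewrite big_mkord -mulr_suml.
by rewrite -mulr_suml ler_wpM2r.
Qed.

Lemma weighted_tail m J :
  weighted (fun n => (m <= n)%N%:R) (holes J) <= delta m / 8.
Proof.
apply: le_trans (weighted_holes _ _) _; first by move=> n; rewrite ler0n.
apply: le_trans (eps_tail m J); rewrite [leRHS]big_geq_mkord /=.
rewrite big_mkord big_mkcond [leRHS]big_mkcond /=.
by apply: ler_sum => j _; case: leqP => _; rewrite ?mulr1 ?mulr0.
Qed.

Lemma r_le j s k : r j s k <= delta j / 8.
Proof.
pose J := (maxn j (maxn s k)).+1.
have tJ : (j, s, k) \in cheese_indices J by rewrite mem_cheese_indices /J; lia.
apply: le_trans (weighted_tail j J).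
rewrite /weighted /holes big_map (perm_big _ (perm_to_rem tJ)) big_cons /=.
rewrite leqnn mulr1 lerDl sumr_ge0 // => t _.
by rewrite mulr_ge0 ?ler0n ?ltW.
Qed.

Lemma segment_cheese x : segment_pt x -> cheese x%:C.
Proof.
move=> sx; split=> [|j s k].
  by rewrite cnorm_real ler_norml; move: sx; rewrite /segment_pt; lra.
have := c_dist j s k sx; have := r_le j s k; have := delta_gt0 j.
by rewrite cdistC; lra.
Qed.

Lemma closed_cheese : closed cheese.
Proof.
have -> : cheese = [set z | cnorm (z - 0) <= 1] `&`
    \bigcap_(t in [set: nat * nat * nat]) [set z | (hole t).1.2 <= cnorm (z - (hole t).1.1)].
  apply/seteqP; split=> z /=; rewrite subr0 => -[z1 H]; split=> //.
    by move=> t _; exact: H.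
  by move=> j s k; exact: (H (j, s, k) I).
apply: closedI; first exact: closed_cdist_le.
by apply: closed_bigI => t _; exact: closed_cdist_ge.
Qed.

Lemma compact_cheese : compact cheese.
Proof. by apply: compact_sub_unit_disc; [exact: closed_cheese|move=> z []]. Qed.

(** The points violating the bound off the first holes form decreasing compact sets, which would
    have a common point in the cheese. Written without a quotient, the strict inequality also
    excludes the zeros of [q]. *)
Lemma finite_holes_bound (p q : {poly R[i]}) (M : R) :
  (forall z, cheese z -> cnorm p.[z] < M * cnorm q.[z]) ->
  exists J, forall z, cnorm z <= 1 ->
    (forall d, d \in holes J -> ~~ in_disc d z) -> cnorm p.[z] < M * cnorm q.[z].
Proof.
move=> Mpq; apply: contrapT => /forallNP H.
pose A J := [set z | cnorm (z - 0) <= 1] `&`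
  ([set z | M * cnorm q.[z] <= cnorm p.[z]] `&`
  \bigcap_(t in [set t | t \in cheese_indices J])
     [set z | (hole t).1.2 <= cnorm (z - (hole t).1.1)]).
have cA J : closed (A J).
  apply: closedI; first exact: closed_cdist_le.
  apply: closedI; first exact: closed_poly_ratio_ge.
  by apply: closed_bigI => t _; exact: closed_cdist_ge.
have /choice[u uA] : forall J, exists z, A J z.
  move=> J; have /existsNP[z /not_implyP[z1 /not_implyP[zJ /negP]]] := H J.
  rewrite -leNgt => zM; exists z; split; first by rewrite /= subr0.
  split=> // t tJ /=; have := zJ (hole t) (map_f _ tJ).
  by rewrite /in_disc -leNgt.
have A_mono J K : (J <= K)%N -> A K `<=` A J.
  move=> JK z [z1 [zM zK]]; split=> //; split=> // -[[j s] k] tJ; apply: (zK (j, s, k)).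
  by move: tJ; rewrite /= !mem_cheese_indices; lia.
have E1 : [set z : R[i] | cnorm z <= 1] = [set z | cnorm (z - 0) <= 1].
  by apply/seteqP; split=> z /=; rewrite subr0.
have cD : compact [set z : R[i] | cnorm z <= 1].
  apply: compact_sub_unit_disc; last by move=> z.
  by rewrite E1; exact: closed_cdist_le.
have [z [_ zu]] : [set z : R[i] | cnorm z <= 1] `&` cluster (u @ \oo) !=set0.
  by apply: cD; rewrite E1; exists 0%N => // n _ /=; case: (uA n).
have zA J : A J z.
  have E := (closure_id (A J)).1 (cA J); rewrite E.
  move: zu; rewrite clusterE; apply.
  by exists J => // n Jn /=; exact: A_mono (uA n).
have zX : cheese z.
  split=> [|j s k]; first by have [] := zA 0%N; rewrite /= subr0.
  have [_ [_]] := zA (maxn j (maxn s k)).+1.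
  by move=> /(_ (j, s, k)); apply; rewrite /= mem_cheese_indices; lia.
have [_ [zM _]] := zA 0%N.
by have := Mpq z zX; rewrite ltNge => /negP; apply.
Qed.

(** The sum [T] and the range [J] depend on [e], but the factor [M + 1] does not, and the later
    bounds for the sums over [j < J] are uniform in [J]. *)
Lemma cheese_csum (f : R[i] -> R[i]) (M e : R) : rational_algebra cheese f ->
  (forall z, cheese z -> cnorm (f z) <= M) -> 0 < e ->
  exists T : seq (R[i] * R[i] * nat),
    [/\ forall t, t \in T -> forall x, segment_pt x -> delta t.2 / 2 <= cnorm (t.1.2 - x%:C),
        exists J, forall b, monotone_weight b ->
          cweight b T <= (M + 1) * (b 0%N + \sum_(0 <= j < J) eps j * b j) &
        forall x, segment_pt x -> cnorm (csum T x%:C - f x%:C) <= e].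
Proof.
move=> [_ fA] fM e0.
(* The distance 1/2 makes the rational function strictly smaller than [M + 1] on the cheese; the
   other half of [e] is left for the Cauchy sum. *)
have [|g [p [q pq]] fg] := fA (Num.min (e / 2) 2^-1).
  by rewrite lt_min divr_gt0 //= invr_gt0.
have {}fg z : cheese z -> cnorm (f z - g z) < Num.min (e / 2) 2^-1 := supnorm_lt fg.
have M0 : 0 <= M.
  apply: le_trans (fM (0%:C) _); first exact: cnorm_ge0.
  by apply: segment_cheese; rewrite /segment_pt; lra.
have [|J JP] := @finite_holes_bound p q (M + 1).
  move=> z zX; have [q0 gz] := pq z zX.
  have := fg z zX; rewrite lt_min => /andP[_]; have := fM z zX.
  have := cnormB (f z) (f z - g z); rewrite subKr gz cnormM cnormV => h1 h2 h3.
  by rewrite -ltr_pdivrMr ?cnorm_gt0 //; lra.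
have pJ : all_pos (holes J) by move=> d /mapP[t _ ->]; exact: r_gt0.
have [L [r0 [/andP[r01 r02] apL inL domL [lvL wL]]]] := merge_discs 1 pJ.
have tail0 : \sum_(d <- holes J) d.1.2 <= delta 0%N / 8.
  by have := weighted_tail 0%N J; rewrite -weighted1.
(* A merged disc of level [m] is made of holes of level at least [m]. The indicator of these levels
   is a monotone weight, so the radius is bounded by the tail of [eps] from [m] on. *)
have rad d : d \in L -> d.1.2 <= delta d.2 / 8.
  move=> dL; apply: le_trans (weighted_tail d.2 J).
  apply: le_trans (wL (fun n => (d.2 <= n)%N%:R) _); last first.
    split=> [m|m n mn]; first by rewrite ler0n.
    by rewrite ler_nat; case: (leqP d.2 m) => // /leq_trans ->.
  rewrite /weighted (perm_big _ (perm_to_rem dL)) big_cons /= leqnn mulr1 lerDl.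
  rewrite big_seq sumr_ge0 // => t /mem_rem/inL[t0 _].
  by rewrite mulr_ge0 ?ler0n ?ltW.
(* The disc contains a hole of the same level, whose centre is at distance at least [delta d.2] from
   I; the two centres differ by at most the radius. *)
have cdist d x : d \in L -> segment_pt x -> delta d.2 * (7 / 8) <= cnorm (x%:C - d.1.1).
  move=> dL sx; have [_ [/mapP[[[j s] k] _ ->] /= lv di]] := lvL d dL.
  have := c_dist j s k sx; have := rad d dL; have := r_gt0 j s k; rewrite -lv.
  have := cdistD d.1.1 (c j s k) x%:C; rewrite (cdistC d.1.1 x%:C); lra.
have d0 := delta_gt0 0%N.
have segn (x : R) : segment_pt x -> cnorm x%:C * 2 <= 1.
  move=> sx; rewrite -ler_pdivlMr // cnorm_real ler_norml.
  by move: sx; rewrite /segment_pt; lra.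
have domX z : domain L r0 z -> cnorm p.[z] < (M + 1) * cnorm q.[z].
  move=> [z1 zL]; apply: JP; first by lra.
  exact: domL.
have M1 : 0 < M + 1 by lra.
have q0 z : domain L r0 z -> q.[z] != 0.
  move=> /domX zq; rewrite -cnorm_gt0 -(pmulr_rgt0 _ M1); apply: le_lt_trans zq.
  exact: cnorm_ge0.
have gM z : domain L r0 z -> cnorm (p.[z] / q.[z]) <= M + 1.
  move=> zK; rewrite cnormM cnormV ler_pdivrMr ?cnorm_gt0 ?q0 //.
  exact: ltW (domX z zK).
have r0_ge : 1 - 2 * (delta 0%N / 8) <= r0.
  by apply: le_trans r01; rewrite lerD2l lerN2 ler_pM2l.
have r0_gt0 : 0 < r0.
  by move: r0_ge d0 delta0_le; move: (delta 0%N) => dd; lra.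
have D_dist w m x : on_contour L r0 w m -> segment_pt x -> delta m / 2 <= cnorm (w - x%:C).
  move=> [[wr ->]|[d [dL -> wd]]] sx.
    have := cnormD (w - x%:C) x%:C; rewrite subrK wr; have := segn x sx.
    by move: r0_ge d0 delta0_le; move: (delta 0%N) => dd; lra.
  have := cdist d x dL sx; have := rad d dL; have := delta_gt0 d.2.
  by have := cdistD w x%:C d.1.1; rewrite wd (cdistC x%:C w); lra.
have [|||T [TC TW TP]] := @cauchy_sums_uniform R L r0 r0_gt0 apL inL _
    (fun m => delta m / 2) _ D_dist p q (M + 1) (ltW M1) q0 gM (e / 2) _.
- move=> x sx; split.
    by have := segn x sx; move: r0_ge d0 delta0_le; move: (delta 0%N) => dd; lra.
  move=> d dL; have := cdist d x dL sx; have := rad d dL; have := delta_gt0 d.2; lra.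
- by move=> m; rewrite divr_gt0.
- by rewrite divr_gt0.
exists T; split.
- by move=> t tT x sx; exact: D_dist (TC t tT) sx.
- exists J => b bm; have [b0 _] := bm.
  apply: le_trans (TW b b0) _; rewrite ler_pM2l // lerD //.
    by rewrite ler_piMl.
  by rewrite (le_trans (wL b bm)) // weighted_holes.
- move=> x sx; have xX := segment_cheese sx; have [_ gx] := pq _ xX.
  have h := TP x sx; rewrite -gx in h.
  have := fg _ xX; rewrite lt_min => /andP[+ _].
  have := cdistD (g x%:C) (csum T x%:C) (f x%:C); rewrite (cdistC (g x%:C) (f x%:C)).
  by lra.
Qed.

End Cheese.

(** * Smoothness on the segment *)

Section SmoothLimits.
Variable R : realType.

(** Here [u] and [v] stand for the kernels [1 / (w - x)] and [1 / (w - y)], of which only the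
    resolvent identity is used. The second bound is the Taylor formula of order one with quadratic
    remainder. *)
Lemma cauchy_kernel_taylor (u v y x : R[i]) (s : R) k :
  v - u = (y - x) * u * v -> cnorm u <= s -> cnorm v <= s ->
  cnorm (v ^+ k - u ^+ k) <= k%:R * cnorm (y - x) * s ^+ k.+1 /\
  cnorm (v ^+ k - u ^+ k - k%:R * (y - x) * u ^+ k.+1) <=
    k%:R ^+ 2 * cnorm (y - x) ^+ 2 * s ^+ k.+2.
Proof.
move=> vu us vs; set h := y - x in vu *.
have s0 : 0 <= s by apply: le_trans us; exact: cnorm_ge0.
have h0 := cnorm_ge0 h.
have first j : cnorm (v ^+ j - u ^+ j) <= j%:R * cnorm h * s ^+ j.+1.
  elim: j => [|j IH]; first by rewrite !expr0 subrr cnorm0 !mul0r.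
  have -> : v ^+ j.+1 - u ^+ j.+1 = v * (v ^+ j - u ^+ j) + (v - u) * u ^+ j.
    by rewrite !exprS; ring.
  rewrite (le_trans (cnormD _ _)) // vu !cnormM cnormX.
  have -> : j.+1%:R * cnorm h * s ^+ j.+2 =
      s * (j%:R * cnorm h * s ^+ j.+1) + cnorm h * s * s * s ^+ j.
    by rewrite -natr1 !exprS; ring.
  rewrite lerD //; first by rewrite ler_pM ?cnorm_ge0.
  rewrite ler_pM ?mulr_ge0 ?exprn_ge0 ?cnorm_ge0 //.
    by rewrite ler_pM ?mulr_ge0 ?cnorm_ge0 // ler_wpM2l.
  by rewrite lerXn2r ?nnegrE ?cnorm_ge0.
split=> //; elim: k => [|k IH].
  by rewrite !expr0 subrr !mul0r subr0 cnorm0 expr0n !mul0r.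
have -> : v ^+ k.+1 - u ^+ k.+1 - k.+1%:R * h * u ^+ k.+2 =
    u * (v ^+ k - u ^+ k - k%:R * h * u ^+ k.+1) + h * u * (v ^+ k.+1 - u ^+ k.+1).
  have E : v ^+ k.+1 = u * v ^+ k + h * u * v * v ^+ k.
    by rewrite -vu exprS; ring.
  rewrite [in LHS]E -natr1 !exprS; ring.
rewrite (le_trans (cnormD _ _)) // !cnormM.
have -> : k.+1%:R ^+ 2 * cnorm h ^+ 2 * s ^+ k.+3 =
  s * (k%:R ^+ 2 * cnorm h ^+ 2 * s ^+ k.+2) +
  cnorm h * s * (k.+1%:R * cnorm h * s ^+ k.+2) + k%:R * cnorm h ^+ 2 * s ^+ k.+3.
  by rewrite -!natr1 !exprS; ring.
rewrite -[leLHS]addr0 lerD //; last first.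
  apply: mulr_ge0; last exact: exprn_ge0.
  by apply: mulr_ge0; [exact: ler0n|exact: exprn_ge0].
rewrite lerD //; first by rewrite ler_pM ?cnorm_ge0.
by rewrite ler_pM ?mulr_ge0 ?cnorm_ge0 // ler_wpM2l.
Qed.

Lemma segment_near x (e : R) : 0 < e -> segment_pt x ->
  exists y, [/\ segment_pt y, y != x & `|y - x| <= e].
Proof.
move=> e0 /andP[x1 x2]; pose d : R := Num.min e 2^-1.
have d0 : 0 < d by rewrite lt_min e0 invr_gt0 ltr0n.
have de : d <= e by rewrite /d ge_min lexx.
have d1 : d <= 2^-1 by rewrite /d ge_min lexx orbT.
have [xp|xn] := leP x 0.
  exists (x + d); rewrite /segment_pt addrAC subrr add0r gtr0_norm //; split=> //.
    by apply/andP; split; lra.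
  by rewrite gt_eqF // ltrDl.
exists (x - d); rewrite /segment_pt addrAC subrr sub0r normrN gtr0_norm //; split=> //.
  by apply/andP; split; lra.
by rewrite lt_eqF // ltrBlDr ltrDl.
Qed.

Variables (D : nat -> R) (T : nat -> seq (R[i] * R[i] * nat)) (f : R -> R[i]).
Hypothesis D_gt0 : forall m, 0 < D m.
Hypothesis T_dist : forall n t, t \in T n -> forall x, segment_pt x ->
  D t.2 <= cnorm (t.1.2 - x%:C).
Hypothesis T_weight : forall k, exists W, forall n,
  cweight (fun m => D m ^- k) (T n) <= W.
Hypothesis T_lim : forall n x, segment_pt x -> cnorm (csum (T n) x%:C - f x) <= 2 ^- n.

(* The [k]-th derivative of the [n]-th Cauchy sum. *)
Let G n k x := k`!%:R * \sum_(t <- T n) t.1.1 * (t.1.2 - x%:C) ^- k.+1.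

Let T_neq0 n t x : t \in T n -> segment_pt x -> t.1.2 - x%:C != 0.
Proof. by move=> tT sx; rewrite -cnorm_gt0 (lt_le_trans (D_gt0 t.2)) ?(T_dist tT). Qed.

Let T_inv n t x : t \in T n -> segment_pt x -> cnorm (t.1.2 - x%:C)^-1 <= (D t.2)^-1.
Proof.
move=> tT sx; rewrite cnormV lef_pV2 ?posrE ?(T_dist tT) //.
by rewrite cnorm_gt0 (T_neq0 tT).
Qed.

Let G_le n k x W : segment_pt x -> cweight (fun m => D m ^- k.+1) (T n) <= W ->
  cnorm (G n k x) <= k`!%:R * W.
Proof.
move=> sx TW; rewrite /G cnormM cnorm_nat ler_wpM2l ?ler0n //.
apply: le_trans TW; rewrite (le_trans (cnorm_sum _ _ _)) // /cweight.
rewrite big_seq [leRHS]big_seq; apply: ler_sum => t tT.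
rewrite cnormM ler_wpM2l ?cnorm_ge0 // -!exprVn cnormX.
by rewrite lerXn2r ?nnegrE ?cnorm_ge0 ?invr_ge0 ?(ltW (D_gt0 _)) ?(T_inv tT).
Qed.

Let G_taylor k : exists2 A : R, 0 < A & forall n x y, segment_pt x -> segment_pt y ->
  cnorm (G n k y - G n k x - G n k.+1 x * (y - x)%:C) <= A * (y - x) ^+ 2.
Proof.
have [W TW] := T_weight k.+3; exists (k`!%:R * (k.+1%:R ^+ 2 * (`|W| + 1))).
  by rewrite !mulr_gt0 ?exprn_gt0 ?ltr0n ?fact_gt0 ?ltr_wpDl.
move=> n x y sx sy.
have E : G n k y - G n k x - G n k.+1 x * (y - x)%:C =
    k`!%:R * \sum_(t <- T n) t.1.1 * ((t.1.2 - y%:C)^-1 ^+ k.+1 -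
      (t.1.2 - x%:C)^-1 ^+ k.+1 - k.+1%:R * (y%:C - x%:C) * (t.1.2 - x%:C)^-1 ^+ k.+2).
  rewrite /G factS natrM -mulrBr [_.+1%:R * _]mulrC -!mulrA -mulrBr; congr (_ * _).
  rewrite mulr_suml mulr_sumr -!sumrB; apply: eq_bigr => t _.
  by rewrite -!exprVn rmorphB; ring.
rewrite E cnormM cnorm_nat -[leRHS]mulrA ler_wpM2l ?ler0n //.
rewrite (le_trans (cnorm_sum _ _ _)) //.
apply: (@le_trans _ _
    (\sum_(t <- T n) k.+1%:R ^+ 2 * (cnorm t.1.1 * D t.2 ^- k.+3) * (y - x) ^+ 2)).
  rewrite big_seq [leRHS]big_seq; apply: ler_sum => t tT; rewrite cnormM.
  have xt := T_neq0 tT sx; have yt := T_neq0 tT sy.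
  have vu : (t.1.2 - y%:C)^-1 - (t.1.2 - x%:C)^-1 =
      (y%:C - x%:C) * (t.1.2 - x%:C)^-1 * (t.1.2 - y%:C)^-1.
    by field; rewrite xt yt.
  have [_ H] := cauchy_kernel_taylor k.+1 vu (T_inv tT sx) (T_inv tT sy).
  have -> : k.+1%:R ^+ 2 * (cnorm t.1.1 * D t.2 ^- k.+3) * (y - x) ^+ 2 =
      cnorm t.1.1 * (k.+1%:R ^+ 2 * (y - x) ^+ 2 * D t.2 ^- k.+3).
    by set X := _ ^- _; ring.
  rewrite ler_wpM2l ?cnorm_ge0 // (le_trans H) //.
  by rewrite -rmorphB cnorm_real real_normK ?num_real // exprVn.
rewrite -mulr_suml -mulr_sumr -/(cweight (fun m => D m ^- k.+3) (T n)).
rewrite ler_wpM2r ?sqr_ge0 // ler_wpM2l ?exprn_ge0 ?ler0n //.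
by rewrite (le_trans (TW n)) // (le_trans (ler_norm _)) // lerDl.
Qed.

Definition converges (u : nat -> R[i]) (l : R[i]) :=
  forall e : R, 0 < e -> exists N, forall n, (N <= n)%N -> cnorm (u n - l) < e.

(** The constant of [G_taylor] does not depend on [n]: for [y] close to [x], the next derivative
    differs little from the difference quotient of [G n k] between [x] and [y], and these quotients
    converge by induction. So the next derivatives form a Cauchy sequence. *)
Let G_cvg k x : segment_pt x -> exists l, converges (fun n => G n k x) l.
Proof.
elim: k x => [|k IH] x sx.
  exists (f x) => e e0; have [N Ne] := exp2V_lt e0; exists N => n Nn.
  have -> : G n 0 x = csum (T n) x%:C.
    by rewrite /G fact0 mul1r; apply: eq_bigr => t _; rewrite expr1.
  apply: le_lt_trans (T_lim n sx) _; apply: le_lt_trans Ne.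
  by rewrite lef_pV2 ?posrE ?exprn_gt0 // ler_weXn2l ?ler1n.
apply: complex_cauchy_cvg => e e0.
have [A A0 AP] := G_taylor k.
have [|y [sy yx ye]] := @segment_near x (e / (4 * A)) _ sx.
  by rewrite divr_gt0 // mulr_gt0.
have h0 : 0 < `|y - x| by rewrite normr_gt0 subr_eq0.
have [lx lxP] := IH x sx; have [ly lyP] := IH y sy.
have eh : 0 < e * `|y - x| / 8 by rewrite divr_gt0 // mulr_gt0.
have [N1 N1P] := lxP _ eh; have [N2 N2P] := lyP _ eh.
exists (maxn N1 N2) => m n; rewrite !geq_max => /andP[m1 m2] /andP[n1 n2].
rewrite -(ltr_pM2r h0) -[`|y - x|]cnorm_real -cnormM mulrBl.
set hC := (y - x)%:C.
have -> : G m k.+1 x * hC - G n k.+1 x * hC =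
   - (G m k y - G m k x - G m k.+1 x * hC) + (G n k y - G n k x - G n k.+1 x * hC)
   + ((G m k y - ly) - (G n k y - ly) - ((G m k x - lx) - (G n k x - lx))) by ring.
have t1 := AP m x y sx sy; have t2 := AP n x y sx sy.
have t3 := N2P m m2; have t4 := N2P n n2; have t5 := N1P m m1; have t6 := N1P n n1.
have A2 : A * (y - x) ^+ 2 <= e * `|y - x| / 4.
  rewrite ler_pdivlMr ?mulr_gt0 // in ye.
  by have := ler_wpM2r (ltW h0) ye; rewrite -real_normK ?num_real // expr2; lra.
have := cnormD (- (G m k y - G m k x - G m k.+1 x * hC) + (G n k y - G n k x - G n k.+1 x * hC))
  ((G m k y - ly) - (G n k y - ly) - ((G m k x - lx) - (G n k x - lx))).
have := cnormD (- (G m k y - G m k x - G m k.+1 x * hC)) (G n k y - G n k x - G n k.+1 x * hC).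
have := cnormB ((G m k y - ly) - (G n k y - ly)) ((G m k x - lx) - (G n k x - lx)).
have := cnormB (G m k y - ly) (G n k y - ly).
have := cnormB (G m k x - lx) (G n k x - lx).
rewrite cnormN cnorm_real.
lra.
Qed.

Let converges_unique u l l' : converges u l -> converges u l' -> l = l'.
Proof.
move=> ul ul'; apply/eqP; rewrite -subr_eq0 -cnorm_eq0 eq_le cnorm_ge0 andbT.
apply/ler_addgt0Pr => e e0; have e2 : 0 < e / 2 by rewrite divr_gt0.
have [N1 N1P] := ul _ e2; have [N2 N2P] := ul' _ e2.
have := N1P _ (leq_maxl N1 N2); have := N2P _ (leq_maxr N1 N2).
by have := cdistD (u (maxn N1 N2)) l l'; rewrite (cdistC l (u _)); lra.
Qed.

Lemma csum_smooth : exists F : nat -> R -> R[i],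
  [/\ forall x, segment_pt x -> F 0%N x = f x,
      forall k x W, segment_pt x ->
        (forall n, cweight (fun m => D m ^- k.+1) (T n) <= W) ->
        cnorm (F k x) <= k`!%:R * W &
      forall k, exists2 A : R, 0 < A & forall x y, segment_pt x -> segment_pt y ->
        cnorm (F k y - F k x - F k.+1 x * (y - x)%:C) <= A * (y - x) ^+ 2].
Proof.
have /choice[F FP] : forall kx : nat * R, exists l, segment_pt kx.2 ->
    converges (fun n => G n kx.1 kx.2) l.
  move=> [k x]; have [sx|nsx] := pselect (segment_pt x); last by exists 0.
  by have [l lP] := G_cvg k sx; exists l.
exists (fun k x => F (k, x)); split.
- move=> x sx; apply: (converges_unique (FP (0%N, x) sx)) => e e0 /=.
  have [N Ne] := exp2V_lt e0; exists N => n Nn.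
  have -> : G n 0 x = csum (T n) x%:C.
    by rewrite /G fact0 mul1r; apply: eq_bigr => t _; rewrite expr1.
  apply: le_lt_trans (T_lim n sx) _; apply: le_lt_trans Ne.
  by rewrite lef_pV2 ?posrE ?exprn_gt0 // ler_weXn2l ?ler1n.
- move=> k x W sx TW; rewrite -[X in cnorm X]subr0.
  apply: (le_of_cvg (FP (k, x) sx)); exists 0%N => n _ /=.
  by rewrite subr0 G_le.
- move=> k; have [A A0 AP] := G_taylor k; exists A => // x y sx sy.
  apply/ler_addgt0Pr => e e0.
  have h1 : 0 < 1 + `|y - x| by rewrite ltr_wpDr.
  have e4 : 0 < e / 4 by rewrite divr_gt0.
  have eh : 0 < e / 4 / (1 + `|y - x|) by rewrite divr_gt0.
  have [N1 N1P] := FP (k, y) sy _ e4.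
  have [N2 N2P] := FP (k, x) sx _ e4.
  have [N3 N3P] := FP (k.+1, x) sx _ eh.
  pose n := maxn N1 (maxn N2 N3).
  have n1 := N1P n (leq_maxl _ _).
  have n2 := N2P n (leq_trans (leq_maxl _ _) (leq_maxr _ _)).
  have n3 := N3P n (leq_trans (leq_maxr _ _) (leq_maxr _ _)).
  move: n1 n2 n3 => /= n1 n2 n3.
  have n4 : cnorm ((G n k.+1 x - F (k.+1, x)) * (y - x)%:C) <= e / 4.
    rewrite cnormM cnorm_real; rewrite ltr_pdivlMr // in n3.
    by apply: le_trans (ltW n3); rewrite ler_wpM2l ?cnorm_ge0 // lerDr.
  have n5 := AP n x y sx sy.
  have -> : F (k, y) - F (k, x) - F (k.+1, x) * (y - x)%:C =
    (G n k y - G n k x - G n k.+1 x * (y - x)%:C) - (G n k y - F (k, y))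
    + ((G n k x - F (k, x)) + (G n k.+1 x - F (k.+1, x)) * (y - x)%:C) by ring.
  set a := G n k y - G n k x - _ in n5 *; set b := G n k y - F (k, y) in n1 *.
  set d := G n k x - F (k, x) in n2 *; set d' := _ * (y - x)%:C in n4 *.
  have := cnormD (a - b) (d + d'); have := cnormB a b; have := cnormD d d'; lra.
Qed.

End SmoothLimits.

(** * Derivatives along the segment *)

Section DeriveOn.
Variable R : realType.

Lemma segmentIP (z : R[i]) : segmentI R z <-> exists2 x, segment_pt x & z = x%:C.
Proof.
by split=> [[x /= + <-]|[x sx ->]]; [rewrite in_itv; exists x|exists x; rewrite //= in_itv].
Qed.

Lemma within_segment_proper x : segment_pt x ->
  ProperFilter (within (segmentI R) (x%:C)^').
Proof.
move=> sx; apply: Build_ProperFilter_ex => P PF.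
have /nbhs_cnormP[e e0 eP] :
  nbhs x%:C [set w | w != x%:C -> segmentI R w -> P w] := PF.
have [|y [sy yx ye]] := @segment_near R x (e / 2) _ sx; first exact: divr_gt0.
exists y%:C; apply: eP.
- by rewrite -rmorphB cnorm_real (le_lt_trans ye) // ltr_pdivrMr // ltr_pMr // ltr1n.
- by apply: contra yx => /eqP/complexI->.
- by apply/segmentIP; exists y.
Qed.

Lemma quotient_filter_cvg (f : R[i] -> R[i]) (F0 F1 : R -> R[i]) (A x : R) :
  0 < A -> segment_pt x -> (forall y, segment_pt y -> f y%:C = F0 y) ->
  (forall y, segment_pt y -> cnorm (F0 y - F0 x - F1 x * (y - x)%:C) <= A * (y - x) ^+ 2) ->
  quotient_filter (segmentI R) f x%:C --> F1 x.
Proof.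
move=> A0 sx fF H P /nbhs_cnormP[e e0 eP].
suff : nbhs x%:C [set w | w != x%:C -> segmentI R w -> P ((f w - f x%:C) / (w - x%:C))].
  by [].
apply/nbhs_cnormP; exists (e / A); first exact: divr_gt0.
move=> w wx wx0 /segmentIP[y sy wy]; apply: eP; move: wx wx0; rewrite {}wy.
rewrite -rmorphB cnorm_real ltr_pdivlMr // => yxe yx.
have yx0 : (y - x)%:C != 0 by rewrite rmorphB subr_eq0.
have h0 : 0 < `|y - x| by rewrite -cnorm_real cnorm_gt0.
rewrite !fF // -[X in _ - X](mulfK yx0) -mulrBl cnormM cnormV cnorm_real.
rewrite ltr_pdivrMr // (le_lt_trans (H y sy)) // -real_normK ?num_real // expr2.
by rewrite mulrA mulrC [A * _]mulrC mulrC ltr_pM2r.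
Qed.

(** The quotients only see points of the segment, so agreement of the [k]-th derivative with [F k]
    there suffices to pass to [k.+1]. *)
Lemma derive_on_taylor (f : R[i] -> R[i]) (F : nat -> R -> R[i]) :
  (forall x, segment_pt x -> f x%:C = F 0%N x) ->
  (forall k, exists2 A : R, 0 < A & forall x y, segment_pt x -> segment_pt y ->
     cnorm (F k y - F k x - F k.+1 x * (y - x)%:C) <= A * (y - x) ^+ 2) ->
  (forall k x, segment_pt x -> derive_on_n (segmentI R) k f x%:C = F k x) /\
  infinitely_derivable_on (segmentI R) f.
Proof.
move=> f0 H.
have cvgF k x : segment_pt x ->
    (forall y, segment_pt y -> derive_on_n (segmentI R) k f y%:C = F k y) ->
    quotient_filter (segmentI R) (derive_on_n (segmentI R) k f) x%:C --> F k.+1 x.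
  move=> sx fk; have [A A0 AP] := H k.
  by apply: (quotient_filter_cvg A0 sx fk) => y sy; exact: AP.
have D k : forall x, segment_pt x -> derive_on_n (segmentI R) k f x%:C = F k x.
  elim: k => [|k IH] x sx; first exact: f0.
  rewrite /derive_on_n iterS -/(derive_on_n _ k f) /derive_on.
  have PF := within_segment_proper sx.
  apply: cvg_lim; last exact: cvgF.
  exact: (@norm_hausdorff R[i] R[i]).
split=> // k _ /segmentIP[x sx ->]; apply/cvg_ex; exists (F k.+1 x); apply: cvgF => //.
exact: D.
Qed.

End DeriveOn.

(** * Determination by the left half of the segment *)

Section KernelApproximation.
Variables (R : realType) (d : R).
Hypothesis d_gt0 : 0 < d.

Definition left_pt (x : R) := - 2^-1 <= x <= 0.

Lemma left_segment x : left_pt x -> segment_pt x.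
Proof. by move=> /andP[x1 x2]; rewrite /segment_pt x1 (le_trans x2) ?invr_ge0. Qed.

Definition away w := forall x : R, segment_pt x -> d <= cnorm (w - x%:C).

(** The roles of a Cauchy sum are exchanged: the pole [w] is the variable and the points of the
    segment are fixed. Summing over the terms of a Cauchy sum turns such a combination into one of
    its values on the left half. *)
Definition kernel_sum (s : seq (R[i] * R)) w := \sum_(l <- s) l.1 / (w - l.2%:C).

Definition approximable (phi : R[i] -> R[i]) := forall e : R, 0 < e ->
  exists2 s : seq (R[i] * R), (forall l, l \in s -> left_pt l.2) &
    forall w, away w -> cnorm (phi w - kernel_sum s w) <= e.

Let away_neq0 w x : away w -> segment_pt x -> w - x%:C != 0.
Proof. by move=> aw sx; rewrite -cnorm_gt0 (lt_le_trans d_gt0) ?aw. Qed.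

Let away_inv w x : away w -> segment_pt x -> cnorm (w - x%:C)^-1 <= d^-1.
Proof.
move=> aw sx; rewrite cnormV lef_pV2 ?posrE ?aw //.
by rewrite cnorm_gt0 away_neq0.
Qed.

Lemma approximable_limit phi :
  (forall e : R, 0 < e -> exists2 psi, approximable psi &
     forall w, away w -> cnorm (phi w - psi w) <= e) -> approximable phi.
Proof.
move=> H e e0; have e2 : 0 < e / 2 by rewrite divr_gt0.
have [psi psiA psiP] := H _ e2; have [s sP sA] := psiA _ e2.
exists s => // w aw; have := psiP w aw; have := sA w aw.
have := cdistD (psi w) (phi w) (kernel_sum s w); lra.
Qed.

Lemma approximable_ext phi psi : (forall w, away w -> phi w = psi w) ->
  approximable phi -> approximable psi.
Proof.
move=> E A; apply: approximable_limit => e e0; exists phi => // w aw.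
by rewrite E // subrr cnorm0 ltW.
Qed.

Lemma approximableD phi psi : approximable phi -> approximable psi ->
  approximable (fun w => phi w + psi w).
Proof.
move=> A B e e0; have e2 : 0 < e / 2 by rewrite divr_gt0.
have [s sP sA] := A _ e2; have [s' sP' sA'] := B _ e2.
exists (s ++ s') => [l|w aw]; first by rewrite mem_cat => /orP[]; [exact: sP|exact: sP'].
rewrite /kernel_sum big_cat /= opprD addrACA (le_trans (cnormD _ _)) //.
by have := sA w aw; have := sA' w aw; rewrite /kernel_sum; lra.
Qed.

Lemma approximable0 : approximable (fun=> 0).
Proof.
by move=> e e0; exists [::] => // w _; rewrite /kernel_sum big_nil subrr cnorm0 ltW.
Qed.

Lemma approximableZ a phi : approximable phi -> approximable (fun w => a * phi w).
Proof.
move=> A e e0; have a0 : 0 < cnorm a + 1 by rewrite ltr_wpDl ?cnorm_ge0.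
have [|s sP sA] := A (e / (cnorm a + 1)); first exact: divr_gt0.
exists [seq (a * l.1, l.2) | l <- s] => [l /mapP[k ks ->]|w aw]; first exact: (sP _ ks).
have -> : kernel_sum [seq (a * l.1, l.2) | l <- s] w = a * kernel_sum s w.
  by rewrite /kernel_sum big_map mulr_sumr; apply: eq_bigr => l _; rewrite mulrA.
have := sA w aw; rewrite ler_pdivlMr // -mulrBr cnormM => H; apply: le_trans H.
by rewrite mulrC ler_wpM2l ?cnorm_ge0 // lerDl.
Qed.

Lemma approximable_sum (I : eqType) (s : seq I) (phi : I -> R[i] -> R[i]) :
  (forall i, i \in s -> approximable (phi i)) ->
  approximable (fun w => \sum_(i <- s) phi i w).
Proof.
elim: s => [|i s IH] H.
  by apply: approximable_ext approximable0 => w _; rewrite big_nil.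
apply: (@approximable_ext (fun w => phi i w + \sum_(j <- s) phi j w)).
  by move=> w _; rewrite big_cons.
apply: approximableD; first exact: H (mem_head _ _).
by apply: IH => j js; apply: H; rewrite inE js orbT.
Qed.

Lemma approximable_kernel x : left_pt x -> approximable (fun w => (w - x%:C)^-1).
Proof.
move=> lx e e0; exists [:: (1, x)] => [l|w aw]; first by rewrite inE => /eqP->.
by rewrite /kernel_sum big_seq1 mul1r subrr cnorm0 ltW.
Qed.

(** Distinct kernels are handled by partial fractions. The square of a kernel is a uniform limit of
    products of distinct ones, with error at most [d^-1 ^+ 3] times the distance of the two
    points. *)
Lemma approximable_kernel2 x y : left_pt x -> left_pt y ->
  approximable (fun w => (w - x%:C)^-1 * (w - y%:C)^-1).
Proof.
have dist u v : left_pt u -> left_pt v -> u != v ->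
    approximable (fun w => (w - u%:C)^-1 * (w - v%:C)^-1).
  move=> lu lv uv;
    have uvC : u%:C - v%:C != 0 by rewrite -rmorphB -cnorm_gt0 cnorm_real normr_gt0 subr_eq0.
  have := approximableD (approximable_kernel lu) (approximableZ (-1) (approximable_kernel lv)).
  move=> /(approximableZ (u%:C - v%:C)^-1); apply: approximable_ext => w aw.
  have u0 := away_neq0 aw (left_segment lu); have v0 := away_neq0 aw (left_segment lv).
  by field; rewrite uvC u0 v0.
move=> lx ly; have [xy|] := eqVneq x y; last exact: dist.
rewrite -{y ly}xy; apply: approximable_limit => e e0.
have [y [ly yx ye]] : exists y, [/\ left_pt y, x != y & `|y - x| <= e * d ^+ 3].
  (* A shift by at most 1/4, to the right in the left part of the interval and to the left
     otherwise, remains between -1/2 and 0. *)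
  pose t : R := Num.min (e * d ^+ 3) (4^-1).
  have t0 : 0 < t by rewrite lt_min mulr_gt0 ?exprn_gt0 //= invr_gt0.
  have t1 : t <= e * d ^+ 3 by rewrite /t ge_min lexx.
  have t2 : t <= 4^-1 by rewrite /t ge_min lexx orbT.
  move: lx => /andP[x1 x2]; have [xp|xn] := leP x (- 4^-1).
    exists (x + t); rewrite /left_pt addrAC subrr add0r gtr0_norm //; split=> //.
      by apply/andP; split; lra.
    by rewrite lt_eqF // ltrDl.
  exists (x - t); rewrite /left_pt addrAC subrr sub0r normrN gtr0_norm //; split=> //.
    by apply/andP; split; lra.
  by rewrite gt_eqF // ltrBlDr ltrDl.
exists (fun w => (w - x%:C)^-1 * (w - y%:C)^-1); first exact: dist.
move=> w aw; have sx := left_segment lx; have sy := left_segment ly.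
have x0 := away_neq0 aw sx; have y0 := away_neq0 aw sy.
have -> : (w - x%:C)^-1 * (w - x%:C)^-1 - (w - x%:C)^-1 * (w - y%:C)^-1 =
    (x - y)%:C * (w - x%:C)^-1 * (w - x%:C)^-1 * (w - y%:C)^-1.
  by rewrite rmorphB; field; rewrite x0 y0.
rewrite !cnormM cnorm_real distrC.
have ix := away_inv aw sx; have iy := away_inv aw sy.
have d3 : e = e * d ^+ 3 * d^-1 * d^-1 * d^-1 by field; rewrite gt_eqF.
by rewrite [leRHS]d3 !ler_pM ?mulr_ge0 ?cnorm_ge0.
Qed.

Lemma approximable_mul_kernel phi x : left_pt x -> approximable phi ->
  approximable (fun w => phi w * (w - x%:C)^-1).
Proof.
move=> lx A; apply: approximable_limit => e e0.
have [|s sP sA] := A (e * d); first exact: mulr_gt0.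
exists (fun w => \sum_(l <- s) l.1 * ((w - l.2%:C)^-1 * (w - x%:C)^-1)).
  apply: (@approximable_sum _ s (fun l w => l.1 * ((w - l.2%:C)^-1 * (w - x%:C)^-1))).
  by move=> l /sP ll; apply: approximableZ; exact: approximable_kernel2.
move=> w aw; under eq_bigr do rewrite mulrA.
rewrite -mulr_suml -mulrBl cnormM -[leRHS](mulfK (lt0r_neq0 d_gt0)).
by rewrite ler_pM ?cnorm_ge0 ?sA ?away_inv //; exact: left_segment.
Qed.

(** Closure under products provides the powers of a kernel, hence the terms of its geometric
    expansion at a nearby point. *)
Lemma approximableM phi psi (B : R) : 0 <= B -> (forall w, away w -> cnorm (phi w) <= B) ->
  approximable phi -> approximable psi -> approximable (fun w => phi w * psi w).
Proof.
move=> B0 phiB A A'; apply: approximable_limit => e e0.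
have B1 : 0 < B + 1 by rewrite ltr_wpDl.
have [|s sP sA] := A' (e / (B + 1)); first exact: divr_gt0.
exists (fun w => \sum_(l <- s) l.1 * (phi w * (w - l.2%:C)^-1)).
  apply: (@approximable_sum _ s (fun l w => l.1 * (phi w * (w - l.2%:C)^-1))).
  by move=> l /sP ll; apply: approximableZ; exact: approximable_mul_kernel.
move=> w aw; under eq_bigr do rewrite mulrCA.
rewrite -mulr_sumr -mulrBr cnormM.
have -> : e = (B + 1) * (e / (B + 1)) by rewrite mulrCA mulfV ?mulr1 ?gt_eqF.
by rewrite ler_pM ?cnorm_ge0 ?sA // (le_trans (phiB w aw)) // lerDl.
Qed.

Lemma approximable_kernelX y j : segment_pt y -> approximable (fun w => (w - y%:C)^-1) ->
  approximable (fun w => (w - y%:C)^-1 ^+ j.+1).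
Proof.
move=> sy A; elim: j => [|j IH]; first by apply: approximable_ext A => w _; rewrite expr1.
apply: (@approximable_ext (fun w => (w - y%:C)^-1 * (w - y%:C)^-1 ^+ j.+1)).
  by move=> w _; rewrite -exprS.
apply: (@approximableM _ _ d^-1) => //; first by rewrite invr_ge0 ltW.
by move=> w aw; exact: away_inv.
Qed.

(* Geometric expansion of the kernel at [z] around the nearby pole [y]. *)
Lemma approximable_push y z : segment_pt y -> segment_pt z -> `|z - y| <= d / 2 ->
  approximable (fun w => (w - y%:C)^-1) -> approximable (fun w => (w - z%:C)^-1).
Proof.
move=> sy sz zy A; apply: approximable_limit => e e0.
have [|J Je] := @exp2V_lt R (e * d); first exact: mulr_gt0.
exists (fun w => \sum_(j <- iota 0 J) (z - y)%:C ^+ j * (w - y%:C)^-1 ^+ j.+1).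
  apply: (@approximable_sum _ (iota 0 J) (fun j w => (z - y)%:C ^+ j * (w - y%:C)^-1 ^+ j.+1)).
  by move=> j _; apply: approximableZ; exact: approximable_kernelX.
move=> w aw; have y0 := away_neq0 aw sy; have z0 := away_neq0 aw sz.
pose q := (z - y)%:C * (w - y%:C)^-1.
have -> : \sum_(j <- iota 0 J) (z - y)%:C ^+ j * (w - y%:C)^-1 ^+ j.+1 =
    (w - y%:C)^-1 * \sum_(j < J) q ^+ j.
  rewrite -{1}[J]subn0 -/(index_iota 0 J) big_mkord mulr_sumr.
  by apply: eq_bigr => j _; rewrite /q exprMn exprS mulrCA.
have q1 : cnorm q <= 2^-1.
  rewrite /q cnormM cnorm_real; apply: (@le_trans _ _ (d / 2 * d^-1)).
    by rewrite ler_pM ?cnorm_ge0 ?away_inv.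
  by rewrite mulrAC mulfV ?mul1r // gt_eqF.
have Eq : (w - z%:C)^-1 - (w - y%:C)^-1 * \sum_(j < J) q ^+ j = q ^+ J * (w - z%:C)^-1.
  have E1 : (1 - q) * (w - y%:C) = w - z%:C by rewrite /q rmorphB; field.
  have q0 : 1 - q != 0 by apply: contraNneq z0 => q0; rewrite -E1 q0 mul0r.
  have E2 : \sum_(j < J) q ^+ j = (1 - q ^+ J) / (1 - q).
    by rewrite -[1 - q ^+ J]opprB subrX1 -mulNr opprB mulrC mulKf.
  by rewrite E2 -E1; field; rewrite y0 q0.
rewrite Eq cnormM cnormX.
have -> : e = e * d * d^-1 by rewrite mulfK // gt_eqF.
apply: ler_pM; rewrite ?exprn_ge0 ?cnorm_ge0 ?away_inv //.
apply: le_trans (ltW Je); rewrite -exprVn lerXn2r ?nnegrE ?cnorm_ge0 ?invr_ge0 //.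
Qed.

(* The poles are pushed from [0] to [z] in steps of length at most [d / 2]. *)
Lemma approximable_segment z : segment_pt z -> approximable (fun w => (w - z%:C)^-1).
Proof.
have step n : forall y, segment_pt y -> y <= n%:R * (d / 2) ->
    approximable (fun w => (w - y%:C)^-1).
  elim: n => [|n IH] y sy yn.
    by apply: approximable_kernel; move: sy => /andP[y1 _]; rewrite /left_pt y1;
      rewrite mul0r in yn.
  have [y0|y0] := leP y 0.
    by apply: approximable_kernel; move: sy => /andP[y1 _]; rewrite /left_pt y1.
  pose x := Num.max 0 (y - d / 2).
  have d2 : 0 < d / 2 by rewrite divr_gt0.
  have x0 : 0 <= x by rewrite /x le_max lexx.
  have xy : x <= y by rewrite /x ge_max (ltW y0) gerBl ltW.
  have yx : y - d / 2 <= x by rewrite /x le_max lexx orbT.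
  have xn : x <= n%:R * (d / 2).
    rewrite /x ge_max mulr_ge0 ?ler0n ?(ltW d2) //=.
    by move: yn; rewrite -natr1 mulrDl mul1r; lra.
  have sx : segment_pt x.
    by move: sy; rewrite /segment_pt => /andP[y1 y2]; apply/andP; split; lra.
  apply: (approximable_push sx sy); last exact: IH.
  by rewrite ger0_norm; lra.
move=> sz; apply: (step (Num.bound (z / (d / 2)))) => //.
have d2 : 0 < d / 2 by rewrite divr_gt0.
rewrite -ler_pdivrMr //; have [y0|y0] := leP 0 z.
  by apply/ltW/archi_boundP; rewrite divr_ge0 // ltW.
by apply: (@le_trans _ _ 0); rewrite ?ler0n // pmulr_lle0 ?invr_gt0 // ltW.
Qed.

End KernelApproximation.

(** * Vanishing on the left half forces vanishing at 1/2 *)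

Section Vanishing.
Variable R : realType.

Lemma sum_exp2V N J : \sum_(N <= j < J) 2 ^- j <= 2 * 2 ^- N :> R.
Proof.
have [NJ|/ltnW NJ] := leqP N J; last first.
  by rewrite big_geq // mulr_ge0 // invr_ge0 exprn_ge0.
have : \sum_(N <= j < J) 2 ^- j <= 2 * 2 ^- N - 2 * 2 ^- J :> R.
  rewrite -(subnKC NJ); elim: (J - N)%N => [|m IH].
    by rewrite addn0 big_geq // subrr.
  have E : 2 ^- (N + m).+1 = 2 ^- (N + m) / 2 :> R by rewrite exprS invfM mulrC.
  by rewrite addnS big_nat_recr ?leq_addr //= E; lra.
have : 0 < 2 ^- J :> R by rewrite invr_gt0 exprn_gt0.
by lra.
Qed.

(** The part [P] of the weight costs at most [P] because the total of [eps] is at most 1. The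
    possibly huge part [Q] occurs only from level [N] on, where [eps] absorbs it. Both the vanishing
    argument and the bounds on derivatives rest on this split. *)
Lemma weighted_eps (eps b Q : nat -> R) (P : R) N J : 0 <= P ->
  (forall j, 0 <= eps j) -> \sum_(0 <= j < J) eps j <= 1 ->
  (forall j, b j <= P + (N <= j)%N%:R * Q j) ->
  (forall j, (N <= j)%N -> eps j * Q j <= 2 ^- j) ->
  \sum_(0 <= j < J) eps j * b j <= P + 2 * 2 ^- N.
Proof.
move=> P0 e0 e1 bP eQ.
apply: (@le_trans _ _ (\sum_(0 <= j < J) (P * eps j + (N <= j)%N%:R * 2 ^- j))).
  apply: ler_sum => j _; rewrite (le_trans (ler_wpM2l (e0 j) (bP j))) //.
  rewrite mulrDr [eps j * P]mulrC lerD2l.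
  by case: leqP => [/eQ|_]; rewrite ?mul1r ?mul0r ?mulr0.
rewrite big_split /= -mulr_sumr lerD //; first by rewrite ler_piMr.
apply: le_trans (sum_exp2V N J).
rewrite [leRHS]big_geq_mkord big_mkord [leRHS]big_mkcond /=.
by apply: ler_sum => j _; case: leqP; rewrite ?mul1r ?mul0r.
Qed.

Lemma kernel_approx (d e : R) : 0 < d -> 0 < e ->
  exists2 s : seq (R[i] * R), (forall l, l \in s -> left_pt l.2) &
    forall w, away d w -> cnorm ((w - (2^-1)%:C)^-1 - kernel_sum s w) <= e.
Proof.
move=> d0 e0; apply: (approximable_segment d0) e0.
by rewrite /segment_pt lexx andbT; apply: (@le_trans _ _ 0); rewrite ?oppr_le0 invr_ge0.
Qed.

Variables (delta eps : nat -> R) (s : nat -> seq (R[i] * R)) (f : R[i] -> R[i]) (M : R).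
Hypothesis delta_gt0 : forall j, 0 < delta j.
Hypothesis delta_mono : forall i j, (i <= j)%N -> delta j <= delta i.
Hypothesis eps_ge0 : forall j, 0 <= eps j.
Hypothesis eps_sum : forall J, \sum_(0 <= j < J) eps j <= 1.
Hypothesis s_left : forall N l, l \in s N -> left_pt l.2.
Hypothesis s_approx : forall N w, away (delta N / 2) w ->
  cnorm ((w - (2^-1)%:C)^-1 - kernel_sum (s N) w) <= 2 ^- N.
Hypothesis eps_s : forall i j, (i <= j)%N ->
  eps j * ((1 + \sum_(l <- s i) cnorm l.1) * (delta j / 2)^-1) <= 2 ^- j.
Hypothesis M_ge0 : 0 <= M.
Hypothesis f_csum : forall e : R, 0 < e -> exists T : seq (R[i] * R[i] * nat),
    [/\ forall t, t \in T -> forall x, segment_pt x -> delta t.2 / 2 <= cnorm (t.1.2 - x%:C),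
        exists J, forall b, monotone_weight b ->
          cweight b T <= M * (b 0%N + \sum_(0 <= j < J) eps j * b j) &
        forall x, segment_pt x -> cnorm (csum T x%:C - f x%:C) <= e].

Lemma vanishing_propagates : (forall x, left_pt x -> f x%:C = 0) -> f (2^-1)%:C = 0.
Proof.
move=> f0; apply/eqP; rewrite -cnorm_eq0 eq_le cnorm_ge0 andbT.
have half : segment_pt (2^-1 : R).
  by rewrite /segment_pt lexx andbT; apply: (@le_trans _ _ 0); rewrite ?oppr_le0 invr_ge0.
apply/ler_addgt0Pr => eta eta0; rewrite add0r.
have M4 : 0 < 4 * M + 1 by rewrite ltr_wpDl ?mulr_ge0.
have [|N' Ne'] := @exp2V_lt R (eta / 2 / (4 * M + 1)); first by rewrite !divr_gt0.
rewrite ltr_pdivlMr // in Ne'.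
pose N := N'.+1.
have Ne : 2 ^- N * (4 * M) <= eta / 2.
  have : 2 ^- N = 2 ^- N' / 2 :> R by rewrite /N exprS invfM mulrC.
  have : 0 < 2 ^- N' :> R by rewrite invr_gt0 exprn_gt0.
  move=> h ->; move: h Ne'; set y := 2 ^- N' => y0.
  have : 0 <= y * M by rewrite mulr_ge0 // ltW.
  by lra.
pose Lam := \sum_(l <- s N) cnorm l.1.
have Lam0 : 0 <= Lam by rewrite sumr_ge0 // => l _; exact: cnorm_ge0.
(* The error of the Cauchy sum enters once at 1/2 and, through the combination of its values on the
   left half, with total coefficient [Lam]. *)
have e0 : 0 < eta / 2 / (1 + Lam) by rewrite !divr_gt0 // ltr_wpDr.
have [T [TD [J TW] TA]] := f_csum e0.
pose Psi w := (w - (2^-1)%:C)^-1 - kernel_sum (s N) w.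
(* Poles of level below [N] are far enough from I for the kernel approximation. From level [N] on
   only the trivial bound of each kernel is available, and [eps_s] compensates for it. *)
pose b m := 2 ^- N + (N <= m)%N%:R * ((1 + Lam) * (delta m / 2)^-1).
have b_mono : monotone_weight b.
  have pos m : 0 <= (1 + Lam) * (delta m / 2)^-1.
    apply: mulr_ge0; first exact: addr_ge0.
    by rewrite invr_ge0 ltW // divr_gt0.
  split=> [m|m n mn].
    apply: addr_ge0; first by rewrite invr_ge0 exprn_ge0.
    by apply: mulr_ge0; [exact: ler0n|exact: pos].
  rewrite /b lerD2l; case: (leqP N m) => Nm; last first.
    by rewrite mul0r; apply: mulr_ge0; [exact: ler0n|exact: pos].
  rewrite (leq_trans Nm mn) !mul1r ler_wpM2l ?addr_ge0 //.
  by rewrite lef_pV2 ?posrE ?divr_gt0 // ler_pM2r ?invr_gt0 // delta_mono.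
have Psi_le t : t \in T -> cnorm (Psi t.1.2) <= b t.2.
  move=> tT; rewrite /b; case: (leqP N t.2) => Nt; last first.
    rewrite mul0r addr0; apply: s_approx => x sx.
    apply: le_trans (TD t tT x sx); rewrite ler_pM2r ?invr_gt0 //.
    exact: delta_mono (ltnW Nt).
  have inv x : segment_pt x -> cnorm (t.1.2 - x%:C)^-1 <= (delta t.2 / 2)^-1.
    move=> sx; have dx := TD t tT x sx; have d2 : 0 < delta t.2 / 2 by rewrite divr_gt0.
    by rewrite cnormV lef_pV2 ?posrE // (lt_le_trans d2).
  rewrite ler_wpDl ?invr_ge0 ?exprn_ge0 // mul1r mulrDl mul1r.
  rewrite (le_trans (cnormB _ _)) // lerD ?inv // /kernel_sum (le_trans (cnorm_sum _ _ _)) //.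
  rewrite mulr_suml big_seq [leRHS]big_seq; apply: ler_sum => l ls.
  by rewrite cnormM ler_wpM2l ?cnorm_ge0 ?inv //; exact: left_segment (s_left ls).
have E : csum T (2^-1)%:C - \sum_(l <- s N) l.1 * csum T l.2%:C =
    \sum_(t <- T) t.1.1 * Psi t.1.2.
  rewrite /csum; under [X in _ - X]eq_bigr do rewrite mulr_sumr.
  rewrite exchange_big -sumrB; apply: eq_bigr => t _; rewrite /Psi mulrBr; congr (_ - _).
  by rewrite /kernel_sum mulr_sumr; apply: eq_bigr => l _; rewrite mulrCA.
have h1 : cnorm (\sum_(t <- T) t.1.1 * Psi t.1.2) <= eta / 2.
  apply: (@le_trans _ _ (cweight b T)).
    rewrite (le_trans (cnorm_sum _ _ _)) // /cweight big_seq [leRHS]big_seq.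
    by apply: ler_sum => t tT; rewrite cnormM ler_wpM2l ?cnorm_ge0 ?Psi_le.
  apply: le_trans (TW b b_mono) _; apply: le_trans Ne.
  have b0 : b 0%N = 2 ^- N by rewrite /b mul0r addr0.
  have P0 : 0 <= 2 ^- N :> R by rewrite invr_ge0 exprn_ge0.
  have Hb : \sum_(0 <= j < J) eps j * b j <= 2 ^- N + 2 * 2 ^- N.
    apply: (weighted_eps P0 eps_ge0 (eps_sum J)) => [m|m]; first exact: lexx.
    exact: eps_s.
  rewrite b0 mulrC mulrA ler_wpM2r //; lra.
have h2 : cnorm (\sum_(l <- s N) l.1 * csum T l.2%:C) <= Lam * (eta / 2 / (1 + Lam)).
  rewrite (le_trans (cnorm_sum _ _ _)) // /Lam mulr_suml big_seq [leRHS]big_seq.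
  apply: ler_sum => l ls; rewrite cnormM ler_wpM2l ?cnorm_ge0 //.
  have ll := s_left ls; have := TA l.2 (left_segment ll).
  by rewrite f0 // subr0.
have h3 := TA _ half.
have h4 : (1 + Lam) * (eta / 2 / (1 + Lam)) = eta / 2.
  by rewrite mulrCA mulfV ?mulr1 // gt_eqF // ltr_wpDr.
rewrite -E in h1.
have := cdistD (csum T (2^-1)%:C) (f (2^-1)%:C) 0.
rewrite !subr0 (cdistC (f _)).
have := cnormD (csum T (2^-1)%:C - \sum_(l <- s N) l.1 * csum T l.2%:C)
  (\sum_(l <- s N) l.1 * csum T l.2%:C).
rewrite subrK; lra.
Qed.

End Vanishing.

(** * Slow growth of the derivatives *)

Section Divergence.
Variable R : realType.

Lemma harmonic_unbounded (x : R) N : exists2 n, (N <= n)%N &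
  x <= \sum_(1 <= k < n.+1) k%:R^-1.
Proof.
have term_ge0 k : 0 <= k%:R^-1 :> R by rewrite invr_ge0 ler0n.
have H m : m%:R / 2 <= \sum_(1 <= k < (2 ^ m).+1) k%:R^-1 :> R.
  elim: m => [|m IH]; first by rewrite mul0r sumr_ge0.
  have e1 : ((2 ^ m).+1 <= (2 ^ m.+1).+1)%N by rewrite ltnS leq_pexp2l.
  rewrite (big_cat_nat _ e1) //=.
  apply: (@le_trans _ _ (m%:R / 2 + 1 / 2)); first by rewrite -natr1 mulrDl.
  apply: lerD => //.
  apply: (@le_trans _ _ (\sum_((2 ^ m).+1 <= k < (2 ^ m.+1).+1) (2 ^ m.+1)%:R^-1)).
    have cnt : ((2 ^ m.+1).+1 - (2 ^ m).+1 = 2 ^ m)%N by rewrite subSS expnS; lia.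
    have m0 : (2 ^ m)%:R != 0 :> R by rewrite pnatr_eq0 -lt0n expn_gt0.
    rewrite big_const_nat iter_addr_0 cnt -[leRHS]mulr_natr.
    have -> : (2 ^ m.+1)%:R = 2 * (2 ^ m)%:R :> R by rewrite expnS natrM.
    by rewrite invfM mulfVK // div1r.
  rewrite [leLHS]big_nat [leRHS]big_nat; apply: ler_sum => k /andP[k1 k2].
  rewrite lef_pV2 ?posrE ?ltr0n ?ler_nat ?expn_gt0 //.
  exact: leq_ltn_trans k1.
pose m := maxn N (Num.bound (2 * `|x|)).
have Nm : (N <= m)%N by exact: leq_maxl.
exists (2 ^ m)%N; first by rewrite (leq_trans Nm) // ltnW // ltn_expl.
apply: le_trans (H m); rewrite ler_pdivlMr // mulrC.
have h : 0 <= 2 * `|x| by rewrite mulr_ge0.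
apply: (@le_trans _ _ (2 * `|x|)); first by rewrite ler_pM2l // ler_norm.
by apply: le_trans (ltW (archi_boundP h)) _; rewrite ler_nat leq_maxr.
Qed.

Lemma fact_le_expn k : (k`! <= k ^ k)%N.
Proof.
elim: k => // k IH; rewrite factS expnS leq_mul2l /= (leq_trans IH) //.
by case: (k) => // j; rewrite leq_exp2r // leqnSn.
Qed.

Lemma inv_root_ge (k : nat) (s : \bar R) (t : R) : (0 < k)%N -> 0 < t -> (0 <= s)%E ->
  (s <= (t ^+ k)%:E)%E -> ((t^-1)%:E <= inv_root k s)%E.
Proof.
move=> k0 t0 s0 st.
have r0 : 0 <= k%:R^-1 :> R by rewrite invr_ge0 ler0n.
have st' : (s `^ (k%:R^-1) <= t%:E)%E.
  have -> : t%:E = ((t ^+ k)%:E `^ (k%:R^-1))%E.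
    rewrite poweR_EFin; congr EFin.
    rewrite -powR_mulrn ?(ltW t0) // -powRrM mulfV ?pnatr_eq0 -?lt0n //.
    by rewrite powRr1 // ltW.
  apply: gt0_ler_poweR => //; rewrite in_itv /= ?leey ?andbT //.
  by rewrite lee_fin exprn_ge0 // ltW.
have -> : (t^-1)%:E = ((t%:E)^-1)%E by rewrite inver gt_eqF.
rewrite /inv_root lee_pV2 // inE ?poweR_ge0 //.
by rewrite lee_fin ltW.
Qed.

Lemma inv_root_ge0 (k : nat) (s : \bar R) : (0 <= inv_root k s)%E.
Proof. by rewrite /inv_root inve_ge0 poweR_ge0. Qed.

Lemma supnorm_ge0 (S : set R[i]) (g : R[i] -> R[i]) z : S z -> (0 <= supnorm S g)%E.
Proof.
move=> Sz; apply: (@le_trans _ _ (cnorm (g z))%:E); first by rewrite lee_fin cnorm_ge0.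
by apply: ereal_sup_ubound; exists z.
Qed.

Section SmoothWithSlowGrowth.
Variables (delta eps : nat -> R) (bb : nat -> nat) (f : R[i] -> R[i]) (M : R).
Hypothesis delta_gt0 : forall j, 0 < delta j.
Hypothesis delta_mono : forall i j, (i <= j)%N -> delta j <= delta i.
Hypothesis delta0_le : delta 0%N * 2 <= 1.
Hypothesis eps_ge0 : forall j, 0 <= eps j.
Hypothesis eps_sum : forall J, \sum_(0 <= j < J) eps j <= 1.
Hypothesis bb_ge : forall N, (N <= bb N)%N.
Hypothesis bb_sum : forall N,
  N%:R * (delta N / 2) ^- 3 <= \sum_(1 <= k < (bb N).+1) k%:R^-1.
Hypothesis eps_bb : forall i j, (i <= j)%N ->
  eps j * (delta j / 2) ^- (bb i).+1 <= 2 ^- j.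
Hypothesis M_ge1 : 1 <= M.
Hypothesis f_csum : forall e : R, 0 < e -> exists T : seq (R[i] * R[i] * nat),
    [/\ forall t, t \in T -> forall x, segment_pt x -> delta t.2 / 2 <= cnorm (t.1.2 - x%:C),
        exists J, forall b, monotone_weight b ->
          cweight b T <= M * (b 0%N + \sum_(0 <= j < J) eps j * b j) &
        forall x, segment_pt x -> cnorm (csum T x%:C - f x%:C) <= e].

Let q N := (delta N / 2)^-1.

Let d2_gt0 j : 0 < delta j / 2. Proof. by rewrite divr_gt0. Qed.

Let q_ge4 N : 4 <= q N.
Proof.
have d4 : delta N / 2 <= 4^-1.
  have := delta_mono (leq0n N); move: delta0_le.
  move: (delta N) (delta 0%N) => u v uv vu; lra.
by rewrite /q -[leLHS]invrK lef_pV2 ?posrE ?invr_gt0.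
Qed.

Let q_mono i j : (i <= j)%N -> q i <= q j.
Proof.
by move=> ij; rewrite /q lef_pV2 ?posrE // ler_pM2r ?invr_gt0 // delta_mono.
Qed.

Let q_gt0 N : 0 < q N. Proof. by rewrite invr_gt0. Qed.

(** Levels up to [N] count as if all poles were at distance [delta N / 2]. Higher levels are
    absorbed by [eps_bb], whose exponent [(bb i).+1] dominates every [k.+1] in question. The factor
    4 collects the outer circle, the low levels and the remainder [2 * 2 ^- N]. *)
Let weight_le k N T J : (k <= bb N)%N ->
  (forall b, monotone_weight b ->
     cweight b T <= M * (b 0%N + \sum_(0 <= j < J) eps j * b j)) ->
  cweight (fun m => (delta m / 2) ^- k.+1) T <= M * (4 * q N ^+ k.+1).
Proof.
move=> kN TW; have b_mono : monotone_weight (fun m => (delta m / 2) ^- k.+1).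
  split=> [m|m n mn]; first by rewrite invr_ge0 exprn_ge0 // ltW.
  by rewrite -!exprVn lerXn2r ?nnegrE ?invr_ge0 ?(ltW (d2_gt0 _)) ?q_mono.
apply: (le_trans (TW _ b_mono)); rewrite ler_wpM2l ?(le_trans _ M_ge1) //.
have qN1 : 1 <= q N ^+ k.+1 by rewrite exprn_ege1 // (le_trans _ (q_ge4 N)) // ler1n.
have b0 : (delta 0%N / 2) ^- k.+1 <= q N ^+ k.+1.
  by rewrite -exprVn lerXn2r ?nnegrE ?(ltW (q_gt0 _)) ?q_mono.
have P0 : 0 <= q N ^+ k.+1 by rewrite exprn_ge0 // ltW.
have S : \sum_(0 <= j < J) eps j * (delta j / 2) ^- k.+1 <= q N ^+ k.+1 + 2 * 2 ^- N.
  apply: (weighted_eps (Q := fun j => (delta j / 2) ^- k.+1) P0 eps_ge0 (eps_sum J)).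
    move=> j; case: leqP => [_|/ltnW jN]; last first.
      by rewrite mul0r addr0 -exprVn lerXn2r ?nnegrE ?(ltW (q_gt0 _)) ?q_mono.
    by rewrite mul1r lerDr.
  move=> j Nj; apply: le_trans (eps_bb Nj); rewrite ler_wpM2l //.
  rewrite -!exprVn ler_weXn2l //; by rewrite (le_trans _ (q_ge4 j)) // ler1n.
have e2 : 2 ^- N <= 1 :> R by rewrite invf_le1 ?exprn_gt0 // exprn_ege1 // ler1n.
lra.
Qed.

Lemma smooth_slow_growth : infinitely_derivable_on (segmentI R) f /\
  (\sum_(1 <= k <oo)
     inv_root k (supnorm (segmentI R) (derive_on_n (segmentI R) k f)) = +oo)%E.
Proof.
have /choice[T TP] : forall n, exists T : seq (R[i] * R[i] * nat),
    [/\ forall t, t \in T -> forall x, segment_pt x -> delta t.2 / 2 <= cnorm (t.1.2 - x%:C),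
        exists J, forall b, monotone_weight b ->
          cweight b T <= M * (b 0%N + \sum_(0 <= j < J) eps j * b j) &
        forall x, segment_pt x -> cnorm (csum T x%:C - f x%:C) <= 2 ^- n].
  by move=> n; apply: f_csum; rewrite invr_gt0 exprn_gt0.
have TW k N n : (k <= bb N)%N ->
    cweight (fun m => (delta m / 2) ^- k.+1) (T n) <= M * (4 * q N ^+ k.+1).
  by move=> kN; have [_ [J TJ] _] := TP n; exact: weight_le TJ.
have [||||F [F0 Fle FT]] := @csum_smooth R (fun m => delta m / 2) T (fun x => f x%:C).
- exact: d2_gt0.
- by move=> n t tT x sx; have [H _ _] := TP n; exact: H.
(* Every order [k] is covered by the choice [N = k], thanks to [bb_ge]. *)
- move=> k; exists (M * (4 * q k ^+ k.+1)) => n.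
  apply: le_trans (TW k k n (bb_ge k)).
  rewrite /cweight; apply: ler_sum => t _; rewrite ler_wpM2l ?cnorm_ge0 //.
  rewrite -!exprVn ler_weXn2l //; by rewrite (le_trans _ (q_ge4 _)) // ler1n.
- by move=> n x sx; have [_ _ H] := TP n; exact: H.
have [DF DI] := @derive_on_taylor R f F (fun x sx => esym (F0 x sx)) FT.
split=> //; apply: eq_infty => A.
pose s k := supnorm (segmentI R) (derive_on_n (segmentI R) k f).
have M0 : 0 < M by rewrite (lt_le_trans _ M_ge1).
have s_le k N : (0 < k)%N -> (k <= bb N)%N ->
    (s k <= ((M * k%:R * q N ^+ 3) ^+ k)%:E)%E.
  move=> k0 kN; apply: supnorm_le => _ /segmentIP[x sx ->]; rewrite DF //.
  apply: le_trans (Fle k x _ sx (fun n => TW k N n kN)) _.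
  rewrite exprMn [(M * _) ^+ k]exprMn -exprM.
  have f1 : k`!%:R <= k%:R ^+ k :> R by rewrite -natrX ler_nat fact_le_expn.
  have M1 : M <= M ^+ k by rewrite -[leLHS]expr1 ler_weXn2l.
  have q1 : 1 <= q N by rewrite (le_trans _ (q_ge4 N)) // ler1n.
  (* As [q N] is at least 4, it absorbs the constant, and [k.+2 <= 3 * k] for positive [k]. This is
     the origin of the exponent 3 in [bb_sum]: the [k]-th root of the bound is linear in [k] with
     slope [M * q N ^+ 3]. *)
  have q3 : 4 * q N ^+ k.+1 <= q N ^+ (3 * k).
    apply: (@le_trans _ _ (q N ^+ k.+2)).
      by rewrite [leRHS]exprS ler_wpM2r // exprn_ge0 // ltW.
    by rewrite ler_weXn2l //; lia.
  rewrite mulrCA mulrA; apply: ler_pM;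
    rewrite ?mulr_ge0 ?exprn_ge0 ?ler0n ?(ltW M0) ?(ltW (q_gt0 N)) //.
  by apply: ler_pM; rewrite ?ler0n ?(ltW M0).
have half : segmentI R 0.
  apply/segmentIP; exists 0; rewrite // /segment_pt oppr_le0 invr_ge0.
  by rewrite ler0n.
(* The terms of order up to [bb N] add up to at least [N / M]. *)
pose N := Num.bound (`|A| * M).
have NA : `|A| * M <= N%:R by apply/ltW/archi_boundP; rewrite mulr_ge0 // ltW.
apply: le_trans (nneseries_lim_ge (bb N).+1 _); last by move=> n _ _; exact: inv_root_ge0.
apply: (@le_trans _ _ (\sum_(1 <= k < (bb N).+1) ((M * k%:R * q N ^+ 3)^-1)%:E)%E); last first.
  rewrite [leLHS]big_nat [leRHS]big_nat; apply: lee_sum => k /andP[k1 k2].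
  apply: inv_root_ge => //; last exact: s_le.
    by rewrite !mulr_gt0 ?exprn_gt0 ?ltr0n.
  exact: supnorm_ge0 half.
rewrite sumEFin lee_fin (le_trans (ler_norm A)) //.
under eq_bigr do rewrite -mulrA mulrCA invfM.
rewrite -mulr_suml ler_pdivlMr ?mulr_gt0 ?exprn_gt0 //.
rewrite mulrA (le_trans _ (bb_sum N)) // -exprVn -/(q N) ler_wpM2r // exprn_ge0 // ltW //.
Qed.

End SmoothWithSlowGrowth.
End Divergence.

(** * Jensen measures *)

Section JensenMeasures.
Variable R : realType.
Local Notation borel := (borelC R).

Lemma open_borel (A : set R[i]) : open A -> measurable (A : set borel).
Proof. by move=> oA; apply: sub_sigma_algebra. Qed.

Lemma closed_borel (A : set R[i]) : closed A -> measurable (A : set borel).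
Proof.
by move=> cA; rewrite -[A]setCK; apply: measurableC; apply: open_borel; exact: closed_openC.
Qed.

Lemma open_cball (y : R[i]) (e : R) : open [set z | cnorm (z - y) < e].
Proof.
have -> : [set z | cnorm (z - y) < e] = ~` [set z | e <= cnorm (z - y)].
  by apply/seteqP; split=> z /=; rewrite ltNge => /negP.
by rewrite openC; exact: closed_cdist_ge.
Qed.

Lemma closed_real_itv (a b : R) : closed [set x%:C | x in `[a, b]].
Proof.
apply: compact_closed; first exact: (@norm_hausdorff R[i] R[i]).
apply: continuous_compact; last exact: segment_compact.
apply: continuous_subspaceT => x P /nbhs_cnormP[e e0 eP].
by exists e => //= y xy; apply: eP; rewrite -rmorphB cnorm_real distrC.
Qed.

Lemma closed_segmentI : closed (segmentI R).
Proof. exact: closed_real_itv. Qed.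

Lemma closed_cset1 (x : R[i]) : closed [set x].
Proof.
have -> : [set x] = [set z | cnorm (z - x) <= 0].
  apply/seteqP; split=> z /=; first by move=> ->; rewrite subrr cnorm0.
  by move=> zx; apply/eqP; rewrite -subr_eq0 -cnorm_eq0 eq_le zx cnorm_ge0.
exact: closed_cdist_le.
Qed.

Lemma rational_algebra_bounded (X : set R[i]) f : compact X ->
  {within X, continuous f} -> exists2 C : R, 0 < C & forall z, X z -> cnorm (f z) <= C.
Proof.
move=> cX fX.
have : compact ((fun z => cnorm (f z)) @` X).
  apply: continuous_compact cX; apply/subspace_continuousP => z Xz.
  move/subspace_continuousP : fX => /(_ z Xz) fz.
  by apply: (cvg_comp _ _ fz); exact: continuous_cnorm.
move=> /compact_bounded[M [_ MP]].
exists (`|M| + 1); first by rewrite ltr_wpDl.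
move=> z Xz; have : `|cnorm (f z)| <= `|M| + 1.
  apply: MP; last by exists z.
  by rewrite (le_lt_trans (ler_norm M)) // ltrDl.
by rewrite ger0_norm ?cnorm_ge0.
Qed.

Section Integral.
Local Open Scope ereal_scope.
Variable mu : {measure set borel -> \bar R}.

(** The integral of a nonnegative function is a supremum over the simple functions below it, so the
    comparison reduces to an inclusion between families of simple functions. *)
Lemma ge0_integral_mono (D E : set borel) (f g : borel -> \bar R) :
  (forall z, D z -> 0 <= f z) -> (forall z, E z -> 0 <= g z) -> D `<=` E ->
  (forall z, D z -> f z <= g z) ->
  \int[mu]_(z in D) f z <= \int[mu]_(z in E) g z.
Proof.
move=> f0 g0 DE fg; rewrite !ge0_integralE //.
apply: ereal_sup_le => _ [h /= hf <-]; exists h => //= z.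
apply: (le_trans (hf z)); rewrite /patch; case: ifPn => [zD|_].
  by rewrite mem_set ?fg ?inE //; [exact: set_mem|apply: DE; exact: set_mem].
by case: ifPn => // zE; apply: g0; exact: set_mem.
Qed.

(** Applied with [N = X] and [c = +oo] when a function vanishes on [V], and with a null set [N] and
    a finite [c] when a function peaks on the segment only. *)
Lemma integral_le_bounds (X N V : set borel) (g : borel -> \bar R) (C : R) (c nN nV : \bar R) :
  mu N = nN -> mu V = nV ->
  measurable N -> measurable V -> N `<=` X -> V `<=` X -> (0 <= C)%R -> 0 <= c ->
  (forall z, X z -> ~ N z -> g z <= 0) -> (forall z, N z -> g z <= C%:E) ->
  (forall z, V z -> g z <= - c) ->
  \int[mu]_(z in X) g z <= C%:E * nN - c * nV.
Proof.
move=> <- <- mN mV NX VX C0 c0 gX gN gV; rewrite integralE; apply: leeB.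
  rewrite -integral_cst //.
  have -> : \int[mu]_(z in N) cst C%:E z = \int[mu]_(z in X) ((cst C%:E) \_ N) z.
    by rewrite -integral_mkcondr setIidr.
  apply: ge0_integral_mono => // [z _|z Xz]; rewrite /patch.
    by case: ifPn; rewrite // lee_fin.
  rewrite funeposE; case: ifPn => zN.
    rewrite ge_max; apply/andP; split; last by rewrite lee_fin.
    by apply: gN; exact: set_mem.
  rewrite ge_max lexx andbT; apply: gX => //.
  by move/mem_set; apply/negP.
rewrite -integral_cst //; apply: ge0_integral_mono => // z Vz.
by rewrite /= funenegE le_max leeNr gV.
Qed.

End Integral.

(* By inner regularity it suffices to look at compact sets, which are covered by
   finitely many null discs. *)
Lemma null_of_local_null (X B : set borel) (mu : {measure set borel -> \bar R}) :
  regular_measure mu -> measurable X -> measurable B -> B `<=` X ->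
  (forall y, B y -> exists2 e : R, 0 < e &
     mu (X `&` [set z : borel | cnorm ((z : R[i]) - y) < e]) = 0%E) ->
  mu B = 0%E.
Proof.
move=> reg mX mB BX loc.
have mball (y : R[i]) (e : R) : measurable (X `&` [set z : borel | cnorm ((z : R[i]) - y) < e]).
  by apply: measurableI => //; apply: open_borel; exact: open_cball.
apply/eqP; rewrite eq_le measure_ge0 andbT; have [_ ->] := reg B mB.
apply: ge_ereal_sup => _ [K /= [cK KB] <-].
have /choice[e eP] : forall y : R[i], exists e : R, B y -> 0 < e /\
    mu (X `&` [set z : borel | cnorm ((z : R[i]) - y) < e]) = 0%E.
  move=> y; have [By|nBy] := pselect (B y); last by exists 0.
  by have [e e0 eP] := loc y By; exists e.
have := cK; rewrite compact_cover => /(_ R[i] B (fun y => [set z | cnorm (z - y) < e y])).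
case.
- by move=> y _; exact: open_cball.
- move=> y Ky; exists y; first exact: KB.
  by rewrite /= subrr cnorm0; have [] := eP y (KB y Ky).
move=> F FB KF.
have sub : K `<=` \big[setU/set0]_(y <- finmap.enum_fset F) (X `&` [set z | cnorm (z - y) < e y]).
  move=> z Kz; have [y Fy zy] := KF z Kz; rewrite -bigcup_seq; exists y => //.
  by split=> //; apply: BX; exact: KB.
have mbig (s : seq R[i]) :
    measurable ((\big[setU/set0]_(y <- s) (X `&` [set z | cnorm (z - y) < e y])) : set borel).
  elim: s => [|y s IH]; first by rewrite big_nil; exact: measurable0.
  by rewrite big_cons; exact: measurableU.
have mK : measurable (K : set borel).
  by apply: closed_borel; apply: compact_closed => //; exact: (@norm_hausdorff R[i] R[i]).
apply: (@le_trans _ _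
    (mu (\big[setU/set0]_(y <- finmap.enum_fset F) (X `&` [set z | cnorm (z - y) < e y])))).
  by apply: le_measure; rewrite ?inE.
have : forall y, y \in finmap.enum_fset F -> B y by move=> y /FB; rewrite inE.
elim: (finmap.enum_fset F) => [|y s IH] sB; first by rewrite big_nil measure0.
rewrite big_cons; apply: (le_trans (measureU2 _ _ _)); first exact: mball.
  exact: mbig.
have [_ ey] := eP y (sB y (mem_head _ _)).
rewrite -[leRHS]adde0; apply: leeD; first by rewrite le_eqVlt; apply/orP; left; apply/eqP;
  exact: ey.
by apply: IH => t ts; apply: sB; rewrite inE ts orbT.
Qed.

Section Trivial.
Variable X : set R[i].
Hypothesis compactX : compact X.
Hypothesis separation : forall x y, X x -> X y -> y <> x ->
  ~ (segmentI R x /\ segmentI R y) ->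
  exists f, [/\ rational_algebra X f, f x <> 0 &
    \forall z \near within X (nbhs y), f z = 0].

Lemma off_segment_continuity x : (X `\` segmentI R) x ->
  point_of_continuity X (rational_algebra X) x.
Proof.
move=> [Xx nIx]; split=> // -[y [Xy yx J]].
have [|f [Af fx fy]] := separation Xx Xy yx; first by case.
by have [] := J f (conj Af fy).
Qed.

Let mX : measurable (X : set borel).
Proof. by apply: closed_borel; apply: compact_closed => //; exact: (@norm_hausdorff R[i] R[i]). Qed.

Lemma rational_algebra_poly (p : {poly R[i]}) : rational_algebra X (horner p).
Proof.
split; first exact/continuous_subspaceT/continuous_horner.
move=> e e0; exists (horner p).
  by exists p, 1 => z _; rewrite hornerC oner_neq0 divr1.
apply: le_lt_trans (_ : (0%:E < e%:E)%E); last by rewrite lte_fin.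
by apply: supnorm_le => z _; rewrite subrr cnorm0.
Qed.

Section Fixed.
Variables (x : R[i]) (mu : probability borel R).
Hypothesis Xx : X x.
Hypothesis jensen : jensen_measure X (rational_algebra X) (fun f => f x) mu.

Let muX : mu X = 1%E. Proof. by case: jensen. Qed.
Let reg : regular_measure mu. Proof. by case: jensen. Qed.
Let ineq f : rational_algebra X f -> (lne (cnorm (f x))%:E <=
  \int[mu]_(z in X) lne (cnorm (f z))%:E)%E.
Proof. by case: jensen => _ _; apply. Qed.

Lemma jensen_null_separated y : X y -> y <> x -> ~ (segmentI R x /\ segmentI R y) ->
  exists2 e : R, 0 < e & mu (X `&` [set z : borel | cnorm ((z : R[i]) - y) < e]) = 0%E.
Proof.
move=> Xy yx nI; have [f [Af fx fy]] := separation Xx Xy yx nI.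
have /nbhs_cnormP[e e0 eP] : nbhs y [set z | X z -> f z = 0] := fy.
exists e => //.
pose V : set borel := X `&` [set z : borel | cnorm ((z : R[i]) - y) < e].
suff : mu V = 0%E by [].
have mV : measurable V by apply: measurableI => //; apply: open_borel; exact: open_cball.
have [C C0 fC] := rational_algebra_bounded compactX Af.1.
apply: contrapT => V0.
have := ineq Af; have fx0 : 0 < cnorm (f x) by rewrite cnorm_gt0; exact/eqP.
rewrite lne_EFin //; apply/negP; rewrite -ltNge.
have C1 : 0 < C + 1 by rewrite ltr_wpDr.
have muV : (0 < mu V)%E by rewrite lt_neqAle measure_ge0 andbT eq_sym; exact/eqP.
apply: le_lt_trans (@integral_le_bounds mu X X V _ `|ln (C + 1)| +oo%E 1%E (mu V) muX erefl mX mV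
    _ _ _ _ _ _ _) _ => //.
- by move=> z [].
- move=> z Xz; apply: (@le_trans _ _ (lne (C + 1)%:E)).
    rewrite lee_lne ?in_itv /= ?lee_fin ?leey ?cnorm_ge0 ?(ltW C1) //.
    by rewrite (le_trans (fC z Xz)) // lerDl.
  by rewrite lne_EFin // lee_fin ler_norm.
- by move=> z [Xz zy]; rewrite (eP z zy Xz) cnorm0 le0_lneNy.
- by rewrite mule1 gt0_mulye // addeNy ltNyr.
Qed.

(* The witness is a polynomial equal to 1 at [x] and of modulus at most 1 on the
   segment, strictly smaller near [y]. *)
Lemma jensen_null_segment y : segmentI R x -> segmentI R y -> y <> x ->
  mu (X `\` segmentI R) = 0%E ->
  exists2 e : R, 0 < e & mu (X `&` [set z : borel | cnorm ((z : R[i]) - y) < e]) = 0%E.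
Proof.
move=> Ix Iy yx nullI.
have /segmentIP[a sa ax] := Ix; have /segmentIP[b sb by_] := Iy.
have h0 : 0 < `|b - a| / 2.
  rewrite divr_gt0 // normr_gt0 subr_eq0; apply/eqP => ba.
  by apply: yx; rewrite ax by_ ba.
(* Within [h] of [y] the points of I are at distance at least [h] from [x], so the polynomial is at
   most [1 - h ^+ 2] there. As [h] is at most 1/2, this bound is positive and its logarithm
   finite. *)
pose h := `|b - a| / 2; exists h => //.
pose p : {poly R[i]} := 1 - ('X - x%:P) ^+ 2.
have pE z : p.[z] = 1 - (z - x) ^+ 2 by rewrite !hornerE.
have mN : measurable ((X `\` segmentI R) : set borel).
  by apply: measurableD => //; apply: closed_borel; exact: closed_segmentI.
pose V : set borel := (X `&` [set z : borel | cnorm ((z : R[i]) - y) < h]) `&` segmentI R.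
have mV : measurable V.
  apply: measurableI; last by apply: closed_borel; exact: closed_segmentI.
  by apply: measurableI => //; apply: open_borel; exact: open_cball.
have pI t : segment_pt t -> cnorm (p.[t%:C]) = 1 - (t - a) ^+ 2.
  move=> st; rewrite pE ax -rmorphB -rmorphXn -(rmorph1 (real_complex R)) -rmorphB cnorm_real.
  rewrite ger0_norm // subr_ge0 -real_normK ?num_real // exprn_ile1 //.
  by rewrite ler_norml; move: st sa; rewrite /segment_pt; lra.
have ab1 : `|b - a| <= 1.
  by rewrite ler_norml; move: sb sa; rewrite /segment_pt; lra.
have k0 : 0 < 1 - h ^+ 2 by rewrite /h; nra.
have k1 : 1 - h ^+ 2 < 1 by rewrite gtrBl exprn_gt0.
have [C C0 fC] := rational_algebra_bounded compactX (rational_algebra_poly p).1.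
have C1 : 0 < C + 1 by rewrite ltr_wpDr.
have px : cnorm p.[x] = 1 by rewrite pE subrr expr0n subr0 cnorm1.
have := ineq (rational_algebra_poly p); rewrite px lne1 => H.
have lnk : ln (1 - h ^+ 2) < 0 by rewrite ln_lt0 // k0.
(* Off I the polynomial may exceed 1 in modulus; that part of X is null and contributes nothing. *)
have := @integral_le_bounds mu X (X `\` segmentI R) V (fun z => lne (cnorm p.[z])%:E)
  `|ln (C + 1)| (- ln (1 - h ^+ 2))%:E 0%E (mu V) nullI erefl mN mV.
rewrite mule0 => H'.
have {}H' : (\int[mu]_(z in X) lne (cnorm p.[z])%:E <= 0 - (- ln (1 - h ^+ 2))%:E * mu V)%E.
  apply: H' => //.
  - by move=> z [[]].
  - by rewrite lee_fin oppr_ge0 ltW.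
  - move=> z Xz nz; have [Iz|nIz] := pselect (segmentI R z); last by exfalso; apply: nz.
    have /segmentIP[t st ->] := Iz; rewrite pI // lne_le0 lee_fin gerBl sqr_ge0 //.
  - move=> z [Xz _]; apply: (@le_trans _ _ (lne (C + 1)%:E)).
      rewrite lee_lne ?in_itv /= ?lee_fin ?leey ?cnorm_ge0 ?(ltW C1) //.
      by rewrite (le_trans (fC z Xz)) // lerDl.
    by rewrite lne_EFin // lee_fin ler_norm.
  - move=> z [[Xz zy] /segmentIP[t st zt]].
    have tb : `|t - b| < h by move: zy; rewrite /= zt by_ -rmorphB cnorm_real.
    rewrite zt pI // -EFinN opprK -lne_EFin // lee_lne ?in_itv /= ?lee_fin ?leey ?(ltW k0) //.
      rewrite lerB // -[(t - a) ^+ 2]real_normK ?num_real // lerXn2r ?nnegrE ?(ltW h0) //.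
      have := ler_normD (b - t) (t - a); rewrite addrA subrK (distrC b t).
      by move: tb; rewrite /h; lra.
    rewrite subr_ge0 -real_normK ?num_real // exprn_ile1 //.
    by rewrite ler_norml; move: st sa; rewrite /segment_pt; lra.
have muV : mu V = 0%E.
  apply/eqP; rewrite eq_le measure_ge0 andbT.
  have := le_trans H H'; rewrite add0e leeNr oppe0 => H2.
  by rewrite -(@pmule_rle0 _ (- ln (1 - h ^+ 2))%:E) // lte_fin oppr_gt0.
apply/eqP; rewrite eq_le measure_ge0 andbT.
pose B : set borel := X `&` [set z : borel | cnorm ((z : R[i]) - y) < h].
suff : (mu B <= 0)%E by [].
have -> : B = V `|` (B `\` segmentI R) by rewrite /V setUIDK.
apply: (le_trans (measureU2 _ _ _)) => //.
  by apply: measurableD; [|apply: closed_borel; exact: closed_segmentI];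
    apply: measurableI => //; apply: open_borel; exact: open_cball.
have null_le (E : set borel) : mu E = 0%E -> (mu E <= 0)%E by move=> ->.
rewrite -[leRHS]adde0; apply: leeD; first exact: null_le.
apply: (@le_trans _ _ (mu ((X `\` segmentI R) : set borel))); last exact: null_le.
apply: le_measure; rewrite ?inE //; last by move=> z [[]].
by apply: measurableD; [|apply: closed_borel; exact: closed_segmentI]; apply: measurableI => //;
  apply: open_borel; exact: open_cball.
Qed.

Lemma jensen_dirac (B : set borel) : measurable B -> mu B = \d_(x : borel) B.
Proof.
move=> mB.
have mx : measurable ([set x] : set borel) by apply: closed_borel; exact: closed_cset1.
have nullx : mu (X `\` [set x]) = 0%E.
  apply: (null_of_local_null reg mX) => [||y [Xy yx]]; [exact: measurableD|by move=> z []|].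
  (* When both points lie on I, every point off I is still separated from [x]. This first makes the
     complement of I null, as the peaking polynomial requires. *)
  have [Ixy|nIxy] := pselect (segmentI R x /\ segmentI R y); last exact: jensen_null_separated.
  case: Ixy => Ix Iy; apply: jensen_null_segment => //.
  apply: (null_of_local_null reg mX) => [||z [Xz nIz]].
  - by apply: measurableD => //; apply: closed_borel; exact: closed_segmentI.
  - by move=> z [].
  - apply: jensen_null_separated => //; first by move=> zx; apply: nIz; rewrite zx.
    by case.
have null_le (E : set borel) : mu E = 0%E -> (mu E <= 0)%E by move=> ->.
have nullc : mu (~` [set x] : set borel) = 0%E.
  have -> : ~` [set x] = (~` X) `|` (X `\` [set x]).
    apply/seteqP; split=> z /=.
      by move=> zx; have [Xz|nXz] := pselect (X z); [right|left].
    by case=> [nXz zx|[]//]; apply: nXz; rewrite zx.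
  apply/eqP; rewrite eq_le measure_ge0 andbT; apply: (le_trans (measureU2 _ _ _)).
  - exact: measurableC.
  - exact: measurableD.
  have nX : mu (~` X : set borel) = 0%E.
    transitivity (1 - 1 : \bar R)%E; last exact: subee.
    by rewrite probability_setC //; congr (1 - _)%E; exact: muX.
  by rewrite -[leRHS]adde0; apply: leeD; exact: null_le.
have mcx : measurable (~` [set x] : set borel) by exact: measurableC.
have sub_null (E : set borel) : measurable E -> ~ E x -> mu E = 0%E.
  move=> mE nEx; apply/eqP; rewrite eq_le measure_ge0 andbT.
  apply: (@le_trans _ _ (mu (~` [set x] : set borel))); last exact: null_le.
  by apply: le_measure; rewrite ?inE // => z Ez zx; apply: nEx; rewrite -zx.
rewrite diracE; have [Bx|nBx] := pselect (B x); last first.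
  by rewrite memNset // sub_null.
have mBc : measurable (~` B) by exact: measurableC.
rewrite mem_set //= -[B]setCK (probability_setC mu mBc).
transitivity (1 - 0 : \bar R)%E; last by rewrite sube0.
by congr (1 - _)%E; apply: sub_null => //; apply.
Qed.

End Fixed.

Lemma trivial_jensen_measures : no_nontrivial_jensen_measure X (rational_algebra X).
Proof. by move=> x Xx mu J B mB; exact: jensen_dirac. Qed.

End Trivial.
End JensenMeasures.

(** * Construction of the cheese *)

Section Construction.
Variable R : realType.

Lemma rational_within_continuous (X : set R[i]) g :
  rational_functions X g -> {within X, continuous g}.
Proof.
move=> [p [q pq]]; apply/within_continuous_cnormP => z Xz e e0.
have [qz gz] := pq z Xz; pose N := q.[z] *: p - p.[z] *: q.
have qz0 : 0 < cnorm q.[z] by rewrite cnorm_gt0.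
have cN : {for z, continuous (fun w => N.[w])} := @continuous_horner R N z.
have cq : {for z, continuous (fun w => q.[w])} := @continuous_horner R q z.
have [|d1 d10 d1P] := (continuous_cnormP _ z).1 cq (cnorm q.[z] / 2).
  by rewrite divr_gt0.
have [|d2 d20 d2P] := (continuous_cnormP _ z).1 cN (e * (cnorm q.[z] / 2 * cnorm q.[z])).
  by rewrite !mulr_gt0 ?divr_gt0.
exists (Num.min d1 d2); first by rewrite lt_min d10.
move=> w Xw; rewrite lt_min => /andP[/d1P w1 /d2P w2].
have [qw gw] := pq w Xw.
have qw0 : 0 < cnorm q.[w] by rewrite cnorm_gt0.
have Nz : N.[z] = 0 by rewrite /N !hornerE mulrC subrr.
have -> : g w - g z = (N.[w] - N.[z]) / (q.[w] * q.[z]).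
  by rewrite Nz subr0 gw gz /N !hornerE; field; rewrite qw qz.
rewrite cnormM cnormV cnormM ltr_pdivrMr ?mulr_gt0 // (lt_le_trans w2) //.
rewrite ler_wpM2l ?(ltW e0) // ler_wpM2r ?cnorm_ge0 //.
have := cnormB q.[w] (q.[w] - q.[z]); rewrite subKr; lra.
Qed.

Lemma rational_algebra_limit (X : set R[i]) f :
  (forall e : R, 0 < e -> exists2 g, rational_functions X g &
     forall z, X z -> cnorm (f z - g z) <= e) -> rational_algebra X f.
Proof.
move=> H; split.
  apply/within_continuous_cnormP => z Xz e e0.
  have [|g Rg fg] := H (e / 4); first by rewrite divr_gt0.
  have e4 : 0 < e / 4 by rewrite divr_gt0.
  have [d d0 dP] := (within_continuous_cnormP X g).1 (rational_within_continuous Rg) z Xz _ e4.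
  exists d => // w Xw wz; have := dP w Xw wz; have := fg w Xw; have := fg z Xz.
  have := cdistD (g w) (f w) (f z); have := cdistD (g z) (g w) (f z).
  by rewrite (cdistC (g z) (f z)); lra.
move=> e e0; have [|g Rg fg] := H (e / 2); first by rewrite divr_gt0.
exists g => //; apply: le_lt_trans (_ : ((e / 2)%:E < e%:E)%E); first exact: supnorm_le.
by rewrite lte_fin ltr_pdivrMr // ltr_pMr // ltr1n.
Qed.

(** The circle may surround I or leave it outside. The factor 2 leaves room for the holes, which lie
    up to [d] inside the circle and must keep the distance [d] from I. *)
Definition clear_circle (a : R[i]) (r d : R) :=
  [/\ 0 < r, 0 < d & forall x, segment_pt x -> 2 * d <= `|cnorm (x%:C - a) - r| ].

(* Only countably many circles are available, hence the rational data. *)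
Lemma rat_circle (a : R[i]) (r g : R) (x y : R[i]) : 0 < r -> 0 < g ->
  cnorm (x - a) + g <= r -> r + g <= cnorm (y - a) ->
  (forall t, segment_pt t -> g <= `|cnorm (t%:C - a) - r|) ->
  exists (u v w : rat) (d : R), let a' := (ratr u : R) +i* (ratr v : R) in
    [/\ clear_circle a' (ratr w) d, cnorm (x - a') < ratr w & ratr w < cnorm (y - a')].
Proof.
move=> r0 g0 xa ya ta; case: a xa ya ta => a1 a2 xa ya ta.
have [|u] := @rat_in_itvoo R a1 (a1 + g / 8); first by rewrite ltrDl divr_gt0.
rewrite in_itv /= => /andP[u1 u2].
have [|v] := @rat_in_itvoo R a2 (a2 + g / 8); first by rewrite ltrDl divr_gt0.
rewrite in_itv /= => /andP[v1 v2].
have [|w] := @rat_in_itvoo R r (r + g / 4); first by rewrite ltrDl divr_gt0.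
rewrite in_itv /= => /andP[w1 w2].
exists u, v, w, (g / 4); set a' := _ +i* _.
have aa' : cnorm (a1 +i* a2 - a') <= g / 4.
  apply: le_trans (cnorm_le_ReIm _) _; rewrite !raddfB /=.
  by rewrite !ltr0_norm; lra.
split.
- split; [lra|by rewrite divr_gt0|move=> t st].
  have := ta t st; have := cnorm_distl (t%:C - (a1 +i* a2)) (t%:C - a').
  have -> : t%:C - (a1 +i* a2) - (t%:C - a') = - (a1 +i* a2 - a') by ring.
  rewrite cnormN; set A := cnorm _; set B := cnorm (t%:C - a') => h1 h2.
  have : `|A - r| <= `|A - B| + `|B - ratr w| + `|ratr w - r|.
    have -> : A - r = (A - B) + (B - ratr w) + (ratr w - r) by ring.
    by rewrite (le_trans (ler_normD _ _)) // lerD2r ler_normD.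
  have : `|ratr w - r| <= g / 4 by rewrite gtr0_norm; lra.
  by lra.
- have := cdistD (a1 +i* a2) x a'; lra.
- have := cdistD a' y (a1 +i* a2); rewrite (cdistC a'); lra.
Qed.

(** The switching function is nonzero inside, so [x] has to be inside and [y] outside. If [x] is off
    I, a small circle around it will do. If [x] is on I, the circle surrounds the whole of I and
    excludes [y]. *)
Lemma separating_circle (x y : R[i]) : y <> x -> ~ (segmentI R x /\ segmentI R y) ->
  exists (a : R[i]) (r g : R), [/\ 0 < r, 0 < g, cnorm (x - a) + g <= r,
    r + g <= cnorm (y - a) & forall t, segment_pt t -> g <= `|cnorm (t%:C - a) - r| ].
Proof.
move=> yx nI; have [Ix|nIx] := pselect (segmentI R x); last first.
  have : nbhs x (~` segmentI R).
    by apply: open_nbhs_nbhs; split=> //; rewrite openC; exact: closed_segmentI.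
  move=> /nbhs_cnormP[e e0 eP]; pose m := Num.min e (cnorm (y - x)).
  have yx0 : 0 < cnorm (y - x) by rewrite cnorm_gt0 subr_eq0; exact/eqP.
  have m0 : 0 < m by rewrite lt_min e0.
  have m1 : m <= e by rewrite /m ge_min lexx.
  have m2 : m <= cnorm (y - x) by rewrite /m ge_min lexx orbT.
  have m20 : 0 < m / 2 by rewrite divr_gt0.
  have mm : m / 2 + m / 2 = m by rewrite -splitr.
  exists x, (m / 2), (m / 2); rewrite subrr cnorm0 add0r mm; split=> //.
  move=> t st; have te : e <= cnorm (t%:C - x).
    by rewrite leNgt; apply/negP => /eP; apply; apply/segmentIP; exists t.
  by rewrite ger0_norm; lra.
have nIy : ~ segmentI R y by move=> Iy; apply: nI.
have /segmentIP[x0 sx ->] := Ix.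
have sgn (t : R) : segment_pt t -> `|t| <= 2^-1 by rewrite /segment_pt ler_norml.
case: y nIy {yx nI} => u v nIy.
have [v0|v0] := eqVneq v 0.
  have u2 : 2^-1 < `|u|.
    rewrite ltNge; apply/negP => u2; apply: nIy; apply/segmentIP; exists u.
      by rewrite /segment_pt -ler_norml.
    by rewrite v0.
  exists 0, ((`|u| + 2^-1) / 2), ((`|u| - 2^-1) / 2).
  have cu : cnorm (u +i* v - 0) = `|u| by rewrite subr0 v0 -cnorm_real.
  rewrite cu !subr0 cnorm_real; have := sgn _ sx; split; try lra.
  move=> t st; rewrite subr0 cnorm_real; have := sgn _ st => t2.
  by rewrite (@ler0_norm _ (`|t| - _)); lra.
(* The centre lies on the imaginary axis, on the other side of I from [y], at height [T]. It is
   within [S] of all of I and at distance at least |v| + T from [y]. With this [T], the square of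
   the latter is v^2 + 1/2 + T^2, which exceeds S^2 = T^2 + 1/4. *)
pose T := (4 * `|v|)^-1; pose sg : R := Num.sg v.
have v_gt0 : 0 < `|v| by rewrite normr_gt0.
have T0 : 0 < T by rewrite invr_gt0 mulr_gt0.
have vT : `|v| * T = 4^-1 by rewrite /T invfM mulrCA mulfV ?mulr1 // gt_eqF.
pose S := Num.sqrt (T ^+ 2 + 4^-1).
have S2 : S ^+ 2 = T ^+ 2 + 4^-1 by rewrite sqr_sqrtr // addr_ge0 ?sqr_ge0.
have S0 : 0 <= S by exact: sqrtr_ge0.
have Sv : S < `|v| + T.
  rewrite -(ltr_pXn2r (n := 2)) ?nnegrE ?addr_ge0 ?(ltW T0) //.
  rewrite S2 sqrrD; have : 0 < `|v| ^+ 2 by rewrite exprn_gt0.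
  by rewrite vT -mulr_natr; lra.
pose a : R[i] := 0 +i* (- (sg * T)).
have sgT : `|- (sg * T)| = T by rewrite normrN normrM normr_sg v0 mul1r gtr0_norm.
have ta (t : R) : segment_pt t -> cnorm (t%:C - a) <= S.
  move=> st; rewrite /cnorm /S /= subr0 opprK add0r ler_wsqrtr //.
  rewrite exprMn sqr_sg v0 mul1r addrC lerD2l -real_normK ?num_real //.
  have -> : 4^-1 = 2^-1 ^+ 2 :> R by rewrite expr2; field.
  by rewrite lerXn2r ?nnegrE ?invr_ge0 ?sgn.
have ya : `|v| + T <= cnorm (u +i* v - a).
  apply: le_trans (Im_le_cnorm _); rewrite raddfB /= opprK.
  have -> : v + sg * T = sg * (`|v| + T) by rewrite mulrDr /sg -numEsg.
  by rewrite normrM normr_sg v0 mul1r ler_norm.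
exists a, ((S + (`|v| + T)) / 2), ((`|v| + T - S) / 2).
have := ta _ sx; split; try lra.
by move=> t /ta h; rewrite (@ler0_norm _ (cnorm _ - _)); lra.
Qed.

Lemma clear_circles : exists (a : nat -> R[i]) (r d : nat -> R),
  (forall j, clear_circle (a j) (r j) (d j)) /\
  forall x y, y <> x -> ~ (segmentI R x /\ segmentI R y) ->
    exists j, cnorm (x - a j) < r j /\ r j < cnorm (y - a j).
Proof.
pose A (t : rat * rat * rat) : R[i] := (ratr t.1.1 : R) +i* (ratr t.1.2 : R).
have : forall j, exists ard : R[i] * R * R, clear_circle ard.1.1 ard.1.2 ard.2 /\
    forall t : rat * rat * rat, unpickle j = Some t ->
      (exists d, clear_circle (A t) (ratr t.2) d) -> ard.1 = (A t, ratr t.2).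
  (* A default circle, for the integers that do not encode a rational circle missing I. *)
  have c0 : clear_circle 0 (3 / 4) (1 / 8).
    split; [lra|lra|move=> x sx].
    have -> : cnorm (x%:C - 0) = `|x| by rewrite subr0 cnorm_real.
    have : `|x| <= 2^-1 by rewrite ler_norml.
    by move=> h; rewrite (@ler0_norm _ (`|x| - _)); lra.
  move=> j; case: (unpickle j) => [t|]; last by exists (0, 3 / 4, 1 / 8).
  have [[d cd]|nd] := pselect (exists d, clear_circle (A t) (ratr t.2) d).
    by exists (A t, ratr t.2, d); split=> // t' [<-].
  by exists (0, 3 / 4, 1 / 8); split=> // t' [<-].
move=> /choice[ard ardP].
exists (fun j => (ard j).1.1), (fun j => (ard j).1.2), (fun j => (ard j).2).
split=> [j|x y yx nI]; first by case: (ardP j).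
have [a [r [g [r0 g0 xa ya ta]]]] := separating_circle yx nI.
have [u [v [w [d [cd xw yw]]]]] := rat_circle r0 g0 xa ya ta.
exists (pickle (u, v, w)); have [_ H] := ardP (pickle (u, v, w)).
by rewrite (H (u, v, w)) ?pickleK //; exists d.
Qed.

End Construction.

(** * Simultaneous choice of all parameters; the cheese as a sequence of discs *)

Section CheeseData.
Variable R : realType.

(** The estimates need a clearance valid for all levels up to a given one, hence the minimum; the
    cap 1/2 takes care of the outer circle. *)
Lemma running_minimum (d : nat -> R) : (forall j, 0 < d j) ->
  exists delta : nat -> R, [/\ forall j, 0 < delta j,
    forall i j, (i <= j)%N -> delta j <= delta i, delta 0%N * 2 <= 1 &
    forall j, delta j <= d j].
Proof.
move=> d_gt0; pose delta := fix m j : R :=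
  if j is j'.+1 then Num.min (m j') (d j) else Num.min (d 0%N) (2^-1).
exists delta; split.
- by elim=> [|j IHj] /=; rewrite lt_min ?IHj d_gt0 //= invr_gt0.
- move=> i j ij; rewrite -(subnK ij); elim: (j - i)%N => // k IHk.
  by rewrite addSn /= ge_min IHk.
- have : delta 0%N <= 2^-1 by rewrite /= ge_min lexx orbT.
  by move: (delta 0%N) => x; lra.
- by case=> [|j] /=; rewrite ge_min lexx ?orbT.
Qed.

Lemma small_weights (delta W : nat -> R) : (forall j, 0 < delta j) ->
  (forall i j, (i <= j)%N -> delta j <= delta i) -> delta 0%N * 2 <= 1 ->
  (forall j, 0 <= W j) ->
  exists eps : nat -> R, [/\ forall j, 0 < eps j,
    forall m J, \sum_(m <= j < J) eps j <= delta m / 8,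
    forall J, \sum_(0 <= j < J) eps j <= 1 &
    forall j, eps j * W j <= 2 ^- j].
Proof.
move=> d0 dm d1 W0.
have W1 j : 0 < 1 + W j by rewrite ltr_wpDr.
have tw j : (0 : R) < 2 ^- j by rewrite invr_gt0 exprn_gt0.
(* Since [delta] is nonincreasing, the tail from [m] on is at most [delta m / 16] times a geometric
   sum bounded by 2; dividing by [1 + W j] meets the last requirement. *)
pose eps j := 2 ^- j * (delta j / 16 / (1 + W j)).
have dW j : 0 < delta j / 16 by rewrite divr_gt0.
have q0 j : 0 < delta j / 16 / (1 + W j) by rewrite divr_gt0.
have tail m J : \sum_(m <= j < J) eps j <= delta m / 8.
  apply: (@le_trans _ _ (\sum_(m <= j < J) 2 ^- j * (delta m / 16))).
    rewrite [leLHS]big_nat [leRHS]big_nat ler_sum // => j /andP[mj _].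
    apply: ler_wpM2l; first exact: ltW (tw j).
    rewrite ler_pdivrMr //; apply: (@le_trans _ _ (delta j / 16)).
      by rewrite ler_wpM2r ?dm.
    have := dm _ _ mj; have := W0 j; have := d0 j; have := dW j.
    move=> a b c e; rewrite mulrDr mulr1; apply: le_trans (_ : delta m / 16 <= _).
      by rewrite ler_wpM2r.
    by rewrite lerDl; apply: mulr_ge0 => //; exact: ltW (dW m).
  rewrite -mulr_suml; apply: le_trans (_ : 2 * (delta m / 16) <= _); last by lra.
  apply: ler_wpM2r; first exact: ltW (dW m).
  apply: le_trans (sum_exp2V _ _ _) _; rewrite ler_pdivrMr ?exprn_gt0 //.
  by rewrite ler_peMr // exprn_ege1 // ler1n.
exists eps; split=> //.
- by move=> j; rewrite mulr_gt0.
- move=> J; apply: le_trans (tail 0%N J) _; move: (delta 0%N) d1 => x; lra.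
- move=> j; have -> : eps j * W j = 2 ^- j * (delta j / 16 / (1 + W j) * W j).
    exact: esym (mulrA _ _ _).
  apply: ler_piMr; first exact: ltW (tw j).
  rewrite [_ / _ * _]mulrAC ler_pdivrMr // mul1r.
  have h : delta j / 16 <= 1.
    have := dm 0%N j isT; move: (delta 0%N) (delta j) d1 => x y; lra.
  apply: le_trans (_ : W j <= _); first by rewrite ler_piMl.
  by rewrite lerDr.
Qed.

Lemma sum_sub_le (I : eqType) (s t : seq I) (F : I -> R) : uniq s -> uniq t ->
  {subset s <= t} -> (forall i, 0 <= F i) ->
  \sum_(i <- s) F i <= \sum_(i <- t) F i.
Proof.
move=> us ut st F0.
have p : perm_eq s [seq i <- t | i \in s].
  apply: uniq_perm => //; first exact: filter_uniq.
  by move=> i; rewrite mem_filter andb_idr //; exact: st.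
rewrite (perm_big _ p) big_filter big_mkcond /= ler_sum // => i _.
by case: ifP.
Qed.

Lemma cheese_indices_uniq J : uniq (cheese_indices J).
Proof.
have u : uniq (index_iota 0 J) by exact: iota_uniq.
apply: allpairs_uniq => //; last by move=> [[? ?] ?] [[? ?] ?] _ _ [-> -> ->].
by apply: allpairs_uniq => // -[? ?] [? ?] _ _ [-> ->].
Qed.

Lemma nat3_enum : exists2 g : nat -> nat * nat * nat, injective g &
  forall t, exists n, g n = t.
Proof.
have /card_set_bijP[f [_ fi fs]] : ([set: nat] #= [set: nat * nat])%card.
  by rewrite card_eq_sym; exact: card_nat2.
pose g n := (f (f n).1, (f n).2); exists g.
  move=> m n [e1 e2].
  have fI x y : f x = f y -> x = y by apply: fi; rewrite inE.
  by apply/fI; rewrite [f m]surjective_pairing [f n]surjective_pairing (fI _ _ e1) e2.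
move=> [[a b] c]; have [n1 _ fn1] := fs (a, b) I; have [n _ fn] := fs (n1, c) I.
by exists n; rewrite /g fn /= fn1.
Qed.

Lemma swiss_cheese_cheese (eps : nat -> R) (c : nat -> nat -> nat -> R[i])
    (r : nat -> nat -> nat -> R) :
  (forall j s k, 0 < r j s k) ->
  (forall j S N, \sum_(s < S) \sum_(k < N) r j s k <= eps j) ->
  (forall J, \sum_(0 <= j < J) eps j <= 1) -> swiss_cheese (cheese c r).
Proof.
move=> r_gt0 r_sum eps_sum; split; first exact: compact_cheese.
have [g gI gS] := nat3_enum.
exists (fun n => c (g n).1.1 (g n).1.2 (g n).2), (fun n => r (g n).1.1 (g n).1.2 (g n).2).
split=> //.
- apply: le_lt_trans (_ : (_ <= 1%:E)%E) _; last exact: ltry.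
  apply: lime_le; first by apply: is_cvg_nneseries => n _ _; rewrite lee_fin ltW.
  apply: nearW => N; rewrite sumEFin lee_fin.
  (* The first [N] triples of the enumeration lie in a cube of side [J], over which the radii are
     already summed. *)
  pose J := (\max_(n < N) maxn (g n).1.1 (maxn (g n).1.2 (g n).2)).+1.
  rewrite -(big_map g xpredT (fun t => r t.1.1 t.1.2 t.2)).
  apply: (@le_trans _ _ (\sum_(t <- cheese_indices J) r t.1.1 t.1.2 t.2)).
    apply: sum_sub_le; rewrite ?cheese_indices_uniq ?(map_inj_uniq gI) ?iota_uniq //.
      move=> _ /mapP[n nN ->]; rewrite mem_index_iota /= in nN.
      have := @leq_bigmax _ (fun i : 'I_N => maxn (g i).1.1 (maxn (g i).1.2 (g i).2)) (Ordinal nN).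
      rewrite /= !geq_max => /and3P[h1 h2 h3].
      by case: (g n) h1 h2 h3 => -[x y] z /= h1 h2 h3; rewrite mem_cheese_indices !ltnS h1 h2.
    by move=> t; exact: ltW.
  have := @weighted_holes R eps c r r_sum (fun=> 1) J (fun=> ler01).
  rewrite /weighted /holes big_map; under eq_bigr do rewrite mulr1.
  under [X in _ <= X]eq_bigr do rewrite mulr1.
  by move=> /le_trans; apply.
- apply/seteqP; split=> z /=.
    move=> [z1 zr]; split; first by rewrite norm_cnorm lecR.
    by move=> [n _] /ballE; rewrite ltNge zr.
  rewrite norm_cnorm lecR => -[z1 zr]; split=> // j s k.
  rewrite leNgt; apply/negP => h; apply: zr.
  have [n gn] := gS (j, s, k); exists n => //; apply/ballE.
  by rewrite gn.
Qed.

(** The dependencies run one way: the circles fix [delta], then [bb] and [s] depend on [delta]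
    alone, and [eps] comes last. The demands on [eps j] are indexed by [i <= j], so one finite sum
    [W j] dominates them all. *)
Lemma cheese_parameters : exists (a : nat -> R[i]) (rr delta eps : nat -> R)
    (bb : nat -> nat) (s : nat -> seq (R[i] * R)),
  [/\ [/\ forall j, 0 < delta j, forall i j, (i <= j)%N -> delta j <= delta i,
    delta 0%N * 2 <= 1, forall j, 0 < eps j &
    forall m J, \sum_(m <= j < J) eps j <= delta m / 8],
   [/\ forall J, \sum_(0 <= j < J) eps j <= 1,
    forall j, clear_circle (a j) (rr j) (delta j) &
    forall x y, y <> x -> ~ (segmentI R x /\ segmentI R y) ->
    exists j, cnorm (x - a j) < rr j /\ rr j < cnorm (y - a j)],
   [/\ forall N : nat, (N <= bb N)%N,
     forall N : nat, N%:R / (delta N / 2) ^+ 3 <= \sum_(1 <= k < (bb N).+1) k%:R^-1 &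
     forall i j : nat, (i <= j)%N -> eps j / (delta j / 2) ^+ (bb i).+1 <= 2 ^- j] &
   [/\ forall N l, l \in s N -> left_pt l.2,
     forall N w, away (delta N / 2) w ->
       cnorm ((w - (2^-1)%:C)^-1 - kernel_sum (s N) w) <= 2 ^- N &
     forall i j : nat, (i <= j)%N ->
       eps j * ((1 + \sum_(l <- s i) cnorm l.1) / (delta j / 2)) <= 2 ^- j]].
Proof.
have [a [rr [d [ad sep]]]] := clear_circles R.
have [|delta [d0 dm d1 dd]] := @running_minimum d; first by move=> j; case: (ad j).
have dh j : 0 < delta j / 2 by rewrite divr_gt0.
have /choice[bb bbP] : forall N : nat, exists n : nat, (N <= n)%N /\
    N%:R / (delta N / 2) ^+ 3 <= \sum_(1 <= k < n.+1) k%:R^-1 :> R.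
  move=> N; have [n Nn h] := harmonic_unbounded (N%:R / (delta N / 2) ^+ 3) N.
  by exists n.
have /choice[s sP] : forall N : nat, exists s : seq (R[i] * R),
    (forall l, l \in s -> left_pt l.2) /\
    forall w, away (delta N / 2) w -> cnorm ((w - (2^-1)%:C)^-1 - kernel_sum s w) <= 2 ^- N.
  move=> N; have e0 : (0 : R) < 2 ^- N by rewrite invr_gt0 exprn_gt0.
  by have [s s1 s2] := kernel_approx (dh N) e0; exists s.
pose A i j : R := ((delta j / 2) ^+ (bb i).+1)^-1.
pose B i j : R := (1 + \sum_(l <- s i) cnorm l.1) / (delta j / 2).
have A0 i j : 0 <= A i j by rewrite invr_ge0 exprn_ge0 // ltW.
have B0 i j : 0 <= B i j.
  apply: divr_ge0; last exact: ltW.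
  by rewrite addr_ge0 // sumr_ge0 // => l _; exact: cnorm_ge0.
pose W j := \sum_(0 <= i < j.+1) (A i j + B i j).
have W0 j : 0 <= W j by rewrite sumr_ge0 // => i _; rewrite addr_ge0.
have ABW i j : (i <= j)%N -> A i j + B i j <= W j.
  move=> ij; rewrite /W big_mkord (bigD1 (Ordinal (ij : (i < j.+1)%N))) //= lerDl.
  by rewrite sumr_ge0 // => k _; rewrite addr_ge0.
have [eps [e0 e_tail e_sum eW]] := small_weights d0 dm d1 W0.
exists a, rr, delta, eps, bb, s; split; split=> //.
- move=> j; have [r0 _ h] := ad j; split=> // x sx; apply: le_trans (h x sx).
  by rewrite ler_pM2l.
- by move=> N; case: (bbP N).
- by move=> N; case: (bbP N).
- move=> i j ij; apply: le_trans (eW j); apply: ler_wpM2l; first exact: ltW.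
  by apply: le_trans (ABW i j ij); rewrite lerDl.
- by move=> N; case: (sP N).
- by move=> N; case: (sP N).
- move=> i j ij; apply: le_trans (eW j); apply: ler_wpM2l; first exact: ltW.
  by apply: le_trans (ABW i j ij); rewrite lerDr.
Qed.

End CheeseData.

(** * Holes away from the segment, separation of points, and conclusion *)

Lemma clear_circle_dist (R : realType) (a z : R[i]) (r d x : R) :
  clear_circle a r d -> segment_pt x -> r - d <= cnorm (z - a) <= r ->
  d <= cnorm (z - x%:C).
Proof.
move=> [r0 d0 ard] sx /andP[z1 z2]; have := ard x sx.
have := cnorm_distl (x%:C - a) (z - a).
have -> : x%:C - a - (z - a) = x%:C - z by ring.
rewrite (cdistC x%:C z); move=> v1 v2.
by have [h|h] := ltP (cnorm (x%:C - a)) r;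
  [move: v2; rewrite (ltr0_norm (x := cnorm (x%:C - a) - r)) ?subr_lt0 //
  |move: v2; rewrite (ger0_norm (x := cnorm (x%:C - a) - r)) ?subr_ge0 //];
  move: v1; rewrite ler_norml => /andP[v1 v1']; lra.
Qed.

(** As [y] is strictly outside the circle, a whole neighbourhood of it is, and [F] vanishes there;
    the uniform rate makes [F] a limit of the rational functions [1 / q s]. *)
Lemma cheese_separation (R : realType) (X : set R[i]) (a : R[i]) (r K : R)
    (F : R[i] -> R[i]) (q : nat -> {poly R[i]}) (x y : R[i]) :
  (forall z, X z -> [/\ forall s : nat,
     (q s).[z] != 0 /\ cnorm (F z - ((q s).[z])^-1) <= K * 2 ^- s,
     r <= cnorm (z - a) -> F z = 0 & cnorm (z - a) < r -> F z != 0]) ->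
  X x -> cnorm (x - a) < r -> r < cnorm (y - a) ->
  [/\ rational_algebra X F, F x <> 0 & \forall z \near within X (nbhs y), F z = 0].
Proof.
move=> XF Xx xa ya; split.
- apply: rational_algebra_limit => e e0.
  have K1 : 0 < `|K| + 1 by rewrite ltr_wpDl.
  have [s sP] := exp2V_lt (divr_gt0 e0 K1).
  exists (fun z => ((q s).[z])^-1).
    exists 1, (q s) => z Xz; have [/(_ s)[qz _] _ _] := XF z Xz.
    by rewrite hornerC mul1r.
  move=> z Xz; have [/(_ s)[_ h] _ _] := XF z Xz; apply: le_trans h _.
  have t0 : (0 : R) < 2 ^- s by rewrite invr_gt0 exprn_gt0.
  apply: (@le_trans _ _ ((`|K| + 1) * 2 ^- s)).
    apply: ler_wpM2r; first exact: ltW.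
    by have := ler_norm K; lra.
  move: sP.
  by rewrite ltr_pdivlMr // mulrC => /ltW.
- by have [_ _ /(_ xa)/eqP] := XF x Xx.
- have d0 : 0 < cnorm (y - a) - r by rewrite subr_gt0.
  apply/nbhs_cnormP; exists (cnorm (y - a) - r) => // z zy Xz.
  have [_ h _] := XF z Xz; apply: h.
  have := cdistD z y a; rewrite (cdistC y z); lra.
Qed.

Theorem corollary6 (R : realType) :
  exists X : set (complex R),
    swiss_cheese X /\ segmentI R `<=` X /\
    (forall x, (X `\` segmentI R) x ->
       point_of_continuity X (rational_algebra X) x) /\
    (forall f, rational_algebra X f ->
       infinitely_derivable_on (segmentI R) f /\
       (\sum_(1 <= k <oo)
          inv_root k (supnorm (segmentI R) (derive_on_n (segmentI R) k f))
        = +oo)%E) /\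
    no_nontrivial_jensen_measure X (rational_algebra X) /\
    ~ regular_algebra X (rational_algebra X).
Proof.
have [a [rr [delta [eps [bb [s [[d0 dm d1 e0 e_tail] [e_sum clear sep]
  [bb1 bb2 bb3] [s1 s2 s3]]]]]]]] := cheese_parameters R.
have e_ge0 j : 0 <= eps j by exact: ltW.
have /choice[H HP] : forall j, exists H : (nat -> nat -> R[i]) * (nat -> nat -> R) *
    R * (R[i] -> R[i]) * (nat -> {poly R[i]}),
  let: (c, r, K, F, q) := H in
  [/\ forall s k, 0 < r s k,
    forall s k, rr j - delta j <= cnorm (c s k - a j) <= rr j,
    forall S N, \sum_(s < S) \sum_(k < N) r s k <= eps j &
    forall z, (forall s k, r s k <= cnorm (z - c s k)) ->
      [/\ forall s : nat, (q s).[z] != 0 /\ cnorm (F z - ((q s).[z])^-1) <= K * 2 ^- s,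
        rr j <= cnorm (z - a j) -> F z = 0 & cnorm (z - a j) < rr j -> F z != 0]].
  move=> j; have [rr0 _ _] := clear j.
  have [c [r [K [F [q h]]]]] := mckissick (a j) rr0 (d0 j) (e0 j).
  by exists (c, r, K, F, q).
pose c j := (H j).1.1.1.1; pose r j := (H j).1.1.1.2.
have r_gt0 j t k : 0 < r j t k.
  by rewrite /r; move: (HP j); case: (H j) => -[[[? ?] ?] ?] ? [].
have r_sum j S N : \sum_(t < S) \sum_(k < N) r j t k <= eps j.
  by rewrite /r; move: (HP j); case: (H j) => -[[[? ?] ?] ?] ? [].
have c_dist j t k x : segment_pt x -> delta j <= cnorm (c j t k - x%:C).
  move=> sx; apply: (clear_circle_dist (clear j)) sx _.
  by rewrite /c; move: (HP j); case: (H j) => -[[[? ?] ?] ?] ? [].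
pose X := cheese c r.
have separation x y : X x -> X y -> y <> x -> ~ (segmentI R x /\ segmentI R y) ->
    exists f : R[i] -> R[i], [/\ rational_algebra X f, f x <> 0
     & \forall z \near within X (nbhs y), f z = 0].
  move=> Xx _ yx nI; have [j [xj yj]] := sep x y yx nI.
  have XP z : X z -> forall t k, r j t k <= cnorm (z - c j t k) by case.
  move: XP (HP j); rewrite /r /c; case: (H j) => -[[[cj rj] K] F] q /= XP [_ _ _ FP].
  exists F; apply: (cheese_separation (a := a j) (r := rr j) (K := K) (q := q)) => //.
  by move=> z /XP/FP.
have seg x : segment_pt x -> X x%:C.
  exact: (segment_cheese d0 d1 r_gt0 r_sum c_dist e_tail).
have f_csum f : rational_algebra X f -> exists2 M : R, 1 <= M & forall e : R, 0 < e ->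
    exists T : seq (R[i] * R[i] * nat),
    [/\ forall t, t \in T -> forall x : R, segment_pt x ->
         delta t.2 / 2 <= cnorm (t.1.2 - x%:C),
       exists J : nat, forall b : nat -> R, monotone_weight b ->
         cweight b T <= M * (b 0%N + \sum_(0 <= j < J) eps j * b j)
     & forall x : R, segment_pt x -> cnorm (csum T x%:C - f x%:C) <= e].
  move=> Af; have [C C0 CP] := rational_algebra_bounded (@compact_cheese R c r) Af.1.
  exists (C + 1) => [|e e_gt0]; first by rewrite lerDr ltW.
  exact: (cheese_csum d0 d1 r_gt0 r_sum c_dist e_tail Af CP e_gt0).
exists X; split; first exact: swiss_cheese_cheese r_gt0 r_sum e_sum.
split; first by move=> z /segmentIP[x sx ->]; exact: seg.
split; first exact: off_segment_continuity separation.
split.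
  move=> f /f_csum[M M1 fM].
  exact: (smooth_slow_growth d0 dm d1 e_ge0 e_sum bb1 bb2 bb3 M1 fM).
split; first exact: (trivial_jensen_measures (@compact_cheese R c r) separation).
move=> /(_ [set x%:C | x in `[- 2^-1, 0]] (2^-1)%:C)[].
- exact (@closed_real_itv R (- 2^-1) 0).
- move=> z [x /=]; rewrite in_itv /= => /andP[x1 x2] <-; apply: seg.
  by rewrite /segment_pt x1 (le_trans x2) // invr_ge0.
- split; first by apply: seg; rewrite /segment_pt lexx andbT; lra.
  move=> [x /=]; rewrite in_itv /= => /andP[x1 x2] [xe].
  by move: x2; rewrite xe leNgt invr_gt0 ltr0n.
move=> f [Af fx f0]; have [M M1 fM] := f_csum f Af.
have M0 : 0 <= M by lra.
have fl x : left_pt x -> f x%:C = 0.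
  by move=> lx; apply: f0; exists x => //=; rewrite in_itv.
have := vanishing_propagates d0 dm e_ge0 e_sum s1 s2 s3 M0 fM fl.
by rewrite fx => /eqP; rewrite oner_eq0.
Qed.
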